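(* Fix integers $d\ge 7$ and $x=1+\lceil 3d/2\rceil$, and let $S\subset\mathbb{P}^3$ be a set of $x$ points. Then $S\in\mathbb{T}(3,d;x)'$ if and only if $S$ is contained in a rational normal curve of $\mathbb{P}^3$.
   Context: We work over an algebraically closed field of characteristic $0$. For a finite set $S\subset\mathbb{P}^n$, $\langle S\rangle$ is its linear span, and $2S\subset\mathbb{P}^n$ is the zero-dimensional scheme defined by the ideal sheaf $(\mathcal{I}_S)^2$ (the union of the double points supported at $S$). For a closed subscheme $Z\subset\mathbb{P}^n$, $h^i(\mathcal{I}_Z(d))=\dim H^i(\mathbb{P}^n,\mathcal{I}_Z(d))$. $\mathbb{T}(n,d;x)$ is the set of all subsets $S\subset\mathbb{P}^n$ of cardinality $x$ such that $h^0(\mathcal{I}_{2S}(d))>0$, $h^1(\mathcal{I}_{2S}(d))>0$ and $\langle S\rangle=\mathbb{P}^n$. $\mathbb{T}(n,d;x)'$ (the minimally Terracini sets) is the set of all $S\in\mathbb{T}(n,d;x)$ such that $h^1(\mathcal{I}_{2A}(d))=0$ for all $A\subsetneq S$. A rational normal curve of $\mathbb{P}^3$ is understood to be irreducible (a twisted cubic). *)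

(* Defs.v *)
From HB Require Import structures.
From mathcomp Require Import all_boot all_order all_algebra.
From mathcomp Require Import finmap mpoly.

Set Implicit Arguments.
Unset Strict Implicit.
Unset Printing Implicit Defensive.

Import GRing.Theory.
Local Open Scope ring_scope.

(* P^n over K is the set of lines through 0 in K^(n+1). *)
Definition proj (K : fieldType) (n : nat) : Type :=
  {U : {vspace 'rV[K]_n.+1} | (\dim U == 1)%N}.

HB.instance Definition _ (K : fieldType) (n : nat) := Choice.on (proj K n).

Section Projective.
Variables (K : fieldType) (n : nat).

Local Notation poly := {mpoly K[n.+1]}.
Local Notation frac := {fraction {mpoly K[n.+1]}}.

(* <S> = P^n *)
Definition spanning (S : {fset proj K n}) : Prop :=
  (\sum_(p <- S) val p)%VS = fullv.

(* The homogeneous ideal of S.  K is infinite in the intended use, so that the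
   polynomials vanishing on the lines p of K^(n+1) form a homogeneous ideal. *)
Definition ideal_of (S : {fset proj K n}) (f : poly) : Prop :=
  forall p, p \in S -> forall v, v \in val p -> f.@[fun i => v 0 i] = 0.

Definition ideal_sqr (J : poly -> Prop) (f : poly) : Prop :=
  exists (r : nat) (g h : 'I_r -> poly),
    [/\ forall i, J (g i), forall i, J (h i) & f = \sum_(i < r) g i * h i].

(* Cech cohomology of J~(d), for a homogeneous ideal J, with respect to the
   cover of P^n by the U_i = {x_i <> 0}.  All localizations of the coordinate
   ring are seen inside its fraction field, so restriction maps are inclusions.
   Cochains are indexed by all sequences (s_0, ..., s_p) of indices. *)
Definition simplex (p : nat) := {ffun 'I_p.+1 -> 'I_n.+1}.

(* Sections of J~(d) over U_(s_0) /\ ... /\ U_(s_p): the degree d part of the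
   localization of J at x_(s_0) ... x_(s_p). *)
Definition sections (J : poly -> Prop) (d p : nat) (s : simplex p)
    (a : frac) : Prop :=
  exists (k : nat) (f : poly),
    [/\ J f, f \is (d + k * p.+1).-homog
      & a = tofrac f / tofrac ((\prod_(j < p.+1) 'X_(s j)) ^+ k)].

Definition cochain (J : poly -> Prop) (d p : nat) (c : simplex p -> frac) :
    Prop :=
  forall s, sections J d s (c s).

Definition face (p : nat) (k : 'I_p.+2) (s : simplex p.+1) : simplex p :=
  [ffun j => s (lift k j)].

Definition cech_diff (p : nat) (c : simplex p -> frac) (s : simplex p.+1) :
    frac :=
  \sum_(k < p.+2) (-1) ^+ k * c (face k s).

Definition cocycle (J : poly -> Prop) (d p : nat) (c : simplex p -> frac) :
    Prop :=
  cochain J d c /\ forall s, cech_diff c s = 0.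

Definition coboundary (J : poly -> Prop) (d p : nat) :
    (simplex p -> frac) -> Prop :=
  match p with
  | 0 => fun c => forall s, c s = 0
  | q.+1 => fun c => exists b : simplex q -> frac,
      cochain J d b /\ forall s, c s = cech_diff b s
  end.

(* h^i(J~(d)) > 0, resp. = 0. *)
Definition h_pos (i : nat) (J : poly -> Prop) (d : nat) : Prop :=
  exists c : simplex i -> frac, cocycle J d c /\ ~ coboundary J d c.

Definition h_zero (i : nat) (J : poly -> Prop) (d : nat) : Prop :=
  forall c : simplex i -> frac, cocycle J d c -> coboundary J d c.

(* The ideal sheaf (I_S)^2 of 2S is the sheaf associated with this ideal. *)
Definition ideal_double (S : {fset proj K n}) : poly -> Prop :=
  ideal_sqr (ideal_of S).

Definition Terracini (d x : nat) (S : {fset proj K n}) : Prop :=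
  [/\ #|` S| = x, h_pos 0 (ideal_double S) d, h_pos 1 (ideal_double S) d
    & spanning S].

Definition min_Terracini (d x : nat) (S : {fset proj K n}) : Prop :=
  Terracini d x S /\
  forall A : {fset proj K n}, (A `<` S)%fset -> h_zero 1 (ideal_double A) d.

(* The projective transforms of the image of the Veronese map
   (u : v) |-> (u^n : u^(n-1) v : ... : v^n) of P^1. *)
Definition veronese (u v : K) : 'rV[K]_n.+1 :=
  \row_(j < n.+1) (u ^+ (n - j) * v ^+ j).

Definition rational_normal_curve (C : proj K n -> Prop) : Prop :=
  exists2 M : 'M[K]_n.+1, M \in unitmx &
  forall p, C p <-> exists u v : K,
    (u, v) <> (0, 0) /\ val p = <[veronese u v *m M]>%VS.

End Projective.

(* Main.v *)
Require Import Defs.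
From HB Require Import structures.
From mathcomp Require Import all_boot all_order all_algebra.
From mathcomp Require Import finmap mpoly ring zify.
From Stdlib Require Import Classical.

(** Let [P_i] be vectors representing the points of [S]. The condition [h^1 > 0] for the double points
    means that forms of degree [d] do not realize all gradients at the [P_i]. Dually, there are
    tangent vectors [lam_i], not all zero, such that the sum of the derivatives of [f] at [P_i] along
    [lam_i] is zero for every form [f] of degree [d]: a dependency ([dep]). That Cech cohomology of
    the sheaf of the square of the ideal says the same is [h_zero1P]. It rests on the vanishing of
    [H^1(O(d))] ([cech_H1]) and on the local description of that sheaf by singular functions
    ([saturation]).

    Points on a twisted cubic. Restriction to the curve turns forms of degree [d] into all binary
    forms of degree [3 d]. With [x] points, the [2 x] unknowns exceed the [3 d + 1] conditions, so
    there is a binary dependency ([binary_dep]), and it is pushed forward by the chain rule. On fewer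
    points, testing with multiples of the quadrics through the curve shows that a dependency is
    tangent to the curve, hence binary, hence zero by [dep_large]. The square of a quadric through
    the curve is a factor of a form of degree [d] singular at [S], and four points of the curve span
    the space. This is [cubic_min_Terracini].

    The converse. In a minimal set, a dependency that is zero at one point is zero, so there is one
    with all [lam_i] nonzero. Points on a line or on a plane conic carry dependencies of their own
    if they are too many, which gives upper bounds ([line_bound], [conic_bound]). The main tool is
    [core]. Suppose a form [g] of degree [e] takes care of some of the points and is nonzero at
    [P_0]. If the remaining points can be covered twice by [d - e] planes that miss [P_0], or all but
    one of which miss [P_0] while that one is transverse to [lam_0], then [g] times the equations of
    the planes is a test form that sees only [lam_0], a contradiction. By a theorem of Rado and
    Edmonds ([edmonds]) such planes exist unless a line or plane through [P_0], or the whole space,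
    has too many of the remaining points.

    Applied to squares of equations of planes, this shows first that if four points are coplanar, all
    points lie on a plane and a line ([residual_line]). This case is excluded by using in addition
    planes through a point of the line ([no_trisecant]) and squares of quadrics
    ([no_plane_and_line]). So no four points are coplanar, and then [core] shows that a quadric
    through seven of the points contains all of them ([quadric_contains]). There is a twisted cubic
    through six of the points ([cubic_through6]). If a point is off this curve, a linear relation
    between the quadrics through the curve puts all points but the six on one plane, which is
    impossible ([exists_cubic]). *)

Set Implicit Arguments.
Unset Strict Implicit.
Unset Printing Implicit Defensive.

Import GRing.Theory.
Local Open Scope ring_scope.

(** * Evaluation, directional derivatives and substitution *)

Section Calculus.
Variable (K : fieldType).

Definition ev n (f : {mpoly K[n]}) (p : 'rV[K]_n) : K := f.@[fun i => p 0 i].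

Definition dD n (f : {mpoly K[n]}) (p l : 'rV[K]_n) : K :=
  \sum_i l 0 i * ev f^`M(i) p.

Lemma mpoly_alg_ind n (P : {mpoly K[n]} -> Prop) :
  P 1 -> (forall i, P 'X_i) -> (forall f g, P f -> P g -> P (f * g)) ->
  (forall c f g, P f -> P g -> P (c *: f + g)) -> forall f, P f.
Proof.
move=> P1 PX PM PD.
have P0 : P 0 by have := PD (-1) _ _ P1 P1; rewrite scaleN1r addNr.
have PE m : P 'X_[m].
  rewrite mpolyXE_id; apply: (big_ind P) => // i _.
  elim: (m i) => [|k IHk]; first by rewrite expr0.
  by rewrite exprS; apply: PM.
move=> f; rewrite (mpolyE f); apply: (big_ind P) => //.
  by move=> g h Pg Ph; rewrite -[g]scale1r; apply: PD.
by move=> m _; rewrite -[X in P X]addr0; apply: PD.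
Qed.

Lemma homog_ind n d (P : {mpoly K[n]} -> Prop) :
  P 0 -> (forall c f g, P f -> P g -> P (c *: f + g)) ->
  (forall m, mdeg m = d -> P 'X_[m]) -> forall f, f \is d.-homog -> P f.
Proof.
move=> P0 PD PX f /dhomogP hf; rewrite (mpolyE f) big_seq.
apply: (big_ind P) => //.
  by move=> g h Pg Ph; rewrite -[g]scale1r; apply: PD.
by move=> m /hf /PX Pm; rewrite -[X in P X]addr0; apply: PD.
Qed.

Lemma evD n (f g : {mpoly K[n]}) p : ev (f + g) p = ev f p + ev g p.
Proof. exact: mevalD. Qed.
Lemma evB n (f g : {mpoly K[n]}) p : ev (f - g) p = ev f p - ev g p.
Proof. exact: mevalB. Qed.
Lemma evM n (f g : {mpoly K[n]}) p : ev (f * g) p = ev f p * ev g p.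
Proof. exact: mevalM. Qed.
Lemma evZ n c (f : {mpoly K[n]}) p : ev (c *: f) p = c * ev f p.
Proof. exact: mevalZ. Qed.
Lemma ev0 n p : ev (0 : {mpoly K[n]}) p = 0. Proof. exact: meval0. Qed.
Lemma ev1 n p : ev (1 : {mpoly K[n]}) p = 1. Proof. exact: meval1. Qed.
Lemma evX n k (f : {mpoly K[n]}) p : ev (f ^+ k) p = ev f p ^+ k.
Proof. exact: rmorphXn. Qed.
Lemma evXU n i p : ev ('X_i : {mpoly K[n]}) p = p 0 i.
Proof. exact: mevalXU. Qed.
Lemma ev_sum n I (r : seq I) (P : pred I) (F : I -> {mpoly K[n]}) p :
  ev (\sum_(i <- r | P i) F i) p = \sum_(i <- r | P i) ev (F i) p.
Proof. exact: raddf_sum. Qed.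
Lemma ev_prod n I (r : seq I) (P : pred I) (F : I -> {mpoly K[n]}) p :
  ev (\prod_(i <- r | P i) F i) p = \prod_(i <- r | P i) ev (F i) p.
Proof. exact: rmorph_prod. Qed.

Lemma dDD n (f g : {mpoly K[n]}) p l : dD (f + g) p l = dD f p l + dD g p l.
Proof.
by rewrite /dD -big_split; apply: eq_bigr => i _; rewrite mderivD evD mulrDr.
Qed.
Lemma dDZ n c (f : {mpoly K[n]}) p l : dD (c *: f) p l = c * dD f p l.
Proof.
by rewrite /dD mulr_sumr; apply: eq_bigr => i _; rewrite mderivZ evZ mulrCA.
Qed.
Lemma dDN n (f : {mpoly K[n]}) p l : dD (- f) p l = - dD f p l.
Proof. by rewrite -scaleN1r dDZ mulN1r. Qed.
Lemma dDB n (f g : {mpoly K[n]}) p l : dD (f - g) p l = dD f p l - dD g p l.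
Proof. by rewrite dDD dDN. Qed.
Lemma dD0 n p l : dD (0 : {mpoly K[n]}) p l = 0.
Proof. by rewrite -(scale0r 0) dDZ mul0r. Qed.
Lemma dD1 n p l : dD (1 : {mpoly K[n]}) p l = 0.
Proof. by rewrite /dD big1 // => i _; rewrite -mpolyC1 mderivC ev0 mulr0. Qed.
Lemma dD_sum n I (r : seq I) (P : pred I) (F : I -> {mpoly K[n]}) p l :
  dD (\sum_(i <- r | P i) F i) p l = \sum_(i <- r | P i) dD (F i) p l.
Proof.
by elim/big_rec2: _ => [|i x y _ <-]; rewrite ?dD0 // dDD.
Qed.
Lemma dDM n (f g : {mpoly K[n]}) p l :
  dD (f * g) p l = ev f p * dD g p l + ev g p * dD f p l.
Proof.
rewrite /dD !mulr_sumr -big_split; apply: eq_bigr => i _.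
by rewrite mderivM evD !evM /=; ring.
Qed.
Lemma dDXU n i p l : dD ('X_i : {mpoly K[n]}) p l = l 0 i.
Proof.
have e0 : (U_(i) - U_(i) = 0)%MM by apply/mnmP => k; rewrite !mnmE subnn.
rewrite /dD (bigD1 i) //= mderivX mnmE eqxx e0 mpolyX0 scale1r ev1 mulr1.
by rewrite big1 ?addr0 // => j ji; rewrite mderivX mnmE eq_sym (negPf ji) scale0r ev0 mulr0.
Qed.

Lemma dDXn n k (f : {mpoly K[n]}) p l :
  dD (f ^+ k.+1) p l = k.+1%:R * ev f p ^+ k * dD f p l.
Proof.
elim: k => [|k IHk]; first by rewrite expr1 expr0 !mul1r.
rewrite exprS dDM IHk evX -[k.+2%:R]natr1 exprS; ring.
Qed.

Lemma dDlZ n (f : {mpoly K[n]}) p c l : dD f p (c *: l) = c * dD f p l.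
Proof. by rewrite /dD mulr_sumr; apply: eq_bigr => i _; rewrite mxE mulrA. Qed.
Lemma dDl0 n (f : {mpoly K[n]}) p : dD f p 0 = 0.
Proof. by rewrite -(scale0r 0) dDlZ mul0r. Qed.
Lemma dD_delta n (f : {mpoly K[n]}) p i : dD f p (delta_mx 0 i) = ev f^`M(i) p.
Proof.
rewrite /dD (bigD1 i) //= mxE !eqxx mul1r big1 ?addr0 // => j ji.
by rewrite mxE (negPf ji) mul0r.
Qed.

Lemma ev_homogZ n d (f : {mpoly K[n]}) c p :
  f \is d.-homog -> ev f (c *: p) = c ^+ d * ev f p.
Proof.
move: f; apply: homog_ind; first by rewrite !ev0 mulr0.
  by move=> a f g hf hg; rewrite !evD !evZ hf hg; ring.
move=> m hm; rewrite /ev !mevalX.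
under eq_bigr do rewrite mxE exprMn.
rewrite big_split /= prodrXr -hm mdegE; congr (_ ^+ _ * _).
Qed.

Lemma mderiv_homog n d i (f : {mpoly K[n]}) :
  f \is d.+1.-homog -> f^`M(i) \is d.-homog.
Proof.
move: f; apply: homog_ind; first by rewrite mderiv0 dhomog0.
  by move=> a f g hf hg; rewrite mderivD mderivZ rpredD ?rpredZ.
move=> m hm; rewrite mderivX; case: (posnP (m i)) => [->|mi].
  by rewrite scale0r dhomog0.
apply: dhomogZ; rewrite dhomogX; apply/eqP/succn_inj; rewrite -hm.
have <- : (m - U_(i) + U_(i))%MM = m.
  by apply/mnmP => j; rewrite !mnmE; case: eqP => [<-|]; rewrite ?subnK // subn0 addn0.
by rewrite mdegD mdeg1 addn1; congr (mdeg _).+1; apply/mnmP => j; rewrite !mnmE; lia.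
Qed.

Lemma euler n d (f : {mpoly K[n]}) p :
  f \is d.-homog -> dD f p p = d%:R * ev f p.
Proof.
move: f; apply: homog_ind; first by rewrite dD0 ev0 mulr0.
  by move=> a f g hf hg; rewrite dDD dDZ evD evZ hf hg; ring.
move=> m; rewrite mpolyXE_id mdegE => <-.
rewrite (_ : dD _ _ _ = \sum_i (m i)%:R * ev (\prod_(j < n) 'X_j ^+ m j) p); last first.
  elim: (index_enum _) => [|i s IHs]; first by rewrite !big_nil dD1.
  rewrite !big_cons dDM IHs evM mulr_sumr.
  rewrite addrC; congr (_ + _); last by apply: eq_bigr => j _; ring.
  case: (m i) => [|k]; first by rewrite expr0 dD1 mulr0 mul0r.
  by rewrite dDXn dDXU evX evXU exprS; ring.
by rewrite -mulr_suml natr_sum.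
Qed.

Definition lf n (c : 'cV[K]_n) : {mpoly K[n]} := \sum_i c i 0 *: 'X_i.

Lemma ev_lf n (c : 'cV[K]_n) p : ev (lf c) p = (p *m c) 0 0.
Proof.
rewrite /lf ev_sum mxE; apply: eq_bigr => i _.
by rewrite evZ evXU mulrC.
Qed.
Lemma dD_lf n (c : 'cV[K]_n) p l : dD (lf c) p l = (l *m c) 0 0.
Proof.
rewrite /lf dD_sum mxE; apply: eq_bigr => i _.
by rewrite dDZ dDXU mulrC.
Qed.
Lemma lf_homog n (c : 'cV[K]_n) : lf c \is 1.-homog.
Proof.
by apply: rpred_sum => i _; apply: dhomogZ; rewrite dhomogX /= mdeg1.
Qed.

Definition gmap n k (g : n.-tuple {mpoly K[k]}) (u : 'rV[K]_k) : 'rV[K]_n :=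
  \row_i ev (tnth g i) u.
Definition jac n k (g : n.-tuple {mpoly K[k]}) (u w : 'rV[K]_k) : 'rV[K]_n :=
  \row_i dD (tnth g i) u w.

Lemma ev_comp n k (g : n.-tuple {mpoly K[k]}) f u :
  ev (f \mPo g) u = ev f (gmap g u).
Proof.
by rewrite /ev comp_mpoly_meval; apply: meval_eq => i; rewrite mxE.
Qed.

Lemma dD_comp n k (g : n.-tuple {mpoly K[k]}) f u w :
  dD (f \mPo g) u w = dD f (gmap g u) (jac g u w).
Proof.
move: f; apply: mpoly_alg_ind.
- by rewrite comp_mpoly1 !dD1.
- by move=> i; rewrite comp_mpolyXU dDXU mxE -tnth_nth.
- by move=> f h hf hh; rewrite rmorphM !dDM !ev_comp hf hh.
by move=> c f h hf hh; rewrite comp_mpolyD comp_mpolyZ !dDD !dDZ hf hh.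
Qed.

Lemma comp_homog n k d e (g : n.-tuple {mpoly K[k]}) f :
  (forall i, tnth g i \is e.-homog) -> f \is d.-homog ->
  f \mPo g \is (d * e).-homog.
Proof.
move=> hg; move: f; apply: homog_ind; first by rewrite comp_mpoly0 dhomog0.
  by move=> c f h hf hh; rewrite comp_mpolyD comp_mpolyZ rpredD ?rpredZ.
move=> m; rewrite comp_mpolyX mdegE => <-.
elim: (index_enum _) => [|i s IHs]; first by rewrite !big_nil dhomog1.
rewrite !big_cons mulnDl; apply: dhomogM IHs.
by rewrite mulnC; apply: dhomogMn.
Qed.

End Calculus.

(** * Dependencies between tangent vectors *)

Section LinearAlgebra.
Variable (K : fieldType).

(** Take a nonzero coordinate of the difference between [v] and its projection to [W]. *)
Lemma separate n (W : {vspace 'rV[K]_n}) v : v \notin W ->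
  exists2 c : 'cV[K]_n, forall w, w \in W -> w *m c = 0 & (v *m c) 0 0 != 0.
Proof.
move=> vW; pose g x : 'rV[K]_n := x - projv W x.
have gv : g v != 0.
  by apply: contraNneq vW => /eqP; rewrite subr_eq0 => /eqP ->; apply: memv_proj.
have [j gj] : exists j, g v 0 j != 0 by apply/rV0Pn.
pose c : 'cV[K]_n := \col_i g (delta_mx 0 i) 0 j.
have cE x : (x *m c) 0 0 = g x 0 j.
  rewrite /g [x in RHS]row_sum_delta linear_sum /= -sumrB summxE mxE.
  apply: eq_bigr => i _; rewrite mxE linearZ /= -scalerBr /g [in RHS]mxE.
  by [].
exists c => [w wW|]; last by rewrite cE.
apply/matrixP => a b; rewrite !ord1 cE /g (projv_id wW) subrr.
by rewrite !mxE.
Qed.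

(** The system has more unknowns, [k] for each element of [A], than equations. *)
Lemma small_system (I J : finType) k (A : {set I}) (C : J -> I -> 'cV[K]_k) :
  (#|J| < #|A| * k)%N ->
  exists w : I -> 'rV[K]_k, [/\ forall i, i \notin A -> w i = 0,
    exists i, w i != 0 & forall j, \sum_(i in A) (w i *m C j i) 0 0 = 0].
Proof.
move=> ltJ; pose T := ({x | x \in A} * 'I_k)%type.
have cT : #|{: T}| = (#|A| * k)%N by rewrite card_prod card_sig card_ord.
pose M : 'M[K]_(#|{: T}|, #|J|) :=
  \matrix_(a, b) C (enum_val b) (val (enum_val a).1) (enum_val a).2 0.
have : kermx M != 0.
  rewrite -mxrank_eq0 mxrank_ker -lt0n subn_gt0.
  by apply: leq_ltn_trans (rank_leq_col M) _; rewrite cT.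
case/rowV0Pn => v /sub_kermxP vM v0.
pose x (i : I) (c : 'I_k) : K :=
  if insub i is Some i' then v 0 (enum_rank ((i', c) : T)) else 0.
exists (fun i => \row_c x i c); split.
- by move=> i iA; apply/rowP => c; rewrite !mxE /x insubN.
- have [a va] : exists a, v 0 a != 0 by apply/rV0Pn.
  exists (val (enum_val a).1); apply/rV0Pn; exists (enum_val a).2.
  by rewrite mxE /x valK -surjective_pairing enum_valK.
move=> j; have /matrixP/(_ 0 (enum_rank j)) := vM; rewrite !mxE => vMj.
rewrite -[RHS]vMj.
rewrite (reindex (enum_rank : T -> _)) /=; last first.
  by apply: onW_bij; exact: enum_rank_bij.
rewrite [in RHS](eq_bigr (fun t : T => x (val t.1) t.2 * C j (val t.1) t.2 0)); last first.
  by move=> [i c] _; rewrite mxE !enum_rankK /x valK.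
rewrite -(pair_bigA _ (fun (i : {x | x \in A}) c => x (val i) c * C j (val i) c 0)) /=.
rewrite big_sub /=.
apply: eq_bigr => i _; rewrite mxE; apply: eq_bigr => c _.
by rewrite mxE.
Qed.

Definition grad n (f : {mpoly K[n]}) (p : 'rV[K]_n) : 'cV[K]_n :=
  \col_i ev f^`M(i) p.

Lemma dD_grad n (f : {mpoly K[n]}) p l : dD f p l = (l *m grad f p) 0 0.
Proof. by rewrite mxE; apply: eq_bigr => i _; rewrite mxE. Qed.

(** The functionals on first-order jets at the points [P i] that vanish on all forms of degree [d].
    By [h_zero1P] a nonzero one is what [h^1 > 0] means for the double points at the [P i]. *)
Definition dep n (I : finType) d (P lam : I -> 'rV[K]_n) :=
  forall f : {mpoly K[n]}, f \is d.-homog -> \sum_i dD f (P i) (lam i) = 0.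

Lemma dep_monomials n (I : finType) d (P lam : I -> 'rV[K]_n) :
  (forall m, mdeg m = d -> \sum_i dD 'X_[m] (P i) (lam i) = 0) -> dep d P lam.
Proof.
move=> h; apply: homog_ind => //; first by rewrite big1 // => i _; rewrite dD0.
move=> c f g hf hg; under eq_bigr do rewrite dDD dDZ.
by rewrite big_split -mulr_sumr /= hf hg mulr0 addr0.
Qed.

Lemma eq_dep n (I : finType) d (P Q lam mu : I -> 'rV[K]_n) :
  P =1 Q -> lam =1 mu -> dep d P lam -> dep d Q mu.
Proof.
by move=> eP el h f hf; rewrite -[RHS](h _ hf); apply: eq_bigr => i _; rewrite eP el.
Qed.

(** By the chain rule, a dependency of binary forms gives one along a parametrized curve, and a
    dependency in a subspace gives one in the whole space. *)
Lemma dep_pullback n k (I : finType) d e (g : n.-tuple {mpoly K[k]})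
    (u w : I -> 'rV[K]_k) :
  (forall i, tnth g i \is e.-homog) -> dep (d * e) u w ->
  dep d (fun i => gmap g (u i)) (fun i => jac g (u i) (w i)).
Proof.
move=> hg h f hf; rewrite -[RHS](h _ (comp_homog hg hf)).
by apply: eq_bigr => i _; rewrite dD_comp.
Qed.

Definition ltup k n (M : 'M[K]_(k, n)) : n.-tuple {mpoly K[k]} :=
  [tuple lf (col j M) | j < n].

Lemma gmap_ltup k n (M : 'M[K]_(k, n)) u : gmap (ltup M) u = u *m M.
Proof.
by apply/rowP => j; rewrite mxE tnth_mktuple ev_lf !mxE; apply: eq_bigr => i _; rewrite mxE.
Qed.
Lemma jac_ltup k n (M : 'M[K]_(k, n)) u w : jac (ltup M) u w = w *m M.
Proof.
by apply/rowP => j; rewrite mxE tnth_mktuple dD_lf !mxE; apply: eq_bigr => i _; rewrite mxE.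
Qed.

Lemma dep_linear k n (I : finType) d (M : 'M[K]_(k, n)) (u w : I -> 'rV[K]_k) :
  dep d u w -> dep d (fun i => u i *m M) (fun i => w i *m M).
Proof.
move=> h; have := @dep_pullback n k I d 1 (ltup M) u w.
rewrite muln1 => /(_ _ h) h'; apply: eq_dep (h' _).
- by move=> i; rewrite gmap_ltup.
- by move=> i; rewrite jac_ltup.
by move=> i; rewrite tnth_mktuple lf_homog.
Qed.

Lemma sum_supp n (I : finType) (A : {set I}) (lam : I -> 'rV[K]_n)
    (F : I -> 'rV[K]_n -> K) :
  (forall i, i \notin A -> lam i = 0) -> (forall i, F i 0 = 0) ->
  \sum_i F i (lam i) = \sum_(i in A) F i (lam i).
Proof.
move=> h F0; rewrite [LHS](bigID (mem A)) /= [X in _ + X]big1 ?addr0 //.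
by move=> i /h ->.
Qed.

Lemma mnm2E (m : 'X_{1..2}) : mdeg m = (m ord0 + m ord_max)%N.
Proof. by rewrite mdegE big_ord_recl big_ord1; congr (_ + m _)%N; apply/val_inj. Qed.

(** There are two unknowns for each point and one equation for each of the [D + 1] monomials of
    degree [D]. *)
Lemma binary_dep (I : finType) (A : {set I}) (u : I -> 'rV[K]_2) D :
  (D.+1 < 2 * #|A|)%N ->
  exists w : I -> 'rV[K]_2, [/\ forall i, i \notin A -> w i = 0,
    exists i, w i != 0 & dep D u w].
Proof.
move=> hA.
pose X (j : 'I_D.+1) : {mpoly K[2]} := 'X_ord0 ^+ j * 'X_ord_max ^+ (D - j).
have [|w [w0 wn wE]] := @small_system I 'I_D.+1 2 A (fun j i => grad (X j) (u i)).
  by rewrite card_ord mulnC.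
exists w; split => //; apply: dep_monomials => m hm.
have hm0 : (m ord0 < D.+1)%N by rewrite ltnS -hm mnm2E leq_addr.
have -> : 'X_[m] = X (Ordinal hm0).
  rewrite mpolyXE_id big_ord_recl big_ord1 /X /=.
  rewrite (_ : lift _ _ = ord_max); last exact/val_inj.
  by rewrite -hm mnm2E addKn.
rewrite (sum_supp (A := A) (F := fun i l => dD (X (Ordinal hm0)) (u i) l)) //.
  by rewrite -[RHS](wE (Ordinal hm0)); apply: eq_bigr => i _; rewrite dD_grad.
by move=> i; rewrite dDl0.
Qed.

Definition qp n (S : 'M[K]_n) : {mpoly K[n]} :=
  \sum_i \sum_j S i j *: ('X_i * 'X_j).

Lemma ev_qp n (S : 'M[K]_n) p : ev (qp S) p = (p *m S *m p^T) 0 0.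
Proof.
rewrite /qp ev_sum mxE.
under [RHS]eq_bigr do rewrite !mxE mulr_suml.
rewrite [RHS]exchange_big /=; apply: eq_bigr => i _; rewrite ev_sum.
by apply: eq_bigr => j _; rewrite evZ evM !evXU; ring.
Qed.

(** The vectors are required to be tangent to the conic, one equation for each point, so that the
    multiples of the conic are taken care of. Since the square of the first variable occurs in [qp
    S], the forms of degree [d] are spanned, modulo these multiples, by the [2 d + 1] monomials of
    degree at most one in that variable. This makes [2 d + 1 + #|A|] equations in [3 #|A|]
    unknowns. *)
Lemma conic_dep0 (I : finType) (A : {set I}) (P : I -> 'rV[K]_3) (S : 'M[K]_3) d :
  S ord0 ord0 != 0 -> (forall i, i \in A -> ev (qp S) (P i) = 0) -> (d < #|A|)%N ->
  exists w : I -> 'rV[K]_3, [/\ forall i, i \notin A -> w i = 0,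
    exists i, w i != 0 & dep d P w].
Proof.
move=> S0 qA hA.
pose i1 : 'I_3 := lift ord0 ord0. pose i2 : 'I_3 := ord_max.
pose X (j : 'I_d.+1 + 'I_d) : {mpoly K[3]} :=
  match j with
  | inl a => 'X_i1 ^+ a * 'X_i2 ^+ (d - a)
  | inr a => 'X_ord0 * ('X_i1 ^+ a * 'X_i2 ^+ (d.-1 - a)) end.
pose J := ({x | x \in A} + ('I_d.+1 + 'I_d))%type.
pose C (j : J) (i : I) : 'cV[K]_3 :=
  match j with
  | inl a => if val a == i then grad (qp S) (P i) else 0
  | inr a => grad (X a) (P i) end.
have [|w [w0 wn wE]] := @small_system I J 3 A C.
  have cA : #|{: {x | x \in A}}| = #|A| by rewrite card_sig.
  by rewrite !card_sum !card_ord cA; move: (#|A|) hA => a; lia.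
have tan i : i \in A -> dD (qp S) (P i) (w i) = 0.
  move=> iA; have := wE (inl (exist _ i iA)); rewrite (bigD1 i) //= eqxx -dD_grad.
  rewrite big1 ?addr0 // => j /andP[_ ji].
  by rewrite eq_sym (negPf ji) mulmx0 mxE.
pose Psi f := \sum_i dD f (P i) (w i).
have PsiD f g : Psi (f + g) = Psi f + Psi g.
  by rewrite /Psi -big_split; apply: eq_bigr => i _; rewrite dDD.
have PsiZ c f : Psi (c *: f) = c * Psi f.
  by rewrite /Psi mulr_sumr; apply: eq_bigr => i _; rewrite dDZ.
have PsiA f : Psi f = \sum_(i in A) dD f (P i) (w i).
  by apply: (sum_supp (F := fun i l => dD f (P i) l)) => // i; rewrite dDl0.
have PsiX j : Psi (X j) = 0.
  by rewrite PsiA -[RHS](wE (inr j)); apply: eq_bigr => i _; rewrite dD_grad.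
have Psiq f : Psi (qp S * f) = 0.
  rewrite PsiA big1 // => i iA; rewrite dDM (tan i iA) (qA i iA); ring.
exists w; split => //; apply: dep_monomials => m; rewrite -/(Psi _).
have [k] := ubnP (m ord0); elim: k m => // k IHk m; rewrite ltnS => hk hm.
have mE : 'X_[m] = 'X_ord0 ^+ (m ord0) * ('X_i1 ^+ (m i1) * 'X_i2 ^+ (m i2)) :> {mpoly K[3]}.
  rewrite mpolyXE_id !big_ord_recl big_ord0 mulr1 /=.
  by rewrite (_ : lift ord0 (lift ord0 ord0) = i2) //; apply/val_inj.
have dE : (m ord0 + (m i1 + m i2))%N = d.
  rewrite -hm mdegE !big_ord_recl big_ord0 addn0 /=.
  by rewrite (_ : lift ord0 (lift ord0 ord0) = i2) //; apply/val_inj.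
(* induction on the exponent of the first variable; its square is replaced by means of the conic *)
case E0 : (m ord0) => [|[|e]].
- have lt1 : (m i1 < d.+1)%N by lia.
  rewrite mE E0 expr0 mul1r -(PsiX (inl (Ordinal lt1))) /=.
  by congr (Psi (_ * 'X_i2 ^+ _)); lia.
- have lt1 : (m i1 < d)%N by lia.
  rewrite mE E0 expr1 -(PsiX (inr (Ordinal lt1))) /=.
  by congr (Psi (_ * (_ * 'X_i2 ^+ _))); lia.
pose m' : 'X_{1..3} := [multinom (if i == ord0 then e else m i) | i < 3].
have mm' : m = (U_(ord0) + U_(ord0) + m')%MM.
  by apply/mnmP => i; rewrite !mnmE eq_sym; case: eqP => [->|]; rewrite ?E0; lia.
have dm' : d = (mdeg m').+2 by rewrite -hm mm' !mdegD !mdeg1; lia.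
have : S ord0 ord0 * Psi 'X_[m] = 0.
  have := Psiq 'X_[m']; rewrite {1}/qp (bigD1 ord0) //= (bigD1 ord0) //=.
  rewrite !mulrDl !PsiD -scalerAl -!mpolyXD -mm' PsiZ -addrA.
  set a := Psi 'X_[m]; set b := Psi _; set c := Psi (_ * _).
  have PsiIJ i j : (i != ord0) || (j != ord0) -> Psi (S i j *: ('X_i * 'X_j) * 'X_[m']) = 0.
    move=> ij; rewrite -scalerAl PsiZ -!mpolyXD IHk ?mulr0 //.
      rewrite !mnmE eqxx; apply: leq_trans hk; rewrite E0.
      by case/orP: ij => /negPf ->; case: eqP => //=; lia.
    by rewrite !mdegD !mdeg1 dm'; lia.
  have Psi0 : Psi 0 = 0 by rewrite -(scale0r 0) PsiZ mul0r.
  have Psis (Q : pred 'I_3) (F : 'I_3 -> {mpoly K[3]}) :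
      (forall i, Q i -> Psi (F i * 'X_[m']) = 0) -> Psi ((\sum_(i | Q i) F i) * 'X_[m']) = 0.
    move=> hF; rewrite mulr_suml; elim/big_ind: _ => //.
    by move=> x y hx hy; rewrite PsiD hx hy addr0.
  have -> : b = 0 by apply: Psis => j j0; apply: PsiIJ; rewrite j0 orbT.
  have -> : c = 0.
    by apply/Psis => i i0; apply/Psis => j _; apply: PsiIJ; rewrite i0.
  by rewrite !addr0.
by move/eqP; rewrite mulf_eq0 (negPf S0) => /eqP.
Qed.

Lemma qp_conj n (S R : 'M[K]_n) p :
  ev (qp S) (p *m R) = ev (qp (R *m S *m R^T)) p.
Proof. by rewrite !ev_qp trmx_mul !mulmxA. Qed.

(** A change of coordinates moves [v] to a multiple of the first basis vector; then the square of
    the first variable has a nonzero coefficient, as [conic_dep0] needs. *)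
Lemma conic_dep (I : finType) (A : {set I}) (P : I -> 'rV[K]_3) (S : 'M[K]_3) v d :
  ev (qp S) v != 0 -> (forall i, i \in A -> ev (qp S) (P i) = 0) -> (d < #|A|)%N ->
  exists w : I -> 'rV[K]_3, [/\ forall i, i \notin A -> w i = 0,
    exists i, w i != 0 & dep d P w].
Proof.
move=> qv qA hA; pose R := row_ebase v.
have Ru : R \in unitmx by apply: row_ebase_unit.
have [c vE] : exists c, v = c *: row ord0 R.
  exists (col_ebase v 0 0 * (\rank v == 1)%:R).
  rewrite -{1}(mulmx_ebase v) -/R; apply/rowP => j; rewrite !mxE big_ord_recl.
  rewrite big1 ?addr0; last first.
    move=> i _; rewrite !mxE big1 ?mul0r // => a _; rewrite mxE.
    by rewrite ord1 (_ : (0 == lift _ _ :> nat) = false) ?mulr0.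
  rewrite !mxE big_ord1 !mxE eqxx /=; congr (_ * _ * _).
  by move: (rank_leq_row v); case: (\rank v) => [|[]].
pose S' := R *m S *m R^T.
have S'0 : S' ord0 ord0 != 0.
  apply: contraNneq qv => S'0; rewrite vE ev_qp rowE scalemxAl.
  rewrite trmx_mul !mulmxA -(mulmxA _ R S) -(mulmxA _ (R *m S)) -/S'.
  rewrite linearZ /= -scalemxAl -scalemxAl -scalemxAr -rowE trmx_delta -colE mxE mxE.
  by move: S'0; rewrite !mxE => ->; rewrite !mulr0.
have [|w [w0 [i wi] wd]] := @conic_dep0 I A (fun i => P i *m invmx R) S' d S'0 _ hA.
  by move=> i /qA <-; rewrite -qp_conj mulmxKV.
exists (fun i => w i *m R); split.
- by move=> j /w0 ->; rewrite mul0mx.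
- exists i; apply: contraNneq wi => /(congr1 (mulmx^~ (invmx R))).
  by rewrite mulmxK // mul0mx => ->.
have := dep_linear R wd; apply: eq_dep => // j.
by rewrite mulmxKV.
Qed.

End LinearAlgebra.

(** * Separating points by forms of high degree *)

Section Separation.
Variable (K : fieldType).

(** The vectors represent distinct points of the projective space. *)
Definition distinct_pts n (I : finType) (A : {set I}) (P : I -> 'rV[K]_n) :=
  {in A, forall i, P i != 0} /\
  {in A &, forall i j, i != j -> P i \notin <[P j]>%VS}.

Lemma nonzero_form n (p : 'rV[K]_n) : p != 0 ->
  exists c : 'cV[K]_n, (p *m c) 0 0 != 0.
Proof.
move=> p0; have [|c _ pc] := @separate K n 0%VS p; first by rewrite memv0.
by exists c.
Qed.

(** A product of linear forms, one through each of the other points, times a power of a linear form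
    that is nonzero at [P i]. *)
Lemma separating_form n (I : finType) (A : {set I}) (P : I -> 'rV[K]_n) i m :
  distinct_pts A P -> i \in A -> (#|A :\ i| <= m)%N ->
  exists g : {mpoly K[n]}, [/\ g \is m.-homog, ev g (P i) != 0 &
    {in A, forall j, j != i -> ev g (P j) = 0}].
Proof.
move=> [P0 Pd] iA hm; have [h ih] := nonzero_form (P0 i iA).
have: {subset enum (A :\ i) <= A :\ i} by move=> j; rewrite mem_enum.
have -> : m = (size (enum (A :\ i)) + (m - #|A :\ i|))%N by rewrite -cardE subnKC.
move: (m - _)%N => r.
suff gs s : {subset s <= A :\ i} -> exists g : {mpoly K[n]},
    [/\ g \is (size s + r).-homog, ev g (P i) != 0 & {in s, forall j, ev g (P j) = 0}].
  move=> /gs [g [hg gi gA]]; exists g; split => // j jA ji; apply: gA.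
  by rewrite mem_enum !inE ji.
elim: s => [_|j s IHs sA].
  exists (lf h ^+ r); split => //; last by rewrite evX ev_lf expf_neq0.
  by rewrite add0n -{2}[r]mul1n; apply/dhomogMn/lf_homog.
have [|g [hg gi gs]] := IHs; first by move=> k ks; apply: sA; rewrite inE ks orbT.
have /setD1P[ji jA] := sA j (mem_head _ _).
have [|c cj ci] := @separate K n <[P j]>%VS (P i); first by apply: Pd; rewrite // eq_sym.
exists (lf c * g); split.
- by rewrite /= addSn -add1n; apply: dhomogM hg; apply: lf_homog.
- by rewrite evM ev_lf mulf_neq0.
move=> k; rewrite inE evM ev_lf => /orP[/eqP->|/gs ->]; last by rewrite mulr0.
by rewrite (cj (P j)) ?memv_line // mxE mul0r.
Qed.

Lemma ev_large n (I : finType) (A : {set I}) (P : I -> 'rV[K]_n) e (c : I -> K) :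
  distinct_pts A P -> (#|A| <= e.+1)%N ->
  (forall g : {mpoly K[n]}, g \is e.-homog -> \sum_(i in A) c i * ev g (P i) = 0) ->
  {in A, forall i, c i = 0}.
Proof.
move=> hP hA h i iA; have [|g [hg gi gA]] := @separating_form n I A P i e hP iA.
  by move: hA; rewrite (cardsD1 i) iA.
have := h g hg; rewrite (bigD1 i) //= big1 ?addr0; last first.
  by move=> j /andP[jA ji]; rewrite gA ?mulr0.
by move/eqP; rewrite mulf_eq0 (negPf gi) orbF => /eqP.
Qed.

(** The square of a separating form has zero gradient at the other points, so that its products
    with linear forms see only [lam i]. If [lam i] is not a multiple of [P i], some linear form
    vanishes at [P i] but not along [lam i]. Otherwise Euler's formula shows that the multiple is
    zero; this uses that the degree is not zero in [K]. *)
Lemma dep_large n (I : finType) (A : {set I}) (P lam : I -> 'rV[K]_n) e :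
  [pchar K] =i pred0 -> distinct_pts A P -> (2 * #|A| <= e.+1)%N ->
  (forall i, i \notin A -> lam i = 0) -> dep e P lam -> forall i, lam i = 0.
Proof.
move=> charK hP hA lam0 hdep i.
have [iA|/lam0//] := boolP (i \in A).
have cA := cardsD1 i A; rewrite iA in cA.
have [g [hg gi gA]] := separating_form hP iA (leqnn _).
have [c ci] := nonzero_form (hP.1 i iA).
pose r := (e - (2 * #|A :\ i|).+1)%N.
pose G : {mpoly K[n]} := lf c ^+ r * g ^+ 2.
have hG : G \is (e.-1).-homog.
  have -> : e.-1 = (1 * r + #|A :\ i| * 2)%N by rewrite /r; lia.
  by apply: dhomogM; [apply/dhomogMn/lf_homog | apply: dhomogMn].
have Gi : ev G (P i) != 0.
  by rewrite evM !evX ev_lf mulf_neq0 ?expf_neq0.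
have test b : dD (G * lf b) (P i) (lam i) = 0.
  have : G * lf b \is e.-homog.
    by have -> : e = (e.-1 + 1)%N by [lia]; apply: dhomogM hG _; apply: lf_homog.
  move/hdep; rewrite (bigD1 i) //= big1 ?addr0 // => j ji.
  have [jA|/lam0 ->] := boolP (j \in A); last by rewrite dDl0.
  by rewrite !dDM !evM (gA j jA ji); ring.
have [lamP|lamP] := boolP (lam i \in <[P i]>%VS); last first.
  have [b bP bl] := separate lamP.
  have bPi : (P i *m b) 0 0 = 0 by rewrite (bP (P i)) ?memv_line // mxE.
  have := test b; rewrite dDM ev_lf dD_lf bPi mul0r addr0.
  by move/eqP; rewrite mulf_eq0 (negPf Gi) (negPf bl).
have /vlineP [a la] := lamP.
have := test c; rewrite la dDlZ (@euler _ _ e); last first.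
  have -> : e = (e.-1 + 1)%N by lia.
  by apply: dhomogM hG _; apply: lf_homog.
move/eqP; rewrite evM ev_lf !mulf_eq0 (negPf Gi) (negPf ci) !orbF.
case/orP => [/eqP ->|]; first by rewrite scale0r.
by rewrite (pcharf0P K).1 //; lia.
Qed.

(** If the gradients of the forms did not fill the space, a linear form vanishing on all of them
    would be a nonzero dependency. *)
Lemma gradients_surj n (I : finType) d (P : I -> 'rV[K]_n.+1) :
  (forall lam, dep d P lam -> forall i, lam i = 0) ->
  forall T : I -> 'rV[K]_n.+1, exists2 f : {mpoly K[n.+1]}, f \is d.-homog &
    forall i l, dD f (P i) l = (l *m (T i)^T) 0 0.
Proof.
move=> nodep T.
pose gr (f : {mpoly K[n.+1]}) : 'rV[K]_(#|I| * n.+1) :=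
  mxvec (\matrix_(a, j) ev f^`M(j) (P (enum_val a))).
pose Phi (f : dhomog n.+1 K d) := gr (val f).
have Phi_lin : linear Phi.
  move=> c f g; rewrite /Phi /gr -linearP; congr mxvec.
  by apply/matrixP => a j; rewrite !mxE /= mderivD mderivZ evD evZ.
pose PhiL := GRing.isLinear.Build _ _ _ _ Phi Phi_lin.
pose Phi' : {linear dhomog n.+1 K d -> 'rV[K]_(#|I| * n.+1)} := HB.pack Phi PhiL.
pose t : 'rV[K]_(#|I| * n.+1) := mxvec (\matrix_(a < #|I|, j < n.+1) T (enum_val a) 0 j).
have [|tU] := boolP (t \in limg (linfun Phi')).
  case/memv_imgP => f _; rewrite lfunE /= => tE.
  exists (val f) => [|i l]; first exact: valP.
  rewrite dD_grad; congr ((l *m _) 0 0).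
  apply/matrixP => j z; rewrite !mxE ord1.
  move/(congr1 (fun v => (vec_mx v : 'M[K]_(#|I|, n.+1)) (enum_rank i) j)) : tE.
  by rewrite /Phi /gr !mxvecK !mxE enum_rankK.
have [c cU ct] := separate tU.
pose lam i : 'rV[K]_n.+1 := \row_j c (mxvec_index (enum_rank i) j) 0.
have cE (M : 'M[K]_(#|I|, n.+1)) :
    (mxvec M *m c) 0 0 = \sum_i \sum_j M (enum_rank i) j * lam i 0 j.
  rewrite mxE (reindex _ (curry_mxvec_bij _ _)) /=.
  rewrite [LHS](eq_bigr (fun p => mxvec M 0 (mxvec_index p.1 p.2) * c (mxvec_index p.1 p.2) 0)); last first.
    by case.
  rewrite -(pair_bigA _ (fun a j => mxvec M 0 (mxvec_index a j) * c (mxvec_index a j) 0)) /=.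
  rewrite (reindex (@enum_rank I)) /=; last by apply: onW_bij; exact: enum_rank_bij.
  apply: eq_bigr => i _; apply: eq_bigr => j _.
  by rewrite mxvecE mxE.
have lam0 : forall i, lam i = 0.
  apply: nodep => f hf; have := cU (Phi (DHomog hf)).
  have -> : Phi (DHomog hf) \in limg (linfun Phi').
    by rewrite -[Phi _](lfunE Phi') memv_img ?memvf.
  move=> /(_ isT) /matrixP /(_ 0 0); rewrite cE mxE => eq0.
  rewrite -[RHS]eq0; apply: eq_bigr => i _; rewrite dD_grad mxE.
  by apply: eq_bigr => j _; rewrite !mxE enum_rankK mulrC.
case/eqP: ct; rewrite cE big1 // => i _; rewrite big1 // => j _.
by rewrite lam0 [X in _ * X]mxE mulr0.
Qed.

End Separation.

(** * Singular points and squares of ideals *)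

Section Taylor.
Variable (K : fieldType).

(** The expansion is stated for substitutions of polynomials because it is used for ideal
    membership: the remainder lies in the square of the ideal generated by the [b i]. *)
Lemma taylor2 n k (f : {mpoly K[n]}) (a b : 'I_n -> {mpoly K[k]}) :
  exists G : 'I_n -> 'I_n -> {mpoly K[k]},
    f \mPo [tuple a i + b i | i < n] = f \mPo [tuple a i | i < n]
      + \sum_i b i * (f^`M(i) \mPo [tuple a i | i < n])
      + \sum_i \sum_j G i j * (b i * b j).
Proof.
move: f; apply: mpoly_alg_ind.
- exists (fun _ _ => 0); rewrite !comp_mpoly1 big1 => [|i _].
    by rewrite big1 ?addr0 // => i _; rewrite big1 // => j _; rewrite mul0r.
  by rewrite -mpolyC1 mderivC comp_mpoly0 mulr0.
- move=> i; exists (fun _ _ => 0); rewrite !comp_mpolyXU -!tnth_nth !tnth_mktuple.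
  have -> : \sum_j b j * (('X_i)^`M(j) \mPo [tuple a i | i < n]) = b i.
    rewrite (bigD1 i) //= big1 ?addr0 => [|j ji]; last first.
      by rewrite mderivX mnmE eq_sym (negPf ji) scale0r comp_mpoly0 mulr0.
    have e0 : (U_(i) - U_(i) = 0)%MM by apply/mnmP => l; rewrite !mnmE subnn.
    by rewrite mderivX mnmE eqxx e0 mpolyX0 scale1r comp_mpoly1 mulr1.
  rewrite [X in _ = _ + X]big1 ?addr0 // => j _.
  by rewrite big1 // => l _; rewrite mul0r.
- move=> f g [F hf] [G hg].
  pose f0 := f \mPo [tuple a i | i < n]; pose g0 := g \mPo [tuple a i | i < n].
  pose f1 i := f^`M(i) \mPo [tuple a i | i < n].
  pose g1 i := g^`M(i) \mPo [tuple a i | i < n].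
  pose f2 := \sum_i \sum_j F i j * (b i * b j).
  pose g2 := \sum_i \sum_j G i j * (b i * b j).
  rewrite -/f0 -/g0 -/f2 -/g2 in hf hg.
  exists (fun i j => F i j * (g0 + \sum_i b i * g1 i + g2) + f1 i * g1 j
    + (f0 + \sum_i b i * f1 i) * G i j).
  rewrite !rmorphM /= hf hg.
  have -> : \sum_i b i * ((f * g)^`M(i) \mPo [tuple a i | i < n]) =
     (\sum_i b i * f1 i) * g0 + f0 * (\sum_i b i * g1 i).
    rewrite mulr_suml mulr_sumr -big_split; apply: eq_bigr => i _ /=.
    by rewrite mderivM rmorphD !rmorphM /= -/f0 -/g0 -/(f1 i) -/(g1 i); ring.
  under [X in _ = _ + X]eq_bigr => i _.
    under eq_bigr => j _ do rewrite mulrDl mulrDl.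
    rewrite !big_split /=; over.
  rewrite !big_split /=.
  have -> : \sum_i \sum_j F i j * (g0 + \sum_i b i * g1 i + g2) * (b i * b j) =
     f2 * (g0 + \sum_i b i * g1 i + g2).
    rewrite /f2 mulr_suml; apply: eq_bigr => i _; rewrite mulr_suml.
    by apply: eq_bigr => j _; ring.
  have -> : \sum_i \sum_j f1 i * g1 j * (b i * b j) =
     (\sum_i b i * f1 i) * (\sum_i b i * g1 i).
    rewrite mulr_suml; apply: eq_bigr => i _; rewrite mulr_sumr.
    by apply: eq_bigr => j _; ring.
  have -> : \sum_i \sum_j (f0 + \sum_i b i * f1 i) * G i j * (b i * b j) =
     (f0 + \sum_i b i * f1 i) * g2.
    rewrite /g2 mulr_sumr; apply: eq_bigr => i _; rewrite mulr_sumr.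
    by apply: eq_bigr => j _; ring.
  by rewrite -/f1 -/g1; ring.
move=> c f g [F hf] [G hg]; exists (fun i j => c *: F i j + G i j).
rewrite !comp_mpolyD !comp_mpolyZ hf hg.
have -> : \sum_i b i * ((c *: f + g)^`M(i) \mPo [tuple a i | i < n]) =
   c *: (\sum_i b i * (f^`M(i) \mPo [tuple a i | i < n])) +
   \sum_i b i * (g^`M(i) \mPo [tuple a i | i < n]).
  rewrite scaler_sumr -big_split; apply: eq_bigr => i _ /=.
  by rewrite mderivD mderivZ comp_mpolyD comp_mpolyZ mulrDr -scalerAr.
have -> : \sum_i \sum_j (c *: F i j + G i j) * (b i * b j) =
   c *: (\sum_i \sum_j F i j * (b i * b j)) + \sum_i \sum_j G i j * (b i * b j).
  rewrite scaler_sumr -big_split; apply: eq_bigr => i _ /=.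
  rewrite scaler_sumr -big_split; apply: eq_bigr => j _ /=.
  by rewrite mulrDl -scalerAl.
by rewrite -!mul_mpolyC; ring.
Qed.

Lemma comp_line n k (f : {mpoly K[n]}) d (v : 'rV[K]_n) (t : {mpoly K[k]}) :
  f \is d.-homog -> f \mPo [tuple v 0 i *: t | i < n] = ev f v *: t ^+ d.
Proof.
move: f; apply: homog_ind.
- by rewrite comp_mpoly0 ev0 scale0r.
- by move=> c f g hf hg; rewrite comp_mpolyD comp_mpolyZ evD evZ hf hg scalerDl scalerA.
move=> m; rewrite comp_mpolyX /ev mevalX mdegE => <-.
rewrite -prodrXr -scaler_prod; apply: eq_bigr => i _.
by rewrite tnth_mktuple exprZn.
Qed.

Definition sing n (f : {mpoly K[n]}) (v : 'rV[K]_n) : Prop :=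
  ev f v = 0 /\ forall l, dD f v l = 0.

(** Expand [f] around [v 0 i *: t], where [t] is a multiple of a coordinate, equal to one at [v].
    The terms of order zero and one vanish because [f] is singular at [v], and the increments [y i]
    vanish on the line of [v]. *)
Lemma sing_local n d (f : {mpoly K[n]}) (v : 'rV[K]_n) :
  f \is d.+1.-homog -> sing f v -> v != 0 ->
  exists (y : 'I_n -> {mpoly K[n]}) (G : 'I_n -> 'I_n -> {mpoly K[n]}),
    (forall i c, ev (y i) (c *: v) = 0) /\
    f = \sum_i \sum_j G i j * (y i * y j).
Proof.
move=> hf [f0 f1] /rV0Pn [i0 vi0].
pose t : {mpoly K[n]} := (v 0 i0)^-1 *: 'X_i0.
pose y i : {mpoly K[n]} := 'X_i - v 0 i *: t.
have [G] := taylor2 f (fun i => v 0 i *: t) y.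
have -> : [tuple v 0 i *: t + y i | i < n] = [tuple 'X_i | i < n].
  by apply: eq_from_tnth => i; rewrite !tnth_mktuple /y addrC subrK.
rewrite comp_mpoly_id (comp_line _ _ hf) f0 scale0r add0r big1 ?add0r => [fE|i _].
  exists y, G; split => // i c.
  by rewrite /y /t evB !evZ !evXU !mxE; field.
by rewrite (comp_line _ _ (mderiv_homog _ hf)) -dD_delta f1 scale0r mulr0.
Qed.

Lemma singD n (f g : {mpoly K[n]}) v : sing f v -> sing g v -> sing (f + g) v.
Proof. by move=> [f0 f1] [g0 g1]; split => [|l]; rewrite ?evD ?dDD ?f0 ?f1 ?g0 ?g1 addr0. Qed.
Lemma sing_mulr n (f g : {mpoly K[n]}) v : sing f v -> sing (g * f) v.
Proof. by move=> [f0 f1]; split => [|l]; rewrite ?evM ?dDM f0 ?f1 !(mulr0, mul0r) ?addr0. Qed.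
Lemma sing_cancel n (f g : {mpoly K[n]}) v : ev g v != 0 -> sing (g * f) v -> sing f v.
Proof.
move=> g0 [h0 h1].
have f0 : ev f v = 0 by apply/eqP; move/eqP: h0; rewrite evM mulf_eq0 (negPf g0).
split => // l; apply/eqP; move/eqP: (h1 l).
by rewrite dDM f0 mul0r addr0 mulf_eq0 (negPf g0).
Qed.

End Taylor.

Section IdealSquare.
Variables (K : fieldType) (n : nat).
Notation poly := {mpoly K[n.+1]}.
Implicit Types (J : poly -> Prop) (f g : poly).

Lemma ideal_sqr0 J : ideal_sqr J 0.
Proof.
exists 0, (fun _ => 0), (fun _ => 0); split; rewrite ?big_ord0 //.
  by case.
by case.
Qed.

Lemma ideal_sqrD J f g : ideal_sqr J f -> ideal_sqr J g -> ideal_sqr J (f + g).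
Proof.
move=> [r1 [g1 [h1 [g1J h1J ->]]]] [r2 [g2 [h2 [g2J h2J ->]]]].
exists (r1 + r2)%N,
  (fun i => match split i with inl a => g1 a | inr a => g2 a end),
  (fun i => match split i with inl a => h1 a | inr a => h2 a end).
split; try by move=> i; case: (split i).
rewrite big_split_ord /=; congr (_ + _); apply: eq_bigr => i _.
  by case: splitP => // [j /= /val_inj ->|k /= e] //; have := ltn_ord i; rewrite e; lia.
by case: splitP => // [j /= e|k /= /addnI /val_inj ->] //; have := ltn_ord j; rewrite -e; lia.
Qed.

Lemma ideal_sqr_sum J (I : Type) (r : seq I) (P : pred I) (F : I -> poly) :
  (forall i, P i -> ideal_sqr J (F i)) -> ideal_sqr J (\sum_(i <- r | P i) F i).
Proof. by move=> h; elim/big_ind: _ => //; [apply: ideal_sqr0 | apply: ideal_sqrD]. Qed.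

Lemma ideal_sqr1 J f g : J f -> J g -> ideal_sqr J (f * g).
Proof.
by move=> Jf Jg; exists 1%N, (fun _ => f), (fun _ => g); rewrite big_ord1.
Qed.

End IdealSquare.

(** * Saturation of the square of the ideal of a finite set *)

Section Saturation.
Variables (K : fieldType) (n : nat) (A : {fset proj K n}).
Variable rep : proj K n -> 'rV[K]_n.+1.
Hypothesis repE : forall p, val p = <[rep p]>%VS.
Notation poly := {mpoly K[n.+1]}.
Implicit Types (f g : poly).

Lemma rep_neq0 p : rep p != 0.
Proof.
by have := valP p; rewrite repE dim_vline; case: (rep p != 0).
Qed.

Lemma rep_distinct : distinct_pts [set: A] (fun i : A => rep (val i)).
Proof.
split=> [i _|i j _ _ ij]; first exact: rep_neq0.
apply: contraNN ij => /vlineP [c e]; apply/eqP/val_inj/val_inj.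
rewrite !repE; apply/eqP; rewrite eqEdim -!repE (eqP (valP (val i))) (eqP (valP (val j))) andbT.
rewrite !repE -memvE e.
by apply: rpredZ; apply: memv_line.
Qed.

Lemma ideal_ofM f g : ideal_of A f -> ideal_of A (g * f).
Proof. by move=> h p pA v vp; rewrite mevalM (h p pA v vp) mulr0. Qed.

Lemma ideal_ofMr f g : ideal_of A f -> ideal_of A (f * g).
Proof. by rewrite mulrC; apply: ideal_ofM. Qed.

Lemma ideal_ofP f :
  ideal_of A f <-> forall (i : A) c, ev f (c *: rep (val i)) = 0.
Proof.
split=> [h i c|h p pA v].
  by apply: (h (val i) (valP i)); rewrite repE memvZ ?memv_line.
by rewrite repE => /vlineP[c ->]; apply: (h [` pA]%fset).
Qed.

Lemma double_sing f (i : A) : ideal_double A f -> sing f (rep (val i)).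
Proof.
have rv : rep (val i) \in val (val i) by rewrite repE memv_line.
move=> [r [g [h [gJ hJ ->]]]].
have g0 a : ev (g a) (rep (val i)) = 0 by apply: gJ rv; apply: valP.
have h0 a : ev (h a) (rep (val i)) = 0 by apply: hJ rv; apply: valP.
split=> [|l]; rewrite ?ev_sum ?dD_sum big1 // => a _.
  by rewrite evM g0 mul0r.
by rewrite dDM g0 h0 !mul0r addr0.
Qed.

(** Locally, the square of the ideal of the points consists of the functions singular at the
    points. For each point outside the zeros of [X], the form [ee i] is a multiple of [X] that
    vanishes at all other points, and a combination [E] of the squares of the [ee i] takes the
    values of a power [X^m]. Hence [E - X^m] is in the ideal, and [X^(2m) = (E - X^m)^2 + E (2 X^m
    - E)]. After multiplication by [f], the first term is a product of two elements of the ideal.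
    For the second one, [f] is near the [i]-th point a combination of products [y a * y b] of forms
    vanishing there, so that [ee i ^ 2 * f] is a combination of products of elements [ee i * y a]
    of the ideal. *)
Lemma saturation (X f : poly) e d :
  X \is e.+1.-homog -> f \is d.+1.-homog ->
  (forall i : A, ev X (rep (val i)) != 0 -> sing f (rep (val i))) ->
  exists m, ideal_double A (X ^+ m * f).
Proof.
move=> hX hf fs; pose P (i : A) := rep (val i).
have gP (i : A) : exists g : poly, [/\ g \is (e.+1 * #|` A|).-homog, ev g (P i) != 0 &
    forall j, j != i -> ev g (P j) = 0].
  have [|g [hg gi gA]] := @separating_form K _ A setT P i (e.+1 * #|` A|) rep_distinct (in_setT i).
    by rewrite setTD cardsC1 -cardfE; lia.
  by exists g; split => // j ji; apply: gA.
have [g hg] := fin_all_exists gP.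
pose U := [pred i : A | ev X (P i) != 0].
pose r := (#|` A|.+1)%N; pose m := (r * 2)%N.
pose ee i := g i * X.
have hee i : ee i \is (e.+1 * r).-homog.
  by rewrite mulnS addnC; apply: dhomogM hX; have [] := hg i.
have ee0 i j : j != i -> ev (ee i) (P j) = 0.
  by move=> ji; rewrite evM; have [_ _ ->] := hg i; rewrite // mul0r.
pose c i := ev X (P i) ^+ m / ev (ee i) (P i) ^+ 2.
pose E := \sum_(i | U i) c i *: ee i ^+ 2.
have hE : E - X ^+ m \is (e.+1 * m).-homog.
  apply: rpredB; last exact: dhomogMn.
  apply: rpred_sum => i _; apply: dhomogZ; rewrite /m mulnA; exact: dhomogMn.
have EP i : ev E (P i) = ev X (P i) ^+ m.
  rewrite /E ev_sum; case: (boolP (U i)) => Ui.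
    rewrite (bigD1 i) //= big1 ?addr0 => [|j /andP[_ ji]].
      rewrite evZ evX /c divfK // expf_neq0 // evM mulf_neq0 //.
      by have [] := hg i.
    by rewrite evZ evX ee0 ?expr0n ?mulr0 // eq_sym.
  move: (Ui); rewrite negbK => /eqP ->; rewrite expr0n big1 // => j Uj.
  rewrite evZ evX ee0 ?expr0n ?mulr0 //.
  by apply: contraNneq Ui => ->.
have EJ : ideal_of A (E - X ^+ m).
  apply/ideal_ofP => i a; rewrite (ev_homogZ _ _ hE) evB evX -/(P i) EP.
  by rewrite subrr mulr0.
exists (m * 2)%N.
have -> : X ^+ (m * 2) * f = (E - X ^+ m) * ((E - X ^+ m) * f) +
    \sum_(i | U i) ((c i)%:MP * (2%:R * X ^+ m - E)) * (ee i ^+ 2 * f).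
  rewrite (eq_bigr (fun i => (c i *: ee i ^+ 2) * ((2%:R * X ^+ m - E) * f))).
    by rewrite -mulr_suml -/E exprM; move: {+}E (X ^+ m) => Y Z; ring.
  move=> i _; rewrite -mul_mpolyC; move: {+}E (X ^+ m) (ee i) (c i)%:MP => Y Z T c'.
  by ring.
apply: ideal_sqrD; first by apply: ideal_sqr1 => //; apply: ideal_ofMr.
apply: ideal_sqr_sum => i Ui.
have [y [G [y0 ->]]] := sing_local hf (fs i Ui) (rep_neq0 (val i)).
rewrite !mulr_sumr; apply: ideal_sqr_sum => a _.
rewrite !mulr_sumr; apply: ideal_sqr_sum => b _.
set z := _%:MP * _.
have -> : z * (ee i ^+ 2 * (G a b * (y a * y b))) = (z * G a b * (ee i * y a)) * (ee i * y b).
  by move: z (ee i) (G a b) (y a) (y b) => z1 z2 z3 z4 z5; ring.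
have eey b' : ideal_of A (ee i * y b').
  apply/ideal_ofP => j k; rewrite evM; have [->|ji] := eqVneq j i.
    by rewrite y0 mulr0.
  by rewrite (ev_homogZ _ _ (hee i)) -/(P j) (ee0 i j ji) mulr0 mul0r.
by apply: ideal_sqr1 => //; apply: ideal_ofM.
Qed.

End Saturation.

(** * Divisibility by powers of the variables *)

Section MonomialIdeals.
Variables (K : fieldType) (n : nat).
Notation poly := {mpoly K[n]}.
Implicit Types (f g : poly).

Lemma mono_div f i k e : f \is (k + e).-homog ->
  {in msupp f, forall m : 'X_{1..n}, (k <= m i)%N} ->
  exists2 h : poly, h \is e.-homog & f = 'X_i ^+ k * h.
Proof.
move=> hf hm.
have mE (m : 'X_{1..n}) : (k <= m i)%N -> m = (U_(i) *+ k + (m - U_(i) *+ k))%MM.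
  move=> km; apply/mnmP => j; rewrite mnmDE mnmBE mulmnE mnm1E.
  by case: eqP => [<-|_] /=; lia.
exists (\sum_(m <- msupp f) f@_m *: 'X_[m - U_(i) *+ k]).
  rewrite big_seq; apply: rpred_sum => m mf; apply: dhomogZ.
  rewrite dhomogX /=; apply/eqP; have := dhomog_mf hf mf => /=.
  by rewrite {1}(mE m (hm m mf)) mdegD mdegMn mdeg1 mul1n => /addnI.
rewrite {1}(mpolyE f) mulr_sumr !big_seq; apply: eq_bigr => m mf.
by rewrite -scalerAr mpolyXn -mpolyXD -(mE m (hm m mf)).
Qed.

Lemma mcoeff_Xk_mul (p : poly) i k (m : 'X_{1..n}) :
  (m i < k)%N -> ('X_i ^+ k * p)@_m = 0.
Proof.
move=> mk; apply: memN_msupp_eq0; apply: contraTN mk => /msuppM_le.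
case/allpairsP => -[m1 m2] [/=]; rewrite mpolyXn msuppX inE => /eqP -> _ ->.
by rewrite -leqNgt mnmDE mulmnE mnm1E eqxx mul1n leq_addr.
Qed.

(** The powers of two variables form a regular sequence. *)
Lemma mono_dvd i j k f g e : i != j -> f \is (k + e).-homog ->
  'X_j ^+ k * f = 'X_i ^+ k * g -> exists2 h : poly, h \is e.-homog & f = 'X_i ^+ k * h.
Proof.
move=> ij hf fg; apply: mono_div => // m mf; rewrite leqNgt; apply/negP => mk.
have := mcoeff_Xk_mul g (m := (m + U_(j) *+ k)%MM) (i := i) (k := k).
rewrite mnmDE mulmnE mnm1E eq_sym (negPf ij) addn0 => /(_ mk).
rewrite -fg mpolyXn [_ * f]mulrC [(m + _)%MM]addmC mcoeffMX => f0.
by move: mf; rewrite mcoeff_msupp f0 eqxx.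
Qed.

(** The power of a third variable is not a zero divisor modulo the powers of two others. The
    monomials of [f] divisible by the first power are split off, and the coefficients of the others
    show that they are divisible by the second one. *)
Lemma mono_split i0 i1 i2 k e f a b : i2 != i0 -> i2 != i1 ->
  f \is (k + e).-homog -> 'X_i2 ^+ k * f = 'X_i0 ^+ k * a + 'X_i1 ^+ k * b ->
  exists g h : poly, [/\ g \is e.-homog, h \is e.-homog &
    f = 'X_i0 ^+ k * g + 'X_i1 ^+ k * h].
Proof.
move=> i20 i21 hf fE.
pose f0 : poly := \sum_(m <- msupp f | (k <= m i0)%N) f@_m *: 'X_[m].
pose f1 : poly := \sum_(m <- msupp f | ~~ (k <= m i0)%N) f@_m *: 'X_[m].
have fD : f = f0 + f1.
  by rewrite {1}(mpolyE f) (bigID (fun m : 'X_{1..n} => k <= m i0)%N).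
have hs (Q : pred 'X_{1..n}) : \sum_(m <- msupp f | Q m) f@_m *: 'X_[m] \is (k + e).-homog.
  rewrite big_seq_cond; apply: rpred_sum => m /andP[mf _]; apply: dhomogZ.
  by rewrite dhomogX /=; apply/eqP; apply: (dhomog_mf hf mf).
have sQ (Q : pred 'X_{1..n}) : {subset msupp (\sum_(m <- msupp f | Q m) f@_m *: 'X_[m]) <= [pred m in msupp f | Q m]}.
  move=> m; rewrite mcoeff_msupp raddf_sum /= inE.
  apply: contraR; rewrite negb_and => h; rewrite big_seq_cond big1 // => m' /andP[m'f Qm'].
  rewrite mcoeffZ mcoeffX; case: eqP => [e'|]; rewrite ?mulr0 //.
  by move: h; rewrite -e' m'f Qm'.
have [|g hg f0E] := @mono_div f0 i0 k e (hs _).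
  by move=> m /sQ /andP[].
have [|h hh f1E] := @mono_div f1 i1 k e (hs _).
  move=> m /sQ /andP[mf mk]; rewrite leqNgt; apply/negP => mk1.
  have := congr1 (mcoeff (m + U_(i2) *+ k)%MM) fE.
  have z (p : poly) i : (m i < k)%N -> i2 != i -> ('X_i ^+ k * p)@_(m + U_(i2) *+ k) = 0.
    by move=> mi ii; rewrite mcoeff_Xk_mul // mnmDE mulmnE mnm1E (negPf ii) addn0.
  rewrite mcoeffD (z a) 1?ltnNge // (z b) //.
  rewrite mpolyXn [_ * f]mulrC [(m + _)%MM]addmC mcoeffMX addr0 => f0'.
  by move: mf; rewrite mcoeff_msupp f0' eqxx.
by exists g, h; split; rewrite // fD f0E f1E.
Qed.

End MonomialIdeals.

(** * Cohomology of the twists of the structure sheaf *)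

Section FieldIdentities.
Variable (F : fieldType).
Implicit Types (a b c x y z t u v w l k q r : F).

(** Here [a], [b], [c] stand for powers of three variables, and the cocycle relation becomes a
    relation between numerators. The identities below serve the same purpose. *)
Lemma frac_cocycle a b c x y z : a != 0 -> b != 0 -> c != 0 ->
  y / (b * c) = z / (a * c) - x / (a * b) -> c * x = a * (- y) + b * z.
Proof.
move=> a0 b0 c0 e.
have -> : y = (z / (a * c) - x / (a * b)) * (b * c) by rewrite -e; field; rewrite c0 b0.
by field; rewrite c0 b0 a0.
Qed.

Lemma frac_shift a b c x y z t : a != 0 -> b != 0 -> c != 0 ->
  y / (b * c) = x / (a * c) - (a * z + b * t) / (a * b) ->
  b * (x - c * t) = a * (c * z + y).
Proof.
move=> a0 b0 c0 e.
have -> : y = (x / (a * c) - (a * z + b * t) / (a * b)) * (b * c).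
  by rewrite -e; field; rewrite c0 b0.
by field; rewrite c0 b0 a0.
Qed.

Lemma frac_split a c x y z : a != 0 -> c != 0 ->
  x - c * z = a * y -> x / (a * c) = y / c + z / a.
Proof.
move=> a0 c0 e; have -> : x = a * y + c * z by rewrite -e subrK.
by field; rewrite c0 a0.
Qed.

Lemma frac_cross a c x y : a != 0 -> c != 0 -> x / a = y / c -> c * x = a * y.
Proof.
move=> a0 c0 e; have -> : x = y / c * a by rewrite -e; field.
by field.
Qed.

Lemma frac_edge a c m x y z : m != 0 -> c != 0 -> a != 0 ->
  z / m = y / c - x / a -> m * (a * y - c * x) = a * c * z.
Proof.
move=> m0 c0 a0 e; have -> : z = (y / c - x / a) * m by rewrite -e divfK.
by field; rewrite c0 a0.
Qed.

Lemma jet_cancel x y u v l k t : x != 0 -> t != 0 -> x * u = k * t * l ->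
  x * (v - (t * ((x * t)^-1 * (x * v - k * y * l)) + y / t * u)) = 0.
Proof.
move=> x0 t0 e; have -> : u = k * t * l / x by rewrite -e mulrC mulKf.
by field; rewrite x0 t0.
Qed.

Lemma jet_compare x y z u v w l k q t r : x != 0 -> t != 0 -> r != 0 ->
  x * u = (q + k) * (r * t) * l -> x * v = q * r * l ->
  r * t * w + y * u = r * (t * z + k * (t / x) * y * l) + t * y * v -> w = z.
Proof.
move=> x0 t0 r0 ue ve e.
have -> : w = (r * (t * z + k * (t / x) * y * l) + t * y * v - y * u) / (r * t).
  by rewrite -e addrK mulrC mulKf // mulf_neq0.
have -> : u = (q + k) * (r * t) * l / x by rewrite -ue mulrC mulKf.
have -> : v = q * r * l / x by rewrite -ve mulrC mulKf.
by field; rewrite x0 t0 r0.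
Qed.

Lemma frac_sub a c x y : a != 0 -> c != 0 ->
  x / c - y / a = (a * x - c * y) / (a * c).
Proof. by move=> a0 c0; field; rewrite a0 c0. Qed.

Lemma frac_sub2 a b c x y : a != 0 -> b != 0 -> c != 0 ->
  x / c - y / b = (a * b * x - c * a * y) / (a * b * c).
Proof. by move=> a0 b0 c0; field; rewrite a0 b0 c0. Qed.

Lemma sub_swap x y z t : x - y = z - t -> x - z = y - t.
Proof. by move=> e; have -> : x = z - t + y; [rewrite -e subrK | ring]. Qed.

End FieldIdentities.

Section Cech.
Variables (K : fieldType) (n : nat).
Notation poly := {mpoly K[n.+3]}.
Notation frac := {fraction {mpoly K[n.+3]}}.

Lemma tofracX_neq0 (i : 'I_n.+3) k : tofrac ('X_i ^+ k : poly) != 0.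
Proof.
by rewrite tofrac_eq0 expf_neq0 // -msupp_eq0 msuppX.
Qed.

(** This is [H^1(O(d)) = 0] on a projective space of dimension at least two. The cocycle relation
    on three indices and [mono_split] write the numerator of [C_01] as [x_0^k g + x_1^k h]. Then
    [C_0j - h / x_0^k] has no pole along [x_0] by [mono_dvd], so that the [C_0j] differ by the
    common term [h / x_0^k] from fractions defined on the [j]-th chart. *)
Lemma cech_H1 d (C : 'I_n.+3 -> 'I_n.+3 -> frac) :
  (forall i j l, C j l = C i l - C i j) ->
  (forall i j, exists k (f : poly), f \is (d + k * 2).-homog /\
     C i j = tofrac f / tofrac (('X_i * 'X_j) ^+ k)) ->
  exists k (g : 'I_n.+3 -> poly), (forall i, g i \is (d + k).-homog) /\
    forall i j, C i j = tofrac (g j) / tofrac ('X_j ^+ k) - tofrac (g i) / tofrac ('X_i ^+ k).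
Proof.
move=> Ccoc Cloc.
have [k [f [hf Cf]]] : exists k (f : 'I_n.+3 -> 'I_n.+3 -> poly),
    (forall i j, f i j \is (k + (d + k)).-homog) /\
    forall i j, C i j = tofrac (f i j) / (tofrac ('X_i ^+ k) * tofrac ('X_j ^+ k)).
  have /fin_all_exists [kk] : forall ij : 'I_n.+3 * 'I_n.+3, exists k, exists f : poly,
      f \is (d + k * 2).-homog /\ C ij.1 ij.2 = tofrac f / tofrac (('X_ij.1 * 'X_ij.2) ^+ k).
    by move=> [i j]; apply: Cloc.
  case/fin_all_exists => f hf; pose k := \max_ij kk ij.
  have kkk ij : (kk ij <= k)%N by apply: leq_bigmax.
  exists k, (fun i j => ('X_i * 'X_j) ^+ (k - kk (i, j)) * f (i, j)).
  split=> i j; have [hfij Cij] := hf (i, j).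
    have -> : (k + (d + k) = 2 * (k - kk (i, j)) + (d + kk (i, j) * 2))%N.
      by have := kkk (i, j); lia.
    apply: dhomogM hfij; apply: dhomogMn.
    by apply: (@dhomogM _ _ _ 1 _ 1); rewrite dhomogX /= mdeg1.
  rewrite Cij /= -tofracM -exprMn -{2}(subnK (kkk (i, j))) exprD !tofracM.
  by rewrite -mulf_div divff ?mul1r // tofracXn tofracM expf_neq0 // mulf_neq0 // -['X__]expr1 tofracX_neq0.
pose Y (i : 'I_n.+3) : frac := tofrac ('X_i ^+ k).
have Y0 i : Y i != 0 by apply: tofracX_neq0.
pose i0 : 'I_n.+3 := ord0; pose i1 : 'I_n.+3 := lift ord0 ord0.
pose i2 : 'I_n.+3 := lift ord0 (lift ord0 ord0).
have [|g [h [hg hh f01]]] := @mono_split K n.+3 i0 i1 i2 k (d + k) (f i0 i1) (- f i1 i2) (f i0 i2) isT isT (hf _ _).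
  apply/eqP; rewrite -tofrac_eq; apply/eqP; rewrite tofracD !tofracM tofracN.
  have := Ccoc i0 i1 i2; rewrite !Cf -!/(Y _) => e.
  exact: frac_cocycle.
have eqj j : 'X_i1 ^+ k * (f i0 j - 'X_j ^+ k * h) = 'X_i0 ^+ k * ('X_j ^+ k * g + f i1 j).
  apply/eqP; rewrite -tofrac_eq; apply/eqP.
  rewrite !(tofracD, tofracN, tofracM) -!/(Y _).
  have := Ccoc i0 i1 j; rewrite !Cf -!/(Y _) f01 !(tofracD, tofracM) -!/(Y _).
  exact: frac_shift.
have ij : i0 != i1 by [].
have /fin_all_exists2 [q hq qE] j : exists2 q : poly, q \is (d + k).-homog &
    f i0 j - 'X_j ^+ k * h = 'X_i0 ^+ k * q.
  apply: (mono_dvd ij _ (eqj j)).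
  have hX : 'X_j ^+ k * h \is (k + (d + k)).-homog.
    by apply: dhomogM hh; rewrite mpolyXn dhomogX /= mdegMn mdeg1 mul1n.
  by rewrite rpredB ?hf ?hX.
have Cq j : C i0 j = tofrac (q j) / Y j + tofrac h / Y i0.
  have := congr1 (@tofrac _) (qE j); rewrite tofracB !tofracM -!/(Y _) Cf -!/(Y _).
  exact: frac_split.
exists k, q; split => // i j; rewrite (Ccoc i0 i j) !Cq -!/(Y _).
by rewrite opprD addrACA subrr addr0.
Qed.

(** By [mono_dvd], a fraction with denominators [x_0^k] and [x_1^k] is a polynomial. *)
Lemma cech_H0 d (g : 'I_n.+3 -> poly) k (b : frac) :
  (forall i, g i \is (k + d).-homog) ->
  (forall i, b = tofrac (g i) / tofrac ('X_i ^+ k)) ->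
  exists2 f : poly, f \is d.-homog & b = tofrac f.
Proof.
move=> hg bE; pose i0 : 'I_n.+3 := ord0; pose i1 : 'I_n.+3 := lift ord0 ord0.
have e : 'X_i1 ^+ k * g i0 = 'X_i0 ^+ k * g i1.
  apply/eqP; rewrite -tofrac_eq; apply/eqP; rewrite !tofracM.
  by apply: frac_cross (etrans (esym (bE i0)) (bE i1)); apply: tofracX_neq0.
have ij : i0 != i1 by [].
have [h hh gh] := mono_dvd ij (hg i0) e.
exists h => //; rewrite (bE i0) gh tofracM mulrC mulKf //.
exact: tofracX_neq0.
Qed.

End Cech.

(** * The cohomological meaning of dependencies *)

Section CechComputations.
Variables (K : fieldType) (n : nat).
Notation frac := {fraction {mpoly K[n.+1]}}.

Definition edge (i j : 'I_n.+1) : simplex n 1 := [ffun x => if x == ord0 then i else j].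
Definition triangle (i j l : 'I_n.+1) : simplex n 2 :=
  [ffun x => if x == ord0 then i else if x == ord_max then l else j].

Lemma edgeE (s : simplex n 1) : s = edge (s ord0) (s ord_max).
Proof.
apply/ffunP => x; rewrite ffunE; case: eqP => [->//|/eqP x0].
by congr (s _); apply/val_inj; case: x x0 => -[|[]].
Qed.

Lemma triangleE (s : simplex n 2) : s = triangle (s ord0) (s (lift ord0 ord0)) (s ord_max).
Proof.
apply/ffunP => x; rewrite ffunE; case: eqP => [->//|/eqP x0]; case: eqP => [->//|/eqP x2].
by congr (s _); apply/val_inj; case: x x0 x2 => -[|[|[]]].
Qed.

Lemma cech_diff0 (b : simplex n 0 -> frac) (s : simplex n 1) :
  cech_diff b s = b [ffun=> s ord_max] - b [ffun=> s ord0].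
Proof.
rewrite /cech_diff !big_ord_recl big_ord0 /= expr0 expr1 mul1r mulN1r addr0.
congr (b _ - b _); apply/ffunP => x; rewrite !ffunE; congr (s _); apply/val_inj;
  by rewrite !ord1.
Qed.

Lemma cech_diff1 (c : simplex n 1 -> frac) i j l :
  cech_diff c (triangle i j l) = c (edge j l) - c (edge i l) + c (edge i j).
Proof.
rewrite /cech_diff !big_ord_recl big_ord0 /= expr0 expr1 mul1r mulN1r addr0.
rewrite -[in X in _ + (_ + X) = _]signr_odd /= expr0 mul1r addrA.
congr (_ - _ + _); congr (c _); apply/ffunP => x; rewrite !ffunE;
  by case: x => -[|[|//]] ?; rewrite /= -?val_eqE.
Qed.

Lemma edge_prod i j : \prod_(a < 2) 'X_(edge i j a) = 'X_i * 'X_j :> {mpoly K[n.+1]}.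
Proof. by rewrite !big_ord_recl big_ord0 mulr1 !ffunE. Qed.

End CechComputations.

Section Bridge.
Variables (K : fieldType) (n d : nat) (A : {fset proj K n.+2}).
Hypothesis charK : [pchar K] =i pred0.
Variable rep : proj K n.+2 -> 'rV[K]_n.+3.
Hypothesis repE : forall p, val p = <[rep p]>%VS.
Notation poly := {mpoly K[n.+3]}.
Notation P := (fun i : A => rep (val i)).

Lemma natK_neq0 k : k.+1%:R != 0 :> K.
Proof. by rewrite (pcharf0P K).1. Qed.

(** By [saturation], being a section of the ideal sheaf of the double points only depends on the
    behaviour at the points of the open set. *)
Lemma sections_double p (s : simplex n.+2 p) k (f : poly) :
  f \is (d.+1 + k * p.+1).-homog ->
  (forall i : A, ev (\prod_(j < p.+1) 'X_(s j)) (P i) != 0 -> sing f (P i)) ->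
  sections (ideal_double A) d.+1 s (tofrac f / tofrac ((\prod_(j < p.+1) 'X_(s j)) ^+ k)).
Proof.
set X := \prod_(j < _) _ => hf fs.
have hX : X \is p.+1.-homog.
  rewrite -[X in X.-homog](card_ord p.+1) -sum1_card /X.
  elim/big_rec2: _ => [|j f0 e _ h]; first exact: dhomog1.
  by apply: dhomogM h; rewrite dhomogX /= mdeg1.
have [m hm] := saturation repE hX hf fs.
exists (m + k)%N, (X ^+ m * f); split => //.
  have -> : (d.+1 + (m + k) * p.+1 = p.+1 * m + (d.+1 + k * p.+1))%N by ring.
  by apply: dhomogM hf; apply: dhomogMn.
rewrite exprD !tofracM -mulf_div divff ?mul1r // tofrac_eq0 expf_neq0 //.
by apply/prodf_neq0 => i _; rewrite -msupp_eq0 msuppX.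
Qed.

(** The factor [v 0 i] avoids the exponent [k - 1]. *)
Lemma dD_Xn i k (v l : 'rV[K]_n.+3) :
  v 0 i * dD ('X_i ^+ k) v l = k%:R * v 0 i ^+ k * l 0 i.
Proof.
case: k => [|k]; first by rewrite expr0 dD1 mulr0 !mul0r.
by rewrite dDXn evXU dDXU exprS; ring.
Qed.

(** A cocycle is a difference of fractions [g i / x_i^k] by [cech_H1]. On common charts these agree
    to first order at the points, so they prescribe a gradient and a value at each point. In the
    absence of dependencies there is a form [f] of degree [d + 1] with these gradients, and by
    Euler's formula with these values. Then the [g i / x_i^k - f] are sections of the ideal sheaf
    with the same differences. *)
Lemma h_zero1_of_nodep :
  (forall lam, dep d.+1 P lam -> forall i, lam i = 0) ->
  h_zero 1 (ideal_double A) d.+1.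
Proof.
move=> nodep c [cJ cd].
pose C i j := c (edge i j).
have [|i j|k [g [hg Cg]]] := @cech_H1 K n d.+1 C.
- move=> i j l; have /eqP := cd (triangle i j l).
  by rewrite cech_diff1 -/(C _ _) -addrA addr_eq0 opprD opprK => /eqP.
- have [k [f [_ hf cE]]] := cJ (edge i j).
  by exists k, f; rewrite edge_prod in cE.
have hs i j (a : A) : P a 0 i != 0 -> P a 0 j != 0 -> sing ('X_i ^+ k * g j - 'X_j ^+ k * g i) (P a).
  move=> ai aj; have [m [f [Jf hf cE]]] := cJ (edge i j).
  have fa : sing f (P a) by apply: double_sing Jf.
  apply: (@sing_cancel _ _ _ (('X_i * 'X_j) ^+ m)).
    by rewrite evX evM !evXU expf_neq0 // mulf_neq0.
  have -> : ('X_i * 'X_j) ^+ m * ('X_i ^+ k * g j - 'X_j ^+ k * g i) = ('X_i * 'X_j) ^+ k * f.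
    apply/eqP; rewrite -tofrac_eq; apply/eqP; rewrite !(tofracM, tofracB).
    have := Cg i j; rewrite /C cE edge_prod.
    have := tofracX_neq0 K i k; have := tofracX_neq0 K j k.
    have : tofrac (('X_i * 'X_j) ^+ m : poly) != 0.
      by rewrite exprMn tofracM mulf_neq0 ?tofracX_neq0.
    rewrite [('X_i * 'X_j) ^+ k]exprMn tofracM.
    exact: frac_edge.
  exact: sing_mulr.
have /fin_all_exists [i0 hi0] : forall a : A, exists i, P a 0 i != 0.
  by move=> a; apply/rV0Pn; apply: rep_neq0 repE _.
pose x a := P a 0 (i0 a).
(* the gradient at [P a] of the fraction [g i / x_i^k] for a chart [i] that contains the point *)
pose T (a : A) : 'rV[K]_n.+3 := (x a ^+ k.+1)^-1 *: (x a *: (grad (g (i0 a)) (P a))^T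
   - (k%:R * ev (g (i0 a)) (P a)) *: delta_mx 0 (i0 a)).
have TE a l : (l *m (T a)^T) 0 0 = (x a ^+ k.+1)^-1 *
    (x a * dD (g (i0 a)) (P a) l - k%:R * ev (g (i0 a)) (P a) * l 0 (i0 a)).
  rewrite linearZ linearB /= !linearZ /= trmxK trmx_delta scalerN mulmxBr -!scalemxAr.
  by rewrite -colE dD_grad !mxE.
have [f hf fT] := gradients_surj nodep T.
have f0 a : ev f (P a) = ev (g (i0 a)) (P a) / x a ^+ k.
  apply: (mulfI (natK_neq0 d)); rewrite -(euler _ hf) fT TE (euler _ (hg _)).
  rewrite -/(x a); move: (ev _ _) (hi0 a) => y; rewrite -/(x a) natrD exprS => x0.
  by field; rewrite x0 expf_neq0.
have s0 a : sing (g (i0 a) - 'X_(i0 a) ^+ k * f) (P a).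
  have x0 : x a != 0 := hi0 a.
  split=> [|l]; first by rewrite evB evM evX evXU f0 -/(x a) mulrC divfK ?subrr ?expf_neq0.
  apply: (mulfI x0); rewrite mulr0 dDB dDM evX evXU f0 -/(x a) fT TE.
  have := dD_Xn (i0 a) k (P a) l; rewrite -/(x a).
  by rewrite exprS; apply: jet_cancel; rewrite // expf_neq0.
have ss i (a : A) : P a 0 i != 0 -> sing (g i - 'X_i ^+ k * f) (P a).
  move=> ai; apply: (@sing_cancel _ _ _ ('X_(i0 a) ^+ k)).
    by rewrite evX evXU expf_neq0.
  have -> : 'X_(i0 a) ^+ k * (g i - 'X_i ^+ k * f) =
     ('X_(i0 a) ^+ k * g i - 'X_i ^+ k * g (i0 a)) +
     'X_i ^+ k * (g (i0 a) - 'X_(i0 a) ^+ k * f).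
    by move: ('X_i ^+ k) ('X_(i0 a) ^+ k) => u v; ring.
  by apply: singD; [apply: hs | apply: sing_mulr].
pose b (s : simplex n.+2 0) := tofrac (g (s ord0)) / tofrac ('X_(s ord0) ^+ k) - tofrac f.
exists b; split=> s.
  have hX : \prod_(j < 1) 'X_(s j) = 'X_(s ord0) :> poly by rewrite big_ord1.
  have -> : b s = tofrac (g (s ord0) - 'X_(s ord0) ^+ k * f) /
      tofrac ((\prod_(j < 1) 'X_(s j)) ^+ k).
    rewrite hX tofracB tofracM mulrBl /b mulrC [X in _ = _ - X]mulrC mulKf ?tofracX_neq0 //.
  apply: sections_double; last by move=> a; rewrite hX evXU; apply: ss.
  have hXf : 'X_(s ord0) ^+ k * f \is (k + d.+1).-homog.
    by apply: dhomogM hf; rewrite mpolyXn dhomogX /= mdegMn mdeg1 mul1n.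
  by rewrite muln1 rpredB ?hg // addnC hXf.
rewrite {1}(edgeE s) -/(C _ _) Cg cech_diff0 /b !ffunE.
by rewrite opprB addrA subrK.
Qed.

(** In the large degree [d + 1 + k] there are no dependencies by [dep_large], so that there are
    forms [f j] with the first-order behaviour of [x_j^k] times a form with gradients [T]. The
    differences of the [f j / x_j^k] make up a cocycle of the ideal sheaf. If it is the coboundary
    of [b], the fractions [f j / x_j^k - b_j] are the same for all [j]; by [cech_H0] they are a
    form of degree [d + 1], and it has gradients [T]. *)
Lemma gradients_of_h_zero1 : h_zero 1 (ideal_double A) d.+1 ->
  forall T : A -> 'rV[K]_n.+3, exists2 f : poly, f \is d.+1.-homog &
    forall a l, dD f (P a) l = (l *m (T a)^T) 0 0.
Proof.
move=> h0 T; have [k' hk'] : exists k', k' = (2 * #|{: A}|)%N by eexists.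
pose k := k'.+1.
have nodepD lam : dep (d.+1 + k) P lam -> forall i, lam i = 0.
  move=> hl; apply: (dep_large charK (rep_distinct A repE) _ _ hl) => [|i].
    by rewrite cardsT -hk' /k; lia.
  by rewrite in_setT.
(* the value that Euler's formula imposes on a form of degree [d + 1] with gradient [T a] *)
pose tau a := (P a *m (T a)^T) 0 0 / d.+1%:R.
(* the gradient of the product of [x_j^k] with such a form *)
pose T' j a : 'rV[K]_n.+3 := P a 0 j ^+ k *: T a
  + (k%:R * P a 0 j ^+ k' * tau a) *: delta_mx 0 j.
have /fin_all_exists2 [f hf fT'] j := gradients_surj nodepD (T' j).
have fT j a l : dD (f j) (P a) l =
    P a 0 j ^+ k * (l *m (T a)^T) 0 0 + k%:R * P a 0 j ^+ k' * tau a * l 0 j.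
  rewrite fT' /T' linearD /= !linearZ /= trmx_delta mulmxDr -!scalemxAr -colE !mxE.
  by [].
have f0 j a : ev (f j) (P a) = P a 0 j ^+ k * tau a.
  have D0 : (d.+1 + k)%:R != 0 :> K by rewrite addSn natK_neq0.
  apply: (mulfI D0); rewrite -(euler _ (hf j)) fT.
  rewrite -[(P a *m _) 0 0](divfK (natK_neq0 d)) -/(tau a) natrD /k exprS.
  by move: (k'.+1%:R) (d.+1%:R) => u v; ring.
have fs i j a : sing ('X_i ^+ k * f j - 'X_j ^+ k * f i) (P a).
  split=> [|l]; first by rewrite evB !evM !evX !evXU !f0; ring.
  rewrite dDB !dDM !evX !evXU !f0 !fT !dDXn !dDXU !evXU /k !exprS.
  by move: (k'.+1%:R) => u; ring.
pose C i := tofrac (f i) / tofrac ('X_i ^+ k).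
pose c (s : simplex n.+2 1) := C (s ord_max) - C (s ord0).
have cc : cocycle (ideal_double A) d.+1 c.
  split=> s; last first.
    by rewrite (triangleE s) cech_diff1 /c !ffunE /=; move: (C _) (C _) (C _) => u v w; ring.
  rewrite (edgeE s); move: (s ord0) (s ord_max) => i j.
  have -> : c (edge i j) = tofrac ('X_i ^+ k * f j - 'X_j ^+ k * f i) /
      tofrac ((\prod_(a < 2) 'X_(edge i j a)) ^+ k).
    rewrite edge_prod exprMn !tofracB !tofracM /c /C !ffunE /=.
    apply: frac_sub; exact: tofracX_neq0.
  apply: sections_double; last by move=> a _; apply: fs.
  have hX i' j' : 'X_i' ^+ k * f j' \is (k + (d.+1 + k)).-homog.
    by apply: dhomogM; rewrite // mpolyXn dhomogX /= mdegMn mdeg1 mul1n.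
  by have -> : (d.+1 + k * 2 = k + (d.+1 + k))%N; [lia | rewrite rpredB ?hX].
have [b [bJ bE]] := h0 c cc.
have /fin_all_exists [kk] i := bJ [ffun=> i].
case/fin_all_exists => h hh.
pose m := \max_i kk i; have km i : (kk i <= m)%N by apply: leq_bigmax.
pose B i := C i - b [ffun=> i].
have BE i j : B i = B j.
  have := bE (edge j i); rewrite cech_diff0 /c !ffunE /= => e.
  exact: sub_swap.
have bEh i : b [ffun=> i] = tofrac (h i) / tofrac ('X_i ^+ kk i).
  by have [_ _ ->] := hh i; rewrite big_ord1 ffunE.
pose g i := 'X_i ^+ m * f i - 'X_i ^+ (k + (m - kk i)) * h i.
have gB i : B i = tofrac (g i) / tofrac ('X_i ^+ (m + k)).
  rewrite /B /C bEh /g tofracB !tofracM.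
  have := tofracX_neq0 K i k; have := tofracX_neq0 K i (kk i).
  have := tofracX_neq0 K i (m - kk i).
  have mE : 'X_i ^+ m = 'X_i ^+ (m - kk i) * 'X_i ^+ (kk i) :> poly.
    by rewrite -exprD subnK.
  rewrite !exprD mE !tofracM; exact: frac_sub2.
have hg i : g i \is ((m + k) + d.+1).-homog.
  have [_ hi _] := hh i.
  have hX q p (u : poly) : u \is p.-homog -> 'X_i ^+ q * u \is (q + p).-homog.
    by move=> hu; apply: dhomogM hu; rewrite mpolyXn dhomogX /= mdegMn mdeg1 mul1n.
  apply: rpredB.
    by have -> : (m + k + d.+1 = m + (d.+1 + k))%N; [lia | apply: hX].
  have -> : (m + k + d.+1 = (k + (m - kk i)) + (d.+1 + kk i * 1))%N.
    by have := km i; lia.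
  exact: hX.
have [|F hF BF] := @cech_H0 K n d.+1 g (m + k) (B ord0) hg.
  by move=> i; rewrite (BE ord0 i).
exists F => // a l.
have [i x0] : exists i, P a 0 i != 0 by apply/rV0Pn; apply: rep_neq0 repE _.
have hs : sing (h i) (P a) by have [Jh _ _] := hh i; apply: double_sing Jh.
have FE : 'X_i ^+ (m + k) * F = 'X_i ^+ m * f i - 'X_i ^+ (k + (m - kk i)) * h i.
  apply/eqP; rewrite -tofrac_eq; apply/eqP; rewrite -/(g i) tofracM.
  by rewrite -BF (BE ord0 i) gB mulrC divfK ?tofracX_neq0.
have F0 : ev F (P a) = tau a.
  have := congr1 (fun u => ev u (P a)) FE; rewrite evB !evM hs.1 !evX !evXU f0.
  by rewrite mulr0 subr0 mulrA -exprD => /(mulfI (expf_neq0 _ x0)).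
have := congr1 (fun u => dD u (P a) l) FE.
rewrite dDB !dDM hs.1 hs.2 mulr0 mul0r addr0 subr0 F0 f0 fT !evX !evXU.
have e1 := dD_Xn i (m + k) (P a) l; have e2 := dD_Xn i m (P a) l.
rewrite natrD [P a 0 i ^+ _]exprD in e1; rewrite exprD.
have -> : P a 0 i ^+ k' = P a 0 i ^+ k / P a 0 i by rewrite /k exprS mulrC mulKf.
exact: jet_compare x0 (expf_neq0 _ x0) (expf_neq0 _ x0) e1 e2.
Qed.

Lemma h_zero1P : h_zero 1 (ideal_double A) d.+1 <->
  forall lam, dep d.+1 P lam -> forall i, lam i = 0.
Proof.
split=> [h0 lam hlam i|]; last exact: h_zero1_of_nodep.
apply/rowP => j; rewrite mxE.
have [f hf fT] := gradients_of_h_zero1 h0 (fun a => if a == i then delta_mx 0 j else 0).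
rewrite -[RHS](hlam f hf) (bigD1 i) //= big1 ?addr0 => [|a ai].
  by rewrite fT eqxx trmx_delta -colE mxE.
by rewrite fT (negPf ai) trmx0 mulmx0 mxE.
Qed.

Lemma h_pos0_of_form (f : poly) : f != 0 -> f \is d.+1.-homog ->
  (forall i : A, sing f (P i)) -> h_pos 0 (ideal_double A) d.+1.
Proof.
move=> f0 hf fs; exists (fun _ => tofrac f); split; last first.
  by move/(_ [ffun=> ord0])/eqP; rewrite tofrac_eq0 (negPf f0).
split=> s; last by rewrite cech_diff0 subrr.
have := @sections_double 0 s 0 f; rewrite expr0 tofrac1 divr1 addn0.
by apply.
Qed.

End Bridge.

(** * The twisted cubic *)

Local Notation o4 k := (@Ordinal 4 k isT).

Section TwistedCubic.
Variable (K : fieldType).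

Definition cubic : 4.-tuple {mpoly K[2]} :=
  [tuple 'X_ord0 ^+ (3 - j) * 'X_ord_max ^+ j | j < 4].

Lemma cubic_homog i : tnth cubic i \is 3.-homog.
Proof.
suff: tnth cubic i \is ((3 - i) + i).-homog by rewrite subnK // -ltnS ltn_ord.
by rewrite tnth_mktuple; apply: dhomogM; rewrite mpolyXn dhomogX /= mdegMn mdeg1 mul1n.
Qed.

Lemma gmap_cubic u : gmap cubic u = veronese 3 (u 0 ord0) (u 0 ord_max).
Proof. by apply/rowP => j; rewrite !mxE tnth_mktuple evM !evX !evXU. Qed.

Lemma row4P (v w : 'rV[K]_4) : v 0 (o4 0) = w 0 (o4 0) -> v 0 (o4 1) = w 0 (o4 1) ->
  v 0 (o4 2) = w 0 (o4 2) -> v 0 (o4 3) = w 0 (o4 3) -> v = w.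
Proof.
move=> h0 h1 h2 h3; apply/rowP => -[[|[|[|[|//]]]] i].
- by rewrite (_ : Ordinal i = o4 0) //; apply/val_inj.
- by rewrite (_ : Ordinal i = o4 1) //; apply/val_inj.
- by rewrite (_ : Ordinal i = o4 2) //; apply/val_inj.
by rewrite (_ : Ordinal i = o4 3) //; apply/val_inj.
Qed.

Lemma jac_cubic (u w : 'rV[K]_2) (s := u 0 ord0) (t := u 0 ord_max) (a := w 0 ord0) (b := w 0 ord_max) :
  [/\ jac cubic u w 0 (o4 0) = 3%:R * s ^+ 2 * a,
      jac cubic u w 0 (o4 1) = 2%:R * s * t * a + s ^+ 2 * b,
      jac cubic u w 0 (o4 2) = t ^+ 2 * a + 2%:R * s * t * b &
      jac cubic u w 0 (o4 3) = 3%:R * t ^+ 2 * b].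
Proof.
rewrite !mxE !tnth_mktuple /= !subSS !subn0 !expr0 !expr1.
rewrite !(dDM, evM, evX, dD1, ev1, dDXU, evXU).
by rewrite -/s -/t -/a -/b; split; ring.
Qed.

Lemma row2P (v w : 'rV[K]_2) : v 0 ord0 = w 0 ord0 -> v 0 ord_max = w 0 ord_max -> v = w.
Proof.
move=> h0 h1; apply/rowP => -[[|[|//]] i].
- by rewrite (_ : Ordinal i = ord0) //; apply/val_inj.
by rewrite (_ : Ordinal i = ord_max) //; apply/val_inj.
Qed.

(** The minors of the matrix with rows [x_0 x_1 x_2] and [x_1 x_2 x_3], which generate the ideal of
    the curve. *)
Definition quadric (k : 'I_3) : {mpoly K[4]} :=
  match val k with
  | 0 => 'X_(o4 0) * 'X_(o4 2) - 'X_(o4 1) * 'X_(o4 1)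
  | 1 => 'X_(o4 0) * 'X_(o4 3) - 'X_(o4 1) * 'X_(o4 2)
  | _ => 'X_(o4 1) * 'X_(o4 3) - 'X_(o4 2) * 'X_(o4 2)
  end.

Lemma quadric_homog k : quadric k \is 2.-homog.
Proof.
have h i j : 'X_i * 'X_j \is [in K[4], 2.-homog].
  by apply: (@dhomogM _ _ _ 1 _ 1); rewrite dhomogX /= mdeg1.
by rewrite /quadric; case: (val k) => [|[|_]]; rewrite rpredB ?h.
Qed.

Lemma ev_quadric_cubic k u : ev (quadric k) (gmap cubic u) = 0.
Proof.
rewrite gmap_cubic /quadric; case: (val k) => [|[|_]];
  rewrite evB !evM !evXU !mxE /= !subSS !subn0; ring.
Qed.

Lemma mpolyX2E (m : 'X_{1..2}) :
  'X_[m] = 'X_ord0 ^+ m ord0 * 'X_ord_max ^+ m ord_max :> {mpoly K[2]}.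
Proof.
by rewrite mpolyXE_id big_ord_recl big_ord1; congr (_ * 'X__ ^+ m _); apply/val_inj.
Qed.

(** The twisted cubic is projectively normal: a monomial of degree [3 e.+1] is divisible by one of
    degree three. *)
Lemma cubic_surj e B : B \is (e * 3).-homog ->
  exists2 g : {mpoly K[4]}, g \is e.-homog & g \mPo cubic = B.
Proof.
move: B; apply: homog_ind.
- by exists 0; rewrite ?dhomog0 ?comp_mpoly0.
- move=> c f g [f1 hf1 <-] [g1 hg1 <-]; exists (c *: f1 + g1).
    by rewrite rpredD ?rpredZ.
  by rewrite comp_mpolyD comp_mpolyZ.
elim: e => [|e IHe] m hm.
  exists 1; first exact: dhomog1.
  rewrite comp_mpoly1; move/eqP: hm; rewrite mul0n mdeg_eq0 => /eqP ->.
  by rewrite mpolyX0.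
rewrite mnm2E mulSn in hm.
pose j := minn 3 (m ord_max); have j4 : (j < 4)%N by rewrite /j; lia.
pose m' : 'X_{1..2} := [multinom (if i == ord0 then m i - (3 - j) else m i - j)%N | i < 2].
have [|g hg gE] := IHe m'.
  by rewrite mnm2E !mnmE /=; rewrite /j; lia.
exists ('X_(Ordinal j4) * g).
  by apply: (@dhomogM _ _ _ 1 _ e) hg; rewrite dhomogX /= mdeg1.
rewrite rmorphM /= gE comp_mpolyXU -tnth_nth tnth_mktuple /=.
rewrite (mpolyX2E m') (mpolyX2E m) !mnmE /=.
rewrite mulrACA -!exprD; congr ('X__ ^+ _ * 'X__ ^+ _); rewrite /j; lia.
Qed.

End TwistedCubic.

Section TwistedCubicTangents.
Variable (K : fieldType).
Hypothesis charK : [pchar K] =i pred0.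
Local Notation cubic := (cubic K).
Local Notation quadric := (quadric K).

Let three : 3%:R != 0 :> K. Proof. by rewrite (pcharf0P K).1. Qed.

Lemma jac_cubic_inj u w : u != 0 -> jac cubic u w = 0 -> w = 0.
Proof.
move=> u0 /rowP j0; have [] := jac_cubic u w; rewrite !j0 !mxE.
set s := u 0 _; set t := u 0 _; set a := w 0 _; set b := w 0 _ => e0 e1 e2 e3.
have [s0|s0] := eqVneq s 0; last first.
  have a0 : a = 0.
    by apply: (mulfI (mulf_neq0 three (expf_neq0 2 s0))); rewrite mulr0 -e0.
  have b0 : b = 0.
    by apply: (mulfI (expf_neq0 2 s0)); move: e1; rewrite a0 !mulr0 add0r => <-.
  by apply: row2P; rewrite mxE.
have t0 : t != 0.
  by apply: contraNneq u0 => t0; apply/eqP/row2P; rewrite mxE.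
have a0 : a = 0.
  by apply: (mulfI (expf_neq0 2 t0)); move: e2; rewrite s0 !mulr0 !mul0r addr0 => <-.
have b0 : b = 0.
  by apply: (mulfI (mulf_neq0 three (expf_neq0 2 t0))); rewrite mulr0 -e3.
by apply: row2P; rewrite mxE.
Qed.

(** The gradients of the quadrics cut out the tangent spaces of the cone over the curve. One solves
    for [w] from two of the coordinates, and the quadrics determine the other two. *)
Lemma tangent_cubic u lam : u != 0 ->
  (forall k, dD (quadric k) (gmap cubic u) lam = 0) ->
  exists w, lam = jac cubic u w.
Proof.
move=> u0 hq.
have := (hq (@Ordinal 3 0 isT), (hq (@Ordinal 3 1 isT), hq (@Ordinal 3 2 isT))).
rewrite /quadric /= !dDB !dDM !dDXU !evXU gmap_cubic !mxE /= !subSS !subn0 !expr0.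
set s := u 0 _; set t := u 0 _.
set l0 := lam 0 (o4 0); set l1 := lam 0 (o4 1); set l2 := lam 0 (o4 2); set l3 := lam 0 (o4 3).
move=> [e1 [e2 e3]].
have [s0|s0] := eqVneq s 0.
  have t0 : t != 0 by apply: contraNneq u0 => t0; apply/eqP/row2P; rewrite mxE.
  have l00 : l0 = 0.
    apply: (mulfI (expf_neq0 3 t0)); rewrite mulr0 -e2 s0; ring.
  have l10 : l1 = 0.
    apply: (mulfI (expf_neq0 3 t0)); rewrite mulr0 -e3 s0; ring.
  pose w : 'rV[K]_2 := \row_j if j == ord0 then l2 / t ^+ 2 else l3 / (3%:R * t ^+ 2).
  exists w; have [j0 j1 j2 j3] := jac_cubic u w.
  have w0 : w 0 ord0 = l2 / t ^+ 2 by rewrite mxE.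
  have w1 : w 0 ord_max = l3 / (3%:R * t ^+ 2) by rewrite mxE.
  rewrite -/s -/t w0 w1 in j0 j1 j2 j3.
  apply: row4P; rewrite ?j0 ?j1 ?j2 ?j3 -/l0 -/l1 -/l2 -/l3 ?l00 ?l10 ?s0; field;
    by rewrite ?three ?t0.
pose a := l0 / (3%:R * s ^+ 2); pose b := (l1 - 2%:R * s * t * a) / s ^+ 2.
pose w : 'rV[K]_2 := \row_j if j == ord0 then a else b.
exists w; have [j0 j1 j2 j3] := jac_cubic u w.
have w0 : w 0 ord0 = a by rewrite mxE.
have w1 : w 0 ord_max = b by rewrite mxE.
rewrite -/s -/t w0 w1 in j0 j1 j2 j3.
have l2E : l2 = (2%:R * s * t * l1 - t ^+ 2 * l0) / s ^+ 2.
  apply: (mulfI (expf_neq0 3 s0)).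
  have -> : s ^+ 3 * l2 = 2%:R * s ^+ 2 * t * l1 - s * t ^+ 2 * l0.
    by apply/eqP; rewrite -subr_eq0 -[X in _ == X]e1; apply/eqP; ring.
  by field.
have l3E : l3 = (s * t ^+ 2 * l1 + s ^+ 2 * t * l2 - t ^+ 3 * l0) / s ^+ 3.
  apply: (mulfI (expf_neq0 3 s0)).
  have -> : s ^+ 3 * l3 = s * t ^+ 2 * l1 + s ^+ 2 * t * l2 - t ^+ 3 * l0.
    by apply/eqP; rewrite -subr_eq0 -[X in _ == X]e2; apply/eqP; ring.
  by field.
apply: row4P; rewrite ?j0 ?j1 ?j2 ?j3 -/l0 -/l1 -/l2 -/l3 ?l3E ?l2E /b /a; field;
  by rewrite ?three ?s0.
Qed.

(** The products of the quadrics with forms [g] of degree [d] are tested first. On the curve only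
    the derivative of the quadric contributes, multiplied by a value of [g], that is, of a binary
    form of degree [3 d]; these values are independent, so each [lam i] is tangent to the curve.
    The dependency then comes from a binary one of degree [3 d + 6], to which [dep_large] applies. *)
Lemma cubic_dep0 (I : finType) d (u : I -> 'rV[K]_2) (lam : I -> 'rV[K]_4) :
  distinct_pts setT u -> (2 * #|I| <= (d.+2 * 3).+1)%N -> (#|I| <= (d * 3).+1)%N ->
  dep d.+2 (fun i => gmap cubic (u i)) lam -> forall i, lam i = 0.
Proof.
move=> hu h1 h2 hd.
have tan i : exists w, lam i = jac cubic (u i) w.
  apply: tangent_cubic => [|k]; first exact: hu.1.
  suff h : {in [set: I], forall i, dD (quadric k) (gmap cubic (u i)) (lam i) = 0} by apply: h.
  apply: (ev_large (e := d * 3) hu) => [|B hB]; first by rewrite cardsT.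
  have [g hg <-] := cubic_surj hB.
  have hqg : quadric k * g \is d.+2.-homog.
    by have -> : d.+2 = (2 + d)%N by []; apply: dhomogM hg; apply: quadric_homog.
  rewrite -[RHS](hd _ hqg); apply: eq_big => [j|j _]; first by rewrite in_setT.
  by rewrite dDM ev_quadric_cubic mul0r add0r ev_comp mulrC.
have /fin_all_exists [w lamE] := tan.
have wd : dep (d.+2 * 3) u w.
  move=> B /cubic_surj [f hf <-]; rewrite -[RHS](hd f hf).
  by apply: eq_bigr => i _; rewrite dD_comp lamE.
move=> i; rewrite lamE (dep_large charK hu _ _ wd) //.
- by apply/rowP => j; rewrite !mxE dDl0.
- by rewrite cardsT.
by move=> j; rewrite in_setT.
Qed.

End TwistedCubicTangents.

(** * Points on a twisted cubic form a minimally Terracini set *)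

Section PointsOnCubic.
Variable (K : fieldType).

Lemma proj_vpick n (p : proj K n) : val p = <[vpick (val p)]>%VS.
Proof.
apply/esym/eqP; rewrite eqEdim (eqP (valP p)) dim_vline -memvE memv_pick /=.
by rewrite vpick0 -dimv_eq0 (eqP (valP p)).
Qed.

(** The description of cohomology by dependencies refers to representatives of all points of the
    projective space; here a choice made on [S] is extended. *)
Lemma exists_rep n (S : {fset proj K n}) (P : S -> 'rV[K]_n.+1) :
  (forall i, val (val i) = <[P i]>%VS) ->
  exists2 rep : proj K n -> 'rV[K]_n.+1, forall p, val p = <[rep p]>%VS &
    forall i, rep (val i) = P i.
Proof.
move=> hP; exists (fun p => if insub p is Some i then P i else vpick (val p)).
  by move=> p; case: insubP => [i _ <-//|_]; apply: proj_vpick.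
by move=> i; rewrite valK.
Qed.

Lemma not_h_zero1 n (J : {mpoly K[n.+1]} -> Prop) d : ~ h_zero 1 J d -> h_pos 1 J d.
Proof.
move=> h; apply: NNPP => h'; apply: h => c cc; apply: NNPP => nc.
by apply: h'; exists c.
Qed.

Lemma ev_linear_form n (I : finType) (g : {mpoly K[n]}) (a : I -> K) (p : I -> 'rV[K]_n) :
  g \is 1.-homog -> \sum_i a i * ev g (p i) = ev g (\sum_i a i *: p i).
Proof.
move: g; apply: homog_ind.
- by rewrite ev0 big1 // => i _; rewrite ev0 mulr0.
- move=> c f g hf hg; rewrite evD evZ -hf -hg mulr_sumr -big_split.
  by apply: eq_bigr => i _; rewrite evD evZ /=; ring.
move=> m /eqP/mdeg1P [j /eqP ->]; rewrite evXU summxE.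
by apply: eq_bigr => i _; rewrite evXU mxE.
Qed.

(** Evaluations at four points are independent on binary cubics. *)
Lemma cubic_span (v : 'I_4 -> 'rV[K]_2) (c : 'cV[K]_4) :
  distinct_pts setT v -> (forall k, gmap (cubic K) (v k) *m c = 0) -> c = 0.
Proof.
move=> hv hc; pose N : 'M[K]_4 := \matrix_k gmap (cubic K) (v k).
have Nu : N \in unitmx.
  rewrite -row_free_unit -kermx_eq0; apply/rowV0P => a /sub_kermxP aN.
  have a0 : {in setT, forall k, a 0 k = 0}.
    apply: (ev_large (e := 1 * 3) hv) => [|B hB]; first by rewrite cardsT card_ord.
    have [g hg <-] := cubic_surj hB.
    rewrite (eq_bigl xpredT) => [|k]; last by rewrite in_setT.
    under eq_bigr do rewrite ev_comp.
    rewrite ev_linear_form //; have -> : \sum_k a 0 k *: gmap (cubic K) (v k) = a *m N.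
      by rewrite mulmx_sum_row; apply: eq_bigr => k _; rewrite rowK.
    by rewrite aN -(scale0r 0) (ev_homogZ _ _ hg) mul0r.
  by apply/rowP => k; rewrite mxE a0 ?in_setT.
have: N *m c = 0 by apply/row_matrixP => k; rewrite row_mul rowK hc row0.
by move/(congr1 (mulmx (invmx N))); rewrite mulKmx // mulmx0.
Qed.

Lemma distinct_pts_inj n (I J : finType) (f : J -> I) (P : I -> 'rV[K]_n) :
  injective f -> distinct_pts setT P -> distinct_pts setT (P \o f).
Proof.
move=> fi [P0 Pd]; split=> [j _|i j _ _ ij]; first by apply: P0; rewrite in_setT.
by apply: Pd; rewrite ?in_setT // (inj_eq fi).
Qed.

Hypothesis charK : [pchar K] =i pred0.
Variables (d x : nat) (S : {fset proj K 3}) (M : 'M[K]_4).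
Hypotheses (hd : (7 <= d)%N) (hx : x = (1 + uphalf (3 * d))%N) (hS : #|` S| = x).
Hypothesis Mu : M \in unitmx.
Hypothesis SM : forall p, p \in S -> exists u v : K,
  (u, v) <> (0, 0) /\ val p = <[veronese 3 u v *m M]>%VS.

(** The square of a quadric containing the curve, times a power of a linear form, is singular along
    the curve. Because [2 x >= 3 d + 2], the parameters of the points carry a binary dependency of
    degree [3 d], which is pushed forward to the curve. A proper subset has [y] points with [2 y <=
    3 d + 1], and [cubic_dep0] excludes dependencies on it. *)
Theorem cubic_min_Terracini : min_Terracini d x S.
Proof.
have [u [u0 uE]] : exists u : S -> 'rV[K]_2, (forall i, u i != 0) /\
    forall i, val (val i) = <[gmap (cubic K) (u i) *m M]>%VS.
  have /fin_all_exists [u hu] : forall i : S, exists u : 'rV[K]_2, u != 0 /\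
      val (val i) = <[gmap (cubic K) u *m M]>%VS.
    move=> i; have [s [t [st iE]]] := SM (valP i).
    pose u : 'rV[K]_2 := \row_j if j == ord0 then s else t.
    exists u; split; last by rewrite gmap_cubic !mxE.
    apply/eqP => /rowP uz; apply: st.
    by have := (uz ord0, uz ord_max); rewrite !mxE /= => -[-> ->].
  by exists u; split=> i; have [] := hu i.
have [rep repE repu] := exists_rep uE.
have udist : distinct_pts setT u.
  split=> [i _|i j _ _ ij]; first exact: u0.
  apply: contraNN ij => /vlineP [c uij]; apply/eqP/val_inj/val_inj => /=.
  have gE : gmap (cubic K) (u i) = c ^+ 3 *: gmap (cubic K) (u j).
    by apply/rowP => k; rewrite !mxE uij (ev_homogZ _ _ (cubic_homog _ k)).
  have c0 : c ^+ 3 != 0.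
    by rewrite expf_neq0 //; apply: contraNneq (u0 i); rewrite uij => ->; rewrite scale0r.
  apply/eqP; rewrite eqEdim (eqP (valP (val i))) (eqP (valP (val j))) andbT.
  by rewrite !uE gE -scalemxAl -memvE memvZ ?memv_line.
have cS : #|{: S}| = x by rewrite -cardfE.
have d2 : d = (d - 2).+2 by lia.
have d1 : d = d.-1.+1 by lia.
have xge : (x >= 4)%N by lia.
have nodep (A : {fset proj K 3}) : (A `<` S)%fset ->
    forall lam : A -> 'rV[K]_4, dep d (fun i => rep (val i)) lam -> forall i, lam i = 0.
  move=> AS lam hdep.
  have AxS : (#|` A| < x)%N by rewrite -hS; apply: fproper_ltn_card.
  have sAS := fproper_sub AS.
  pose f (i : A) : S := fincl sAS i.
  have fi : injective f by move=> i j /(congr1 val) /= /val_inj.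
  have hdep' : dep (d - 2).+2 (fun i => gmap (cubic K) ((u \o f) i)) (fun i => lam i *m invmx M).
    rewrite -d2; have := dep_linear (invmx M) hdep; apply: eq_dep => // i.
    have -> : val i = val (f i) by [].
    by rewrite repu mulmxK.
  move=> i; have : lam i *m invmx M = 0.
    apply: (cubic_dep0 charK (distinct_pts_inj fi udist) _ _ hdep').
      by rewrite -cardfE; lia.
    by rewrite -cardfE; lia.
  by move/(congr1 (mulmx^~ M)); rewrite mulmxKV // mul0mx.
split; last first.
  by move=> A AS; rewrite d1; apply/(h_zero1P _ _ charK repE); rewrite -d1; apply: nodep.
split=> //.
- pose F : {mpoly K[4]} := ('X_(o4 0) * 'X_(o4 2) - 'X_(o4 1) * 'X_(o4 1)) ^+ 2 * 'X_(o4 0) ^+ (d - 4).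
  have hF : F \is d.-homog.
    have -> : d = (2 * 2 + 1 * (d - 4))%N by lia.
    apply: dhomogM; apply: dhomogMn; last by rewrite dhomogX /= mdeg1.
    exact: (quadric_homog K (Ordinal (isT : 0 < 3)%N)).
  have hF' : F \mPo ltup (invmx M) \is d.-1.+1.-homog.
    rewrite -d1 -[d]muln1; apply: comp_homog hF => i.
    by rewrite tnth_mktuple lf_homog.
  rewrite d1; apply: (h_pos0_of_form repE _ hF').
    pose v : 'rV[K]_4 := \row_j ((j == o4 0) || (j == o4 2))%:R.
    apply/eqP => /(congr1 (fun f => ev f (v *m M))); rewrite ev0 ev_comp gmap_ltup mulmxK //.
    rewrite /F !(evM, evX, evB, evXU) !mxE /= !(mulr0, mulr1, subr0, expr1n) => /eqP.
    by rewrite oner_eq0.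
  move=> i; rewrite repu; have q0 := ev_quadric_cubic (Ordinal (isT : 0 < 3)%N) (u i).
  rewrite /quadric /= in q0.
  split=> [|l]; rewrite ?ev_comp ?dD_comp gmap_ltup mulmxK //.
    by rewrite /F evM evX q0 expr0n mul0r.
  by rewrite /F dDM evX dDXn q0 !expr1 !(mulr0, mul0r, expr0n, addr0).
- apply: not_h_zero1; rewrite d1 => /(h_zero1P _ _ charK repE) h.
  have [|w [_ [i wi] wd]] := @binary_dep K S setT u (d * 3).
    by rewrite cardsT cS; lia.
  have := dep_linear M (dep_pullback (cubic_homog K) wd).
  move=> hdep; have := h (fun i => jac (cubic K) (u i) (w i) *m M).
  rewrite -d1 => /(_ _ i) h0.
  have : jac (cubic K) (u i) (w i) *m M = 0.
    by apply: h0; apply: eq_dep hdep => // j; rewrite repu.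
  move/(congr1 (mulmx^~ (invmx M))); rewrite mulmxK // mul0mx => /(jac_cubic_inj charK (u0 i)).
  by move/eqP; rewrite (negPf wi).
apply/eqP; rewrite eqEsubv subvf /=; apply/subvP => v _; apply: contraT => /separate [c cS' cv].
pose f (k : 'I_4) : S := enum_val (cast_ord (esym cS) (widen_ord xge k)).
have fi : injective f.
  by move=> i j /enum_val_inj /cast_ord_inj /(congr1 val) /= /val_inj.
have c0 : M *m c = 0.
  apply: (cubic_span (distinct_pts_inj fi udist)) => k; rewrite mulmxA /= -repu.
  apply: cS'; rewrite big_seq_fsetE /=.
  apply: (subvP (sumv_sup (f k) isT (subvv _))).
  by rewrite repE memv_line.
move/eqP: cv; case; have -> : c = 0.
  by rewrite -(mulKmx Mu c) c0 mulmx0.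
by rewrite mulmx0 mxE.
Qed.

End PointsOnCubic.

(** * Covering vectors by subspaces that avoid given ones *)

Section RadoEdmonds.
Variables (K : fieldType) (V : vectType K).
Implicit Types (F G W : {vspace V}) (E : seq V).

Definition cnt F E := count (fun v => v \in F) E.

(** The condition under which, by [edmonds], the vectors of [E] can be covered with multiplicity by
    subspaces that meet the [U i] trivially. *)
Definition room k (U : 'I_k -> {vspace V}) E :=
  forall F, (cnt F E + \sum_i \dim (U i) <= \sum_i \dim (F + U i))%N.

Lemma dim_add_notin F v : v \notin F -> (\dim F < \dim (F + <[v]>))%N.
Proof.
move=> vF; have sF : (F <= F + <[v]>)%VS := addvSl _ _.
rewrite ltn_neqAle dimvS // andbT; apply: contra vF => eF.
have /eqP -> : F == (F + <[v]>)%VS by rewrite eqEdim sF /= (eqP eF).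
exact: (subvP (addvSr _ _)) (memv_line v).
Qed.

Lemma dim_add_pt F v : v \notin F -> \dim (F + <[v]>) = (\dim F).+1.
Proof.
move=> vF; apply/eqP; rewrite eqn_leq dim_add_notin // andbT.
apply: leq_trans (dimv_add_leqif _ _) _; rewrite dim_vline.
by case: (v != 0); rewrite ?addn1 ?addn0.
Qed.

Definition tight k (U : 'I_k -> {vspace V}) E F :=
  (\sum_i \dim (F + U i) <= cnt F E + \sum_i \dim (U i))%N.

(** Counting vectors is supermodular in the subspace and the sum of dimensions is submodular, so
    that equality in the inequality of [room] passes to sums. *)
Lemma tight_add k (U : 'I_k -> {vspace V}) E F G :
  room U E -> tight U E F -> tight U E G -> tight U E (F + G)%VS.
Proof.
rewrite /tight => hU hF hG; have hc := hU (F :&: G)%VS.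
have cnt : (cnt F E + cnt G E <=
    cnt (F + G)%VS E + cnt (F :&: G)%VS E)%N.
  rewrite /cnt; elim: E {hU hF hG hc} => //= v E IHE.
  have -> : (v \in (F :&: G)%VS) = (v \in F) && (v \in G) by rewrite memv_cap.
  have : (v \in F) || (v \in G) -> v \in (F + G)%VS.
    by case/orP; apply/subvP; rewrite ?addvSl ?addvSr.
  case: (v \in F); case: (v \in G) => //=; try (move=> /(_ isT) ->); lia.
have dims : (\sum_i \dim (F + G + U i) + \sum_i \dim (F :&: G + U i) <=
    \sum_i \dim (F + U i) + \sum_i \dim (G + U i))%N.
  rewrite -!big_split; apply: leq_sum => i _ /=.
  rewrite -[X in (_ <= X)%N]dimv_sum_cap; apply: leq_add; apply: dimvS.
    rewrite !subv_add (subv_trans (addvSl F (U i)) (addvSl _ _)).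
    rewrite (subv_trans (addvSl G (U i)) (addvSr _ _)).
    by rewrite (subv_trans (addvSr G (U i)) (addvSr _ _)).
  by rewrite subv_cap !addvS ?capvSl ?capvSr.
by lia.
Qed.

(** This is the theorem of Rado and Edmonds on covering by independent sets, for matroids given by
    vectors in the quotients by the [U i]. The proof is by induction on the length of [E]. If the
    first vector [e] can be added to some [U i] while [room] stays true for the other vectors, the
    induction hypothesis applies and [e] is added to [W i]. Otherwise there is for every [i] a
    tight subspace [F i] with [e] in [F i + U i]. Their sum [G] is tight, and adding [e] to [G]
    does not change the dimensions of the [G + U i] but raises the count, against [room]. *)
Lemma edmonds k (U : 'I_k -> {vspace V}) E : room U E ->
  exists W : 'I_k -> {vspace V}, (forall i, W i :&: U i = 0)%VS /\
    forall v, (count_mem v E <= #|[set i | v \in W i]|)%N.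
Proof.
elim: E U => [|e E IHE] U hU.
  by exists (fun _ => 0%VS); split=> // i; rewrite cap0v.
have [|noroom] := classic (exists i, e \notin U i /\
    room (fun j => if j == i then (U i + <[e]>)%VS else U j) E).
  move=> [i [eU hU']]; have [W [WU Wc]] := IHE _ hU'.
  exists (fun j => if j == i then (W i + <[e]>)%VS else W j).
  have Wi : (W i :&: (U i + <[e]>) = 0)%VS by have := WU i; rewrite eqxx.
  have eW : e != 0 -> e \notin W i.
    move=> e0; apply: contra e0 => eW; rewrite -memv0 -Wi memv_cap eW.
    exact: (subvP (addvSr _ _)) (memv_line e).
  have e0 : e != 0 by apply: contraNneq eU => ->; rewrite mem0v.
  split=> [j|v].
    case: eqP => [->|/eqP ji]; last by have := WU j; rewrite (negPf ji).
    apply/eqP; rewrite -subv0; apply/subvP => u; rewrite memv_cap => /andP[].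
    case/memv_addP => w wW [_ /vlineP [a ->] uE] uU.
    have w0 : w = 0.
      apply/eqP; rewrite -memv0 -Wi memv_cap wW.
      have -> : w = u - a *: e by rewrite uE addrK.
      apply: rpredB; first exact: (subvP (addvSl _ _)) uU.
      by apply: rpredZ; apply: (subvP (addvSr _ _)) (memv_line e).
    rewrite w0 add0r in uE; rewrite uE memv0 scaler_eq0; apply/orP; left.
    by apply: contraNT eU => a0; rewrite -[e](scalerK a0) -uE rpredZ.
  apply: leq_trans (_ : (v == e) + #|[set j | v \in W j]| <= _)%N.
    by rewrite /= eq_sym leq_add2l.
  have sub : [set j | v \in W j] \subset [set j | v \in if j == i then (W i + <[e]>)%VS else W j].
    apply/subsetP => j; rewrite !inE; case: eqP => [->|//].
    exact: (subvP (addvSl _ _)).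
  have [ve|_] := eqVneq v e; last exact: subset_leq_card.
  rewrite add1n; apply: proper_card; apply/properP; split=> //.
  exists i; rewrite !inE ve ?eqxx ?eW //.
  exact: (subvP (addvSr _ _)) (memv_line e).
have hE : room U E.
  by move=> F; apply: leq_trans (hU F); rewrite leq_add2r /cnt /= leq_addl.
have /fin_all_exists2 [F Ft eF] i : exists2 F, tight U E F & e \in (F + U i)%VS.
  have [eU|eU] := boolP (e \in U i).
    exists 0%VS; last by rewrite add0v.
    rewrite /tight (eq_bigr (fun i => \dim (U i))) ?leq_addl // => j _.
    by rewrite add0v.
  have /not_all_ex_not [F hF] : ~ room (fun j => if j == i then (U i + <[e]>)%VS else U j) E.
    by move=> h; apply: noroom; exists i.
  move/negP: hF => hF; rewrite -ltnNge in hF.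
  have hs (X : {vspace V} -> {vspace V}) : (\sum_j \dim (X (if j == i then (U i + <[e]>)%VS else U j)) =
      \dim (X (U i + <[e]>)%VS) + \sum_(j | j != i) \dim (X (U j)))%N.
    rewrite (bigD1 i) //= eqxx; congr (_ + _)%N; apply: eq_bigr => j /negPf -> //.
  rewrite (hs (fun x => (F + x)%VS)) (hs id) /= in hF.
  have hFE := hE F; rewrite (bigD1 i) //= [in X in (_ <= X)%N](bigD1 i) //= in hFE.
  have dU := dim_add_notin eU.
  have dUle : (\dim (U i + <[e]>) <= (\dim (U i)).+1)%N.
    apply: leq_trans (dimv_add_leqif _ _) _; rewrite -addn1 leq_add2l dim_vline.
    by case: (e != 0).
  have eFU : e \in (F + U i)%VS.
    apply: contraT => /dim_add_notin; rewrite -addvA; lia.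
  exists F => //; rewrite /tight (bigD1 i) //= [in X in (_ <= X)%N](bigD1 i) //=.
  have sFU : (\dim (F + U i) <= \dim (F + (U i + <[e]>)))%N.
    by apply: dimvS; rewrite addvS // addvSl.
  lia.
pose G := (\sum_i F i)%VS.
have Gt : tight U E G.
  rewrite /G; apply: (big_ind (tight U E)) => [|x y|i _]; last exact: Ft; last exact: tight_add.
  rewrite /tight (eq_bigr (fun i => \dim (U i))) ?leq_addl // => j _.
  by rewrite add0v.
have eG i : e \in (G + U i)%VS.
  apply: (subvP _) (eF i); apply: addvS => //; exact: sumv_sup.
have := hU (G + <[e]>)%VS.
have -> : cnt (G + <[e]>)%VS (e :: E) = (cnt (G + <[e]>)%VS E).+1.
  by rewrite /cnt /= (subvP (addvSr _ _) _ (memv_line e)).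
have -> : (\sum_i \dim (G + <[e]> + U i) = \sum_i \dim (G + U i))%N.
  apply: eq_bigr => i _; congr (\dim _).
  rewrite -addvA (addvC <[e]>%VS) addvA; apply/addv_idPl.
  by rewrite -memvE.
have : (cnt G E <= cnt (G + <[e]>)%VS E)%N.
  by apply: sub_count => v; apply: (subvP (addvSl _ _)).
by move: Gt; rewrite /tight; lia.
Qed.

End RadoEdmonds.

(** * Isolating one vector of a dependency *)

Section Core.
Variables (K : fieldType) (n : nat).
Notation V := 'rV[K]_n.
Hypothesis charK : [pchar K] =i pred0.
Implicit Types (p l : V) (E : seq V) (F : {vspace V}).

Definition zeros k (c : 'I_k -> 'cV[K]_n) (v : V) : {set 'I_k} :=
  [set i | (v *m c i) 0 0 == 0].

(** [edmonds] with all [U i] equal to the line of [p]; each [W i] lies in a hyperplane that misses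
    [p]. *)
Lemma transversal_forms k p E : p != 0 ->
  (forall F, p \in F -> (cnt F E <= k * (\dim F).-1)%N) ->
  exists c : 'I_k -> 'cV[K]_n, (forall i, (p *m c i) 0 0 != 0) /\
    forall v, (count_mem v E <= #|zeros c v|)%N.
Proof.
move=> p0 hE.
have [F|W [WU Wc]] := @edmonds K V k (fun _ => <[p]>%VS) E.
  rewrite !sum_nat_const card_ord dim_vline p0 muln1.
  have pF : p \in (F + <[p]>)%VS by apply: (subvP (addvSr _ _)) (memv_line p).
  have d0 : (0 < \dim (F + <[p]>))%N.
    by rewrite lt0n dimv_eq0; apply: contraNneq p0 => e; rewrite e memv0 in pF.
  have := hE _ pF; have : (cnt F E <= cnt (F + <[p]>)%VS E)%N.
    by apply: sub_count => v; apply: (subvP (addvSl _ _)).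
  by move: (cnt _ _) (cnt _ _) => a b; case: (\dim _) d0 => // m _; rewrite /= mulnS; lia.
have /fin_all_exists2 [c cW cp] i : exists2 c : 'cV[K]_n,
    forall w, w \in W i -> w *m c = 0 & (p *m c) 0 0 != 0.
  apply: separate; apply: contra p0 => pW.
  by rewrite -memv0 -(WU i) memv_cap pW memv_line.
exists c; split=> // v; apply: leq_trans (Wc v) _; apply: subset_leq_card.
by apply/subsetP => i; rewrite !inE => /cW ->; rewrite mxE.
Qed.

(** One [U i] is replaced by the plane of [p] and [l], so that the corresponding hyperplane can be
    chosen through [p] and transverse to [l]. *)
Lemma transversal_forms_tangent k p l E : p != 0 -> l \notin <[p]>%VS ->
  (forall F, p \in F -> (cnt F E + (l \in F) <= k.+1 * (\dim F).-1)%N) ->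
  exists c : 'I_k.+1 -> 'cV[K]_n, [/\ (forall i, i != ord0 -> (p *m c i) 0 0 != 0),
    (p *m c ord0) 0 0 = 0, (l *m c ord0) 0 0 != 0 &
    forall v, (count_mem v E <= #|zeros c v|)%N].
Proof.
move=> p0 lp hE.
have [F|W [WU Wc]] := @edmonds K V k.+1 (fun i => if i == ord0 then <[p]> + <[l]> else <[p]>)%VS E.
  rewrite !big_ord_recl /= !sum_nat_const card_ord dim_vline p0 muln1.
  have dl : (\dim (<[p]> + <[l]>) <= 2)%N.
    by apply: leq_trans (dimv_add_leqif _ _) _; rewrite !dim_vline; case: (_ != 0); case: (_ != 0).
  have pF : p \in (F + <[p]>)%VS by apply: (subvP (addvSr _ _)) (memv_line p).
  have d0 : (0 < \dim (F + <[p]>))%N.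
    by rewrite lt0n dimv_eq0; apply: contraNneq p0 => e; rewrite e memv0 in pF.
  have := hE _ pF; have : (cnt F E <= cnt (F + <[p]>)%VS E)%N.
    by apply: sub_count => v; apply: (subvP (addvSl _ _)).
  have : (\dim (F + <[p]>) + (l \notin (F + <[p]>)%VS) <= \dim (F + (<[p]> + <[l]>)))%N.
    rewrite addvA; have [lF|lF] := boolP (l \in (F + <[p]>)%VS).
      by rewrite addn0 dimvS // addvSl.
    by rewrite addn1 dim_add_notin.
  move: (cnt _ _) (cnt _ _) => a b; case: (\dim (F + <[p]>)) d0 => // m _.
  move: (\dim (<[p]> + <[l]>)) dl (\dim (F + _)) => u du w.
  by case: (l \in _); rewrite /= mulSn mulnS; move: (k * m)%N => km; lia.
have /fin_all_exists [c hc] i : exists c : 'cV[K]_n, [/\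
    forall w, w \in W i -> w *m c = 0, i != ord0 -> (p *m c) 0 0 != 0 &
    i = ord0 -> (p *m c) 0 0 = 0 /\ (l *m c) 0 0 != 0].
  case: (eqVneq i ord0) => [->|i0]; last first.
    have [|c cW cp] := @separate K n (W i) p.
      apply: contra p0 => pW; have := WU i; rewrite (negPf i0) => e.
      by rewrite -memv0 -e memv_cap pW memv_line.
    by exists c; split=> // e; rewrite e eqxx in i0.
  have [|c cW cp] := @separate K n (W ord0 + <[p]>)%VS l.
    apply: contra lp => /memv_addP [w wW [_ /vlineP [a ->] lE]].
    have w0 : w = 0.
      apply/eqP; have := WU ord0; rewrite eqxx => e; rewrite -memv0 -e memv_cap wW /=.
      have -> : w = - (a *: p) + l by rewrite lE [w + _]addrC addKr.
      by apply: memv_add; rewrite ?memvN ?memvZ ?memv_line.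
    by rewrite lE w0 add0r memvZ ?memv_line.
  exists c; split=> // [w wW|_]; first by apply: cW; apply: (subvP (addvSl _ _)).
  split=> //; rewrite cW ?mxE //; exact: (subvP (addvSr _ _)) (memv_line p).
exists c; split.
- by move=> i i0; have [_ h _] := hc i; apply: h.
- by have [_ _ h] := hc ord0; have [] := h erefl.
- by have [_ _ h] := hc ord0; have [] := h erefl.
move=> v; apply: leq_trans (Wc v) _; apply: subset_leq_card.
by apply/subsetP => i; rewrite !inE => vW; have [h _ _] := hc i; rewrite h ?mxE.
Qed.

Variables (I : finType) (d : nat) (P lam : I -> V).
Hypothesis Pdist : distinct_pts setT P.
Hypothesis hdep : dep d P lam.

Definition killed (g : {mpoly K[n]}) i := ev g (P i) = 0 /\ dD g (P i) (lam i) = 0.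

(** At a point other than [P i0] the test form contributes nothing if [g] is killed there, if [g]
    and one of the linear forms vanish, or if two of the linear forms vanish. *)
Lemma isolate k e (c : 'I_k -> 'cV[K]_n) E g i0 :
  g \is e.-homog -> d = (e + k)%N ->
  (forall v, (count_mem v E <= #|zeros c v|)%N) ->
  (forall i, i != i0 -> [\/ killed g i, ev g (P i) = 0 /\ P i \in E
     | (2 <= count_mem (P i) E)%N]) ->
  dD (g * \prod_i lf (c i)) (P i0) (lam i0) = 0.
Proof.
move=> hg dE hc hE; set h := \prod_i _.
have hh : h \is k.-homog.
  rewrite -[X in X.-homog](card_ord k) -sum1_card /h.
  by elim/big_rec2: _ => [|j f0 m _ H]; [apply: dhomog1 | apply: dhomogM H; apply: lf_homog].
have : g * h \is d.-homog by rewrite dE; apply: dhomogM.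
move/hdep; rewrite (bigD1 i0) //= big1 ?addr0 // => i /hE.
rewrite dDM; case=> [[-> ->]|[-> iE]|i2]; first by rewrite mul0r mulr0 addr0.
  have : (0 < #|zeros c (P i)|)%N.
    by apply: leq_trans (hc (P i)); rewrite -has_count has_pred1.
  case/card_gt0P => j; rewrite inE => /eqP j0.
  by rewrite /h (bigD1 j) //= evM ev_lf j0 !mul0r addr0.
have : (1 < #|zeros c (P i)|)%N by apply: leq_trans (hc (P i)).
case/card_gt1P => a [b [ha hb ab]]; move: ha hb; rewrite !inE => /eqP a0 /eqP b0.
rewrite /h (bigD1 a) //= (bigD1 b) 1?eq_sym //= !dDM !evM !ev_lf a0 b0.
by rewrite !(mul0r, mulr0, addr0).
Qed.

Lemma dD_prod_lf k (c : 'I_k.+1 -> 'cV[K]_n) p l : (p *m c ord0) 0 0 = 0 ->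
  dD (\prod_i lf (c i)) p l = (l *m c ord0) 0 0 * \prod_(i | i != ord0) (p *m c i) 0 0.
Proof.
move=> p0; rewrite (bigD1 ord0) //= dDM ev_lf p0 mul0r add0r dD_lf ev_prod mulrC.
by congr (_ * _); apply: eq_bigr => i _; rewrite ev_lf.
Qed.

(** The test form of [isolate] sees only [lam i0]. If [lam i0] is a multiple of [P i0], all the
    linear forms are taken nonzero at [P i0], and Euler's formula gives a nonzero value. Otherwise
    one of them vanishes at [P i0] but not along [lam i0]. The bound on the number of points in
    subspaces through [P i0] is the condition of [edmonds]. *)
Theorem core k e E g i0 : g \is e.-homog -> d = (e + k.+1)%N -> lam i0 != 0 ->
  ev g (P i0) != 0 ->
  (forall i, i != i0 -> [\/ killed g i, ev g (P i) = 0 /\ P i \in E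
     | (2 <= count_mem (P i) E)%N]) ->
  cnt <[P i0]>%VS E = 0%N ->
  (forall F, P i0 \in F -> (1 < \dim F)%N ->
     (cnt F E + (lam i0 \in F) <= k.+1 * (\dim F).-1)%N) -> False.
Proof.
move=> hg dE l0 g0 hE hline hF.
have p0 : P i0 != 0 := Pdist.1 i0 (in_setT _).
have dim1 F : P i0 \in F -> (\dim F <= 1)%N -> F = <[P i0]>%VS.
  move=> pF F1; apply/esym/eqP; rewrite eqEdim -memvE pF dim_vline p0.
  by apply: leq_trans F1 _.
have [lp|lp] := boolP (lam i0 \in <[P i0]>%VS).
  have [F pF|c [cp cE]] := @transversal_forms k.+1 (P i0) E p0.
    case: (leqP (\dim F) 1) => F1; first by rewrite (dim1 F pF F1) hline.
    by apply: leq_trans (hF F pF F1); rewrite leq_addr.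
  have := isolate hg dE cE hE; have [a la] := vlineP _ _ lp.
  have hG : g * \prod_i lf (c i) \is d.-homog.
    rewrite dE; apply: dhomogM => //; rewrite -[X in X.-homog](card_ord k.+1) -sum1_card.
    by elim/big_rec2: _ => [|j f0 m _ H]; [apply: dhomog1 | apply: dhomogM H; apply: lf_homog].
  rewrite la dDlZ (euler _ hG) evM ev_prod => /eqP; rewrite !mulf_eq0 (negPf g0) /=.
  case/orP => [/eqP a0|]; first by rewrite la a0 scale0r eqxx in l0.
  rewrite (pcharf0P K).1 // dE addnS /= => /prodf_eq0 [i _].
  by rewrite ev_lf (negPf (cp i)).
have [F pF|c [cp c0 cl cE]] := @transversal_forms_tangent k (P i0) (lam i0) E p0 lp.
  case: (leqP (\dim F) 1) => F1; last exact: hF.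
  by rewrite (dim1 F pF F1) hline (negPf lp).
have := isolate hg dE cE hE.
have h0 : ev (\prod_i lf (c i)) (P i0) = 0.
  by rewrite ev_prod (bigD1 ord0) //= ev_lf c0 mul0r.
rewrite dDM h0 mul0r addr0 dD_prod_lf //.
move/eqP; rewrite !mulf_eq0 (negPf g0) (negPf cl) /= => /prodf_eq0 [i i0'].
by rewrite (negPf (cp i i0')).
Qed.

(** In this variant [g] itself vanishes at [P i0] and has a nonzero derivative along [lam i0]. *)
Theorem core_tangent k e E g i0 : g \is e.-homog -> d = (e + k)%N ->
  ev g (P i0) = 0 -> dD g (P i0) (lam i0) != 0 ->
  (forall i, i != i0 -> [\/ killed g i, ev g (P i) = 0 /\ P i \in E
     | (2 <= count_mem (P i) E)%N]) ->
  (forall F, P i0 \in F -> (cnt F E <= k * (\dim F).-1)%N) -> False.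
Proof.
move=> hg dE g0 g1 hE hF.
have [F pF|c [cp cE]] := @transversal_forms k (P i0) E (Pdist.1 i0 (in_setT _)).
  exact: hF.
have := isolate hg dE cE hE.
rewrite dDM g0 mul0r add0r ev_prod => /eqP; rewrite mulf_eq0 (negPf g1) orbF.
by case/prodf_eq0 => i _; rewrite ev_lf (negPf (cp i)).
Qed.

Definition on F : {set I} := [set i | P i \in F].

Lemma cnt_set F (X : {set I}) : cnt F [seq P i | i <- enum X] = #|X :&: on F|.
Proof.
rewrite /cnt count_map cardE -size_filter; apply: perm_size; apply: uniq_perm.
- by rewrite filter_uniq ?enum_uniq.
- exact: enum_uniq.
by move=> i; rewrite mem_filter !mem_enum !inE andbC.
Qed.

Lemma on_line i (X : {set I}) : i \notin X -> X :&: on <[P i]>%VS = set0.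
Proof.
move=> iX; apply/setP => j; rewrite !inE; apply/negP => /andP[jX jP].
have [ji|ji] := eqVneq j i; first by rewrite ji (negPf iX) in jX.
by have := Pdist.2 j i (in_setT _) (in_setT _) ji; rewrite jP.
Qed.

(** The points at which [g] is not killed are to be covered twice. *)
Lemma core_double k e (X : {set I}) g i0 : g \is e.-homog -> d = (e + k.+1)%N ->
  lam i0 != 0 -> ev g (P i0) != 0 -> i0 \notin X ->
  (forall i, i != i0 -> i \notin X -> killed g i) ->
  (forall F, P i0 \in F -> (1 < \dim F)%N ->
     (2 * #|X :&: on F| + (lam i0 \in F) <= k.+1 * (\dim F).-1)%N) -> False.
Proof.
move=> hg dE l0 g0 i0X hX hF; pose s := [seq P i | i <- enum X].
have cE F : cnt F (s ++ s) = (2 * #|X :&: on F|)%N.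
  by rewrite /cnt count_cat -/(cnt F s) cnt_set mul2n addnn.
apply: (@core k e (s ++ s) g i0) => //.
- move=> i ii0; have [iX|iX] := boolP (i \in X); last by constructor 1; apply: hX.
  constructor 3; rewrite count_cat.
  suff : (0 < count_mem (P i) s)%N by lia.
  by rewrite -has_count has_pred1; apply: map_f; rewrite mem_enum.
- by rewrite cE on_line // cards0.
by move=> F pF F1; rewrite cE; apply: hF.
Qed.

(** As [g] vanishes at all points, they only have to be covered once. *)
Lemma core_single k e g i0 : g \is e.-homog -> d = (e + k)%N ->
  (forall i, ev g (P i) = 0) -> dD g (P i0) (lam i0) != 0 ->
  (forall F, P i0 \in F -> (#|on F|.-1 <= k * (\dim F).-1)%N) -> False.
Proof.
move=> hg dE hX g1 hF; apply: (@core_tangent k e [seq P i | i <- enum (setT :\ i0)] g i0) => //.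
  by move=> i ii0; constructor 2; split=> //; apply: map_f; rewrite mem_enum !inE ii0.
move=> F pF; rewrite cnt_set; apply: leq_trans (hF F pF).
have -> : #|on F| = #|on F :\ i0|.+1 by rewrite (cardsD1 i0) inE pF.
by apply: subset_leq_card; apply/subsetP => j; rewrite !inE => /andP[/andP[-> _] ->].
Qed.

End Core.

(** * Planes with many points: reduction to a plane and a line *)

Section Incidence.
Variables (K : fieldType) (I : finType) (P : I -> 'rV[K]_4).
Hypothesis Pdist : distinct_pts setT P.
Implicit Types (F G L N H : {vspace 'rV[K]_4}).
Local Notation on := (on P).

Lemma dim_le4 F : (\dim F <= 4)%N.
Proof. by apply: leq_trans (dimvS (subvf F)) _; rewrite dimvf dim_matrix. Qed.

Lemma onS F G : (F <= G)%VS -> on F \subset on G.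
Proof. by move=> /subvP FG; apply/subsetP => i; rewrite !inE; apply: FG. Qed.

Lemma onI F G : on (F :&: G)%VS = on F :&: on G.
Proof. by apply/setP => i; rewrite !inE memv_cap. Qed.

Lemma on_dim1 F : (\dim F <= 1)%N -> (#|on F| <= 1)%N.
Proof.
move=> F1; rewrite leqNgt; apply/negP => /card_gt1P [i [j [iF jF ij]]].
have := Pdist.2 i j (in_setT _) (in_setT _) ij; rewrite !inE in iF jF.
have P0 := Pdist.1 j (in_setT _).
have /eqP -> : <[P j]>%VS == F by rewrite eqEdim -memvE jF dim_vline P0.
by rewrite iF.
Qed.

Lemma dim_cap_lt F G : (\dim F <= \dim G)%N -> F != G -> (\dim (F :&: G) < \dim G)%N.
Proof.
move=> dFG; apply: contraR; rewrite -leqNgt => h.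
have GF : (F :&: G)%VS == G by rewrite eqEdim capvSr h.
have sGF : (G <= F)%VS by rewrite -(eqP GF) capvSl.
by rewrite eq_sym eqEdim sGF dFG.
Qed.

Lemma on_two_lines L L' : \dim L = 2%N -> \dim L' = 2%N -> L != L' -> (#|on L :&: on L'| <= 1)%N.
Proof.
move=> dL dL' LL; rewrite -onI; apply: on_dim1.
by have := @dim_cap_lt L L'; rewrite dL dL' LL => /(_ isT isT).
Qed.

Lemma exists_off2 N D L : (D <= N)%VS -> (\dim D < \dim N)%N -> (\dim L < \dim N)%N ->
  exists v, [/\ v \in N, v \notin D & v \notin L].
Proof.
move=> DN dD dL.
have [u uN uD] : exists2 u, u \in N & u \notin D.
  by apply/subvPn; apply: contraL dD => /dimvS; rewrite -leqNgt.
have [w wN wL] : exists2 w, w \in N & w \notin L.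
  by apply/subvPn; apply: contraL dL => /dimvS; rewrite -leqNgt.
have [uL|uL] := boolP (u \in L); last by exists u.
have [wD|wD] := boolP (w \in D); last by exists w.
exists (u + w); split; first exact: rpredD.
  by rewrite rpredDr.
by rewrite rpredDl.
Qed.

End Incidence.

Section PlaneCore.
Variables (K : fieldType) (I : finType) (d : nat) (P lam : I -> 'rV[K]_4).
Hypothesis charK : [pchar K] =i pred0.
Hypothesis Pdist : distinct_pts setT P.
Hypothesis hdep : dep d P lam.
Hypothesis lam0 : forall i, lam i != 0.
Implicit Types (F G L N H : {vspace 'rV[K]_4}).
Local Notation on := (on P).

(** In projective 3-space, what can prevent the use of [core_double] are lines, planes and the
    whole space with too many points. *)
Lemma core_plane k e (Y : {set I}) g i0 : g \is e.-homog -> d = (e + k.+1)%N ->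
  ev g (P i0) != 0 -> i0 \in Y -> (forall i, i \notin Y -> killed P lam g i) ->
  (2 * #|Y| + 1 <= 3 * k.+1 + 2)%N ->
  (forall H, \dim H = 3%N -> P i0 \in H ->
     (2 * #|Y :&: on H| + (lam i0 \in H) <= 2 * k.+1 + 2)%N) ->
  (forall L, \dim L = 2%N -> P i0 \in L ->
     (2 * #|Y :&: on L| + (lam i0 \in L) <= k.+1 + 2)%N) -> False.
Proof.
move=> hg dE g0 i0Y hY h4 h3 h2.
apply: (core_double charK Pdist hdep (X := Y :\ i0) hg dE (lam0 i0) g0).
- by rewrite !inE eqxx.
- by move=> i ii0; rewrite !inE ii0; apply: hY.
move=> F pF F1; have e1 : (#|Y :&: on F| = #|(Y :\ i0) :&: on F|.+1)%N.
  rewrite (cardsD1 i0) !inE i0Y pF add1n; congr _.+1; apply: eq_card => j.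
  by rewrite !inE andbA.
have := dim_le4 F; move: F1; case E: (\dim F) => [|[|[|[|[|//]]]]] // _ _ /=.
- by have := h2 F E pF; rewrite e1; lia.
- by have := h3 F E pF; rewrite e1; lia.
have : (#|Y :&: on F| <= #|Y|)%N by apply: subset_leq_card; apply: subsetIl.
by rewrite e1; case: (_ \in _) => /=; lia.
Qed.

End PlaneCore.

Section Minimal.
Variables (K : fieldType) (I : finType) (d : nat) (P lam : I -> 'rV[K]_4).
Hypothesis charK : [pchar K] =i pred0.
Hypothesis Pdist : distinct_pts setT P.
Hypothesis hdep : dep d P lam.
Hypothesis lam0 : forall i, lam i != 0.
Hypothesis d7 : (7 <= d)%N.
Hypothesis xle : (2 * #|I| <= 3 * d + 3)%N.
Hypothesis xge : (3 * d + 2 <= 2 * #|I|)%N.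
Implicit Types (F G L N H : {vspace 'rV[K]_4}).
Local Notation on := (on P).
Hypothesis Hspan : forall F, (\dim F < 4)%N -> exists i, P i \notin F.
Hypothesis Hline : forall L, \dim L = 2%N -> (2 * #|on L| <= d.+1)%N.

(** The product of the equations of the two planes vanishes at all points. If [lam i0] were not in
    [M], this product would have a nonzero derivative along it, and [core_single] would apply. *)
Lemma two_planes N M i0 : \dim N = 3%N -> \dim M = 3%N ->
  (forall i, (P i \in N) || (P i \in M)) -> P i0 \in M -> P i0 \notin N -> lam i0 \in M.
Proof.
move=> dN dM cov iM iN; apply: contraT => lM.
have [cn cnN cni] := separate iN; have [cm cmM cml] := separate lM.
have evn v : v \in N -> ev (lf cn) v = 0 by move=> vN; rewrite ev_lf cnN // mxE.
have evm v : v \in M -> ev (lf cm) v = 0 by move=> vM; rewrite ev_lf cmM // mxE.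
case: (@core_single K _ I d P lam Pdist hdep (d - 2) 2 (lf cn * lf cm) i0).
- by apply: (@dhomogM _ _ _ 1 _ 1); apply: lf_homog.
- by lia.
- by move=> i; rewrite evM; case/orP: (cov i) => [/evn ->|/evm ->]; rewrite ?mul0r ?mulr0.
- by rewrite dDM (evm _ iM) mul0r addr0 ev_lf dD_lf mulf_neq0.
move=> F pF; have := dim_le4 F; case E: (\dim F) => [|[|[|[|[|//]]]]] // _ /=.
- by have := @on_dim1 K I P Pdist F; rewrite E => /(_ isT); lia.
- by have := @on_dim1 K I P Pdist F; rewrite E => /(_ isT); lia.
- by have := Hline E; lia.
- have [j jF] : exists j, P j \notin F by apply: Hspan; rewrite E.
  have : (#|on F| < #|I|)%N.
    rewrite -cardsT; apply: proper_card; apply/properP; split; first exact: subsetT.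
    by exists j; rewrite ?in_setT // inE.
  by lia.
by have : (#|on F| <= #|I|)%N := max_card _; lia.
Qed.

Section MaxPlane.
Variable N : {vspace 'rV[K]_4}.
Hypothesis dN : \dim N = 3%N.
Hypothesis Nmax : forall H, \dim H = 3%N -> (#|on H| <= #|on N|)%N.
Hypothesis N4 : (4 <= #|on N|)%N.

(** The square of the equation of [N] kills all points of [N], so that only a plane or a line with
    many points off [N] can prevent the use of [core_plane]. *)
Lemma bad_point i0 : P i0 \notin N ->
  (exists H, [/\ \dim H = 3%N, P i0 \in H & (d <= #|on H :\: on N|.+1)%N]) \/
  (exists L, [/\ \dim L = 2%N, P i0 \in L & (d <= 2 * #|on L :\: on N|)%N]).
Proof.
move=> iN; apply: NNPP => /not_or_and [nH nL].
have [c cN ci] := separate iN.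
have k0 : (d - 2 = (d - 3).+1)%N by lia.
have card4 : (#|~: on N| + #|on N| = #|I|)%N by rewrite addnC cardsC.
apply: (core_plane charK Pdist hdep lam0 (k := d - 3) (e := 2) (Y := ~: on N) (g := lf c ^+ 2) (i0 := i0)).
- by apply: (@dhomogMn _ _ _ 1); apply: lf_homog.
- by lia.
- by rewrite evX ev_lf expf_neq0.
- by rewrite !inE.
- move=> i; rewrite !inE negbK => iN'.
  have e0 : ev (lf c) (P i) = 0 by rewrite ev_lf cN // mxE.
  by split; rewrite ?evX ?dDXn e0 ?expr0n ?expr1 ?(mulr0, mul0r).
- by lia.
- move=> H dH iH; rewrite setIC -setDE.
  have : ~ (d <= #|on H :\: on N|.+1)%N by move=> h; apply: nH; exists H.
  by case: (_ \in _) => /=; lia.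
move=> L dL iL; rewrite setIC -setDE.
have : ~ (d <= 2 * #|on L :\: on N|)%N by move=> h; apply: nL; exists L.
by case: (_ \in _) => /=; lia.
Qed.

(** Counting leaves only the case [d = 7] of twelve points, six on each of the planes [N] and [H].
    Then [two_planes] shows that the equation of [H] kills all points of [H]. The points of [N]
    remain, and [core_plane] applies to one that is on no line with four points of [N]. *)
Lemma no_big_residual H : \dim H = 3%N -> ~ (d <= #|on H :\: on N|.+1)%N.
Proof.
move=> dH hH.
have hD : (#|on H :\: on N| + #|on N| <= #|I|)%N.
  rewrite -[X in (X <= _)%N]cardsUI (_ : _ :&: _ = set0) ?cards0 ?addn0.
    exact: max_card.
  by apply/setP => i; rewrite !inE; case: (P i \in N); rewrite ?andbF.
have hHN := Nmax dH.
have hle : (#|on H :\: on N| <= #|on H|)%N by apply: subset_leq_card; apply: subsetDl.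
have hsum : (#|on H :&: on N| + #|on H :\: on N| = #|on H|)%N by rewrite cardsID.
have dd : d = 7 by lia.
have x12 : (#|I| = 12)%N by lia.
have n6 : (#|on N| = 6)%N by lia.
have disj : on H :&: on N = set0 by apply/eqP; rewrite -cards_eq0; lia.
have cov i : (P i \in N) || (P i \in H).
  have : on H :|: on N == setT.
    by rewrite eqEcard subsetT cardsU disj cards0 cardsT x12; lia.
  by move/eqP/setP/(_ i); rewrite !inE orbC.
have lamH i : P i \in H -> lam i \in H.
  move=> iH; apply: (two_planes dN dH cov iH); apply/negP => iN.
  by have /setP/(_ i) := disj; rewrite !inE iH iN.
(* two lines with four points each would need seven points on [N] *)
have [i0 i0N h3] : exists2 i0, i0 \in on N &
    forall L, \dim L = 2%N -> P i0 \in L -> (#|on N :&: on L| <= 3)%N.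
  apply: NNPP => nex.
  have all4 i : i \in on N -> exists L, [/\ \dim L = 2%N, P i \in L & (4 <= #|on N :&: on L|)%N].
    move=> iN; apply: NNPP => nL; apply: nex; exists i => // L dL iL.
    by rewrite leqNgt; apply/negP => h; apply: nL; exists L.
  have [i iN] : exists i, i \in on N by apply/set0Pn; rewrite -cards_eq0 n6.
  have [L [dL iL L4]] := all4 i iN.
  have lt6 : (#|on N :&: on L| < #|on N|)%N.
    have := Hline dL; have : (#|on N :&: on L| <= #|on L|)%N.
      by apply: subset_leq_card; apply: subsetIr.
    by lia.
  have [j jN jL] : exists2 j, j \in on N & j \notin on L.
    apply/subsetPn; apply: contraL lt6 => /setIidPl ->; by rewrite ltnn.
  have [L' [dL' jL' L4']] := all4 j jN.
  have LL : L != L' by apply: contraNneq jL => ->; rewrite inE.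
  have h1 := on_two_lines Pdist dL dL' LL.
  have : (#|(on N :&: on L) :|: (on N :&: on L')| <= #|on N|)%N.
    by apply: subset_leq_card; rewrite subUset !subsetIl.
  rewrite cardsU; have : (#|(on N :&: on L) :&: (on N :&: on L')| <= #|on L :&: on L'|)%N.
    by apply: subset_leq_card; apply: setISS; apply: subsetIr.
  by lia.
have i0N' : P i0 \in N by rewrite inE in i0N.
have i0H : P i0 \notin H.
  by apply/negP => iH; have /setP/(_ i0) := disj; rewrite !inE iH i0N'.
have [c cH ci] := separate i0H.
apply: (core_plane charK Pdist hdep lam0 (k := d - 2) (e := 1) (Y := on N) (g := lf c) (i0 := i0)).
- exact: lf_homog.
- by lia.
- by rewrite ev_lf.
- by [].
- move=> i; rewrite inE => iN.
  have iH : P i \in H by have := cov i; rewrite (negPf iN).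
  by split; rewrite ?ev_lf ?dD_lf cH ?mxE //; apply: lamH.
- by lia.
- move=> H' _ _; have : (#|on N :&: on H'| <= #|on N|)%N.
    by apply: subset_leq_card; apply: subsetIl.
  by case: (_ \in _) => /=; lia.
move=> L dL iL; have := h3 L dL iL.
by case: (_ \in _) => /=; lia.
Qed.

Lemma bad_line i0 : P i0 \notin N ->
  exists L, [/\ \dim L = 2%N, P i0 \in L, (d <= 2 * #|on L|)%N & on L :&: on N = set0].
Proof.
move=> /bad_point [[H [dH _ hH]]|[L [dL iL hL]]]; first by case: (no_big_residual dH).
have := Hline dL; have hs := cardsID (on N) (on L) => h2.
exists L; split => //; first by lia.
by apply/eqP; rewrite -cards_eq0; lia.
Qed.

End MaxPlane.

(** The line [L] comes from [bad_line]. Let a point [P j] be on neither [N] nor [L], and let [L1]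
    be the line that [bad_line] gives for it. If [L] and [L1] meet, their plane contradicts
    [no_big_residual]. If not, [N] has at most one point more than [L], so that the plane [N1] of
    [L] and [P j] has as many points as [N]. Another point of [L1] is not on [N1], and [bad_line]
    for [N1] gives a line [L2] through it; the plane of [L1] and [L2] has more points than [N]. *)
Lemma residual_line N : \dim N = 3%N -> (forall H, \dim H = 3%N -> (#|on H| <= #|on N|)%N) ->
  (4 <= #|on N|)%N ->
  exists L, [/\ \dim L = 2%N, (d <= 2 * #|on L|)%N, on L :&: on N = set0 &
    forall i, (P i \in N) || (P i \in L)].
Proof.
move=> dN Nmax N4.
have [i0 i0N] : exists i, P i \notin N by apply: Hspan; rewrite dN.
have [L [dL i0L hL LN]] := bad_line dN Nmax N4 i0N.
have [cov|/not_all_ex_not [j /negP]] := classic (forall i, (P i \in N) || (P i \in L)).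
  by exists L.
rewrite negb_or => /andP[jN jL]; exfalso.
have [L1 [dL1 jL1 hL1 L1N]] := bad_line dN Nmax N4 jN.
have LL1 : L != L1 by apply: contraNneq jL => ->.
have hcap := on_two_lines Pdist dL dL1 LL1.
have plane_of (X Y : {vspace 'rV[K]_4}) : \dim X = 2%N -> \dim Y = 2%N -> X != Y -> (0 < \dim (X :&: Y))%N -> \dim (X + Y) = 3%N.
  move=> dX dY XY h; have := dimv_sum_cap X Y; have := @dim_cap_lt K X Y.
  by rewrite dX dY XY => /(_ isT isT); lia.
have on2 X Y : (#|on X| + #|on Y| <= #|on (X + Y)%VS| + #|on X :&: on Y|)%N.
  rewrite -cardsUI leq_add2r; apply: subset_leq_card.
  by rewrite subUset !onS ?addvSl ?addvSr.
have [cap0|] := posnP (\dim (L :&: L1)); last first.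
  move=> /(plane_of _ _ dL dL1 LL1) dH.
  apply: (no_big_residual dN Nmax N4 dH).
  have : (#|on L :|: on L1| <= #|on (L + L1)%VS :\: on N|)%N.
    apply: subset_leq_card; rewrite subsetD subUset !onS ?addvSl ?addvSr //=.
    rewrite disjoint_sym disjoints_subset; apply/subsetP => i iN.
    rewrite !inE negb_or; apply/andP; split; apply/negP => iL.
      by have /setP/(_ i) := LN; rewrite !inE iL; rewrite inE in iN; rewrite iN.
    by have /setP/(_ i) := L1N; rewrite !inE iL; rewrite inE in iN; rewrite iN.
  by rewrite cardsU; lia.
have onLL1 : on L :&: on L1 = set0.
  rewrite -onI; apply/setP => i; rewrite !inE; apply/negP.
  move/eqP: cap0; rewrite dimv_eq0 => /eqP ->; rewrite memv0.
  by apply/negP; apply: Pdist.1; rewrite in_setT.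
have hx : (#|on L| + #|on L1| + #|on N| <= #|I|)%N.
  rewrite -[(#|on L| + _)%N]cardsUI onLL1 cards0 addn0 -cardsUI.
  rewrite setIUl LN L1N setU0 cards0 addn0; exact: max_card.
pose N1 := (L + <[P j]>)%VS.
have dN1 : \dim N1 = 3%N by rewrite /N1 dim_add_pt // dL.
have jN1 : j \in on N1 by rewrite inE; apply: (subvP (addvSr _ _)) (memv_line _).
have cN1 : (#|on L| < #|on N1|)%N.
  apply: proper_card; apply/properP; split; first exact: onS (addvSl _ _).
  by exists j; rewrite // inE.
have hN : (#|on N| <= #|on N1|)%N by lia.
(* [N1] may replace [N], so [bad_line] is available for it *)
have N1max H : \dim H = 3%N -> (#|on H| <= #|on N1|)%N.
  by move=> dH; apply: leq_trans (Nmax H dH) hN.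
have [i2 i2L1 i2j] : exists2 i, i \in on L1 & i != j.
  have : (1 < #|on L1|)%N by lia.
  case/card_gt1P => a [b [aL bL ab]].
  by have [aj|aj] := eqVneq a j; [exists b; rewrite // -aj eq_sym | exists a].
have L1E : (<[P j]> + <[P i2]>)%VS = L1.
  apply/eqP; rewrite eqEdim subv_add -!memvE jL1; rewrite inE in i2L1.
  rewrite i2L1 dL1 dim_add_pt ?dim_vline ?(Pdist.1 j) ?in_setT //.
  exact: (Pdist.2 i2 j (in_setT _) (in_setT _) i2j).
have i2N1 : P i2 \notin N1.
  apply/negP => h; have : (L + L1 <= N1)%VS.
    by rewrite subv_add addvSl -L1E subv_add -!memvE h; rewrite inE in jN1; rewrite jN1.
  by move/dimvS; have := dimv_sum_cap L L1; rewrite dN1 cap0 dL dL1; clear; lia.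
have N14 : (4 <= #|on N1|)%N := leq_trans N4 hN.
have [L2 [dL2 i2L2 hL2 L2N1]] := bad_line dN1 N1max N14 i2N1.
have L12 : L1 != L2.
  apply: contraTneq jL1 => ->; apply/negP => jL2.
  by have /setP/(_ j) := L2N1; rewrite inE jN1 !inE jL2.
have capp : (0 < \dim (L1 :&: L2))%N.
  rewrite lt0n dimv_eq0; apply/eqP => e0; have : P i2 \in (L1 :&: L2)%VS.
    by rewrite memv_cap i2L2; rewrite inE in i2L1; rewrite i2L1.
  by rewrite e0 memv0; apply/negP; apply: Pdist.1; rewrite in_setT.
have := Nmax _ (plane_of _ _ dL1 dL2 L12 capp).
have := on2 L1 L2; have := on_two_lines Pdist dL1 dL2 L12.
by move: hx hL hL1 hL2 xle d7; clear; lia.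
Qed.

End Minimal.

(** * A plane and a line: collinear points of the plane *)

Section PlaneAndLine.
Variables (K : fieldType) (I : finType) (d : nat) (P lam : I -> 'rV[K]_4).
Hypothesis charK : [pchar K] =i pred0.
Hypothesis Pdist : distinct_pts setT P.
Hypothesis hdep : dep d P lam.
Hypothesis lam0 : forall i, lam i != 0.
Hypothesis d7 : (7 <= d)%N.
Hypothesis xle : (2 * #|I| <= 3 * d + 3)%N.
Hypothesis xge : (3 * d + 2 <= 2 * #|I|)%N.
Implicit Types (F G H : {vspace 'rV[K]_4}).
Local Notation on := (on P).
Hypothesis Hline : forall L, \dim L = 2%N -> (2 * #|on L| <= d.+1)%N.
Hypothesis Hconic : forall N (g : {mpoly K[4]}), \dim N = 3%N -> g \is 2.-homog ->
  (exists2 v, v \in N & ev g v != 0) -> (forall i, P i \in N -> ev g (P i) = 0) ->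
  (#|on N| <= d)%N.
Variables (N L : {vspace 'rV[K]_4}).
Hypotheses (dN : \dim N = 3%N) (dL : \dim L = 2%N) (hL : (d <= 2 * #|on L|)%N).
Hypothesis LN : on L :&: on N = set0.
Hypothesis cov : forall i, (P i \in N) || (P i \in L).

Lemma card_split : (#|on L| + #|on N| = #|I|)%N.
Proof.
rewrite -cardsUI LN cards0 addn0 -cardsT; apply: eq_card => i.
by rewrite !inE orbC cov.
Qed.

Lemma card_N : #|on N| = d.+1.
Proof. by have := card_split; have := Hline dL; move: hL xle xge d7; clear; lia. Qed.

Lemma off_L i : P i \in N -> P i \notin L.
Proof. by move=> iN; apply/negP => iL; have /setP/(_ i) := LN; rewrite !inE iN iL. Qed.

Lemma off_N i : P i \in L -> P i \notin N.
Proof. by move=> iL; apply/negP => /off_L; rewrite iL. Qed.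

Lemma pt_L : exists b, P b \in L.
Proof.
have : (0 < #|on L|)%N by move: hL d7; clear; lia.
by case/card_gt0P => b; rewrite inE; exists b.
Qed.

Lemma dim_LN : \dim (L :&: N) = 1%N.
Proof.
have [b bL] := pt_L; have bN := off_N bL.
have : (\dim N < \dim (L + N))%N.
  apply: leq_trans (dim_add_notin bN) _; apply: dimvS.
  by rewrite subv_add addvSr (subv_trans _ (addvSl L N)) // -memvE.
have := dim_le4 (L + N)%VS; have := dimv_sum_cap L N; rewrite dL dN.
by move: (\dim _) (\dim _); clear; lia.
Qed.

Lemma plane_trace H i : \dim H = 3%N -> P i \in H -> P i \in N -> H != N ->
  \dim (H :&: N) = 2%N.
Proof.
move=> dH iH iN HN; have := dim_le4 (H + N)%VS; have := dimv_sum_cap H N.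
by have := @dim_cap_lt K H N; rewrite dH dN HN => /(_ isT isT); clear; lia.
Qed.

Lemma trace_L_le1 F : ~~ (L <= F)%VS -> (#|on F :&: on L| <= 1)%N.
Proof.
move=> LF; rewrite -onI; apply: (on_dim1 Pdist).
have : (\dim (F :&: L) <= 2)%N by rewrite (leq_trans (dimvS (capvSr F L))) ?dL.
rewrite leq_eqVlt => /orP[/eqP e|//]; case/negP: LF.
have /eqP <- : (F :&: L)%VS == L by rewrite eqEdim capvSr e dL.
exact: capvSl.
Qed.

(** The two lines form a conic, and it contains [d + 1] points. *)
Lemma no_two_lines D D' : (D <= N)%VS -> (D' <= N)%VS -> \dim D = 2%N -> \dim D' = 2%N ->
  ~ (forall i, P i \in N -> (P i \in D) || (P i \in D')).
Proof.
move=> DN DN' dD dD' h.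
have [|| v [vN vD vD']] := @exists_off2 K N D D' DN; rewrite ?dN ?dD ?dD' //.
have [c cD cv] := separate vD; have [c' cD' cv'] := separate vD'.
have := @Hconic N (lf c * lf c') dN; rewrite card_N ltnn => hh; suff : false by [].
apply: hh.
- by apply: (@dhomogM _ _ _ 1 _ 1); apply: lf_homog.
- by exists v => //; rewrite evM !ev_lf mulf_neq0.
by move=> i /h /orP[/cD|/cD'] e; rewrite evM !ev_lf e [(0 : 'M_(_, _)) _ _]mxE ?mul0r ?mulr0.
Qed.

(** Let [D] be a line of [N] with the largest number of points. The square of the equation of the
    plane [Dh] through [D] and a point of [L] kills the points of [D] and that point. By
    [core_plane], each point of [N] off [D] is then on a line of [N] with many points off [D],
    where fewer points suffice if this line meets [L]. As the points are not on two lines, there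
    are two such lines [L1] and [L2]. By counting they share a point of the set and neither has so
    many points off [D] that it could miss [L]. Both pass through the point [L :&: N], so this is
    the shared point, but no point of the set is on both [L] and [N]. *)
Lemma no_trisecant D : (D <= N)%VS -> \dim D = 2%N -> (3 <= #|on D|)%N -> False.
Proof.
move=> DN0 dD0 hD0.
have [D' [DN dD hD Dmax]] : exists D, [/\ (D <= N)%VS, \dim D = 2%N, (3 <= #|on D|)%N &
    forall D', (D' <= N)%VS -> \dim D' = 2%N -> (#|on D'| <= #|on D|)%N].
  have [m] := ubnP (#|on N| - #|on D|); elim: m D DN0 dD0 hD0 => // m IHm D DN dD hD hm.
  have [?|] := classic (forall D', (D' <= N)%VS -> \dim D' = 2%N -> (#|on D'| <= #|on D|)%N).
    by exists D.
  case/not_all_ex_not => D' hD'; have [DN' {}hD'] := imply_to_and _ _ hD'.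
  have [dD' {}hD'] := imply_to_and _ _ hD'; move/negP: hD'; rewrite -ltnNge => hD'.
  apply: (IHm D') => //; first by move: hD hD'; clear; lia.
  have := subset_leq_card (onS P DN'); have := subset_leq_card (onS P DN).
  by move: hD' hm; clear; lia.
move: {DN0 dD0 hD0}D' DN dD hD Dmax => {}D DN dD hD Dmax.
have [b bL] := pt_L; have bN := off_N bL.
have bD : P b \notin D by apply: contra bN; apply/subvP.
pose Dh := (D + <[P b]>)%VS; have dDh : \dim Dh = 3%N by rewrite dim_add_pt ?dD.
have bDh : P b \in Dh by apply: (subvP (addvSr _ _)) (memv_line _).
have DhN : (Dh :&: N)%VS = D.
  apply/eqP; rewrite eq_sym eqEdim subv_cap addvSl DN /= dD.
  have := @dim_cap_lt K Dh N; rewrite dDh dN => /(_ isT) h; rewrite -ltnS; apply: h.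
  by apply: contraNneq bN => <-.
have DhD i : P i \in N -> P i \in Dh -> P i \in D.
  by move=> iN iD; rewrite -DhN memv_cap iD.
have card_out : (#|~: on Dh| + #|on D| + 1 <= #|I|)%N.
  have : (#|b |: on D| <= #|on Dh|)%N.
    apply: subset_leq_card; rewrite subUset sub1set inE bDh.
    exact: onS (addvSl _ _).
  rewrite cardsU1 inE bD /= add1n -(cardsC (on Dh)).
  by move: (#|_|) (#|_|) (#|_|) => u v w; lia.
have cN := card_N; have bLine := Hline dL.
have card_ND : (#|on N :\: on D| + #|on D| = d.+1)%N.
  by rewrite -cN -(cardsID (on D) (on N)) addnC (setIidPr (onS P DN)).
pose bad i := exists L', [/\ (L' <= N)%VS, \dim L' = 2%N, P i \in L' &
  (d <= 2 * #|on L' :\: on D|)%N \/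
  ((2 * d <= 2 * #|on L' :\: on D| + 2 * #|on L|)%N /\ (0 < \dim (L' :&: L))%N)].
have all_bad i0 : P i0 \in N -> P i0 \notin D -> bad i0.
  move=> iN iD; apply: NNPP => nbad.
  have iDh : P i0 \notin Dh by apply: contra iD; apply: DhD.
  have [c cD ci] := separate iDh.
  have small L' : (L' <= N)%VS -> \dim L' = 2%N -> P i0 \in L' ->
      (2 * #|on L' :\: on D| < d)%N /\
      ((0 < \dim (L' :&: L))%N -> (2 * #|on L' :\: on D| + 2 * #|on L| < 2 * d)%N).
    move=> LN' dL' iL'; split=> [|h0]; rewrite ltnNge; apply/negP => h; apply: nbad;
      exists L'; split=> //; [by left | by right].
  have outN F : ((~: on Dh) :&: on F) :&: on N \subset on (F :&: N)%VS :\: on D.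
    apply/subsetP => i; rewrite !inE memv_cap => /andP[/andP[iDh' ->] ->]; rewrite andbT /= andbT.
    by apply: contra iDh'; apply/subvP; apply: addvSl.
  have split_out F : (#|(~: on Dh) :&: on F| <= #|on (F :&: N)%VS :\: on D|
      + #|((~: on Dh) :&: on F) :&: on L|)%N.
    apply: leq_trans (_ : #|(((~: on Dh) :&: on F) :&: on N) :|: (((~: on Dh) :&: on F) :&: on L)| <= _)%N.
      apply: subset_leq_card; rewrite -setIUr; apply/subsetP => i hi; rewrite inE hi.
      by rewrite !inE cov.
    rewrite cardsU; apply: leq_trans (leq_subr _ _) _; rewrite leq_add2r.
    exact: subset_leq_card (outN F).
  have outL F : (#|((~: on Dh) :&: on F) :&: on L| <= #|on F :&: on L|)%N.
    by apply: subset_leq_card; rewrite setSI // subsetIr.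
  have outL' F : (#|((~: on Dh) :&: on F) :&: on L| < #|on L|)%N.
    apply: proper_card; apply/properP; split; first exact: subsetIr.
    by exists b; rewrite ?inE // bDh.
  apply: (core_plane charK Pdist hdep lam0 (k := d - 3) (e := 2) (Y := ~: on Dh) (g := lf c ^+ 2) (i0 := i0)).
  - by apply: (@dhomogMn _ _ _ 1); apply: lf_homog.
  - by move: d7; clear; lia.
  - by rewrite evX ev_lf expf_neq0.
  - by rewrite !inE.
  - move=> i; rewrite !inE negbK => iDh'.
    have e0 : ev (lf c) (P i) = 0 by rewrite ev_lf cD // mxE.
    by split; rewrite ?evX ?dDXn e0 ?expr0n ?expr1 ?(mulr0, mul0r).
  - by move: d7 xle hD card_out; clear; lia.
  - move=> H dH iH; have h1 := split_out H; have h2 := outL H; have h3 := outL' H.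
    have l1 : ((lam i0 \in H) <= 1)%N by case: (_ \in _).
    have [HN|HN] := eqVneq H N.
      have e0 : #|((~: on Dh) :&: on N) :&: on L| = 0%N.
        by apply/eqP; rewrite cards_eq0 -setIA (setIC (on N)) LN setI0.
      rewrite HN in h1 l1 *; rewrite e0 capvv in h1.
      by move: h1 l1 card_ND hD d7; clear; lia.
    have dHN := plane_trace dH iH iN HN.
    have iHN : P i0 \in (H :&: N)%VS by rewrite memv_cap iH.
    have [s1 s2] := small _ (capvSr H N) dHN iHN.
    have [LH|/trace_L_le1 t1] := boolP (L <= H)%VS; last first.
      by move: t1 h1 h2 l1 s1 d7; clear; lia.
    have : (0 < \dim ((H :&: N) :&: L))%N.
      by rewrite (capvC H N) -capvA (capv_idPr LH) capvC dim_LN.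
    by move/s2; move: h1 h3 l1 d7; clear; lia.
  move=> F dF iF; have h1 := split_out F; have h2 := outL F.
  have l1 : ((lam i0 \in F) <= 1)%N by case: (_ \in _).
  have [FN|FN] := boolP (F <= N)%VS.
    have [s1 _] := small _ FN dF iF.
    have e0 : on F :&: on L = set0.
      apply/setP => i; rewrite !inE; apply/negP => /andP[iF' iL].
      by case/negP: (off_N iL); apply: (subvP FN).
    rewrite e0 cards0 in h2; rewrite (capv_idPl FN) in h1.
    by move: h1 h2 l1 s1 d7; clear; lia.
  have LF : ~~ (L <= F)%VS.
    apply/negP => LF; have /eqP e : L == F by rewrite eqEdim LF dL dF.
    by have := off_L iN; rewrite e iF.
  have t1 := trace_L_le1 LF.
  have t2 : (#|on (F :&: N)%VS :\: on D| <= 1)%N.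
    apply: leq_trans (subset_leq_card (subsetDl _ _)) _; apply: (on_dim1 Pdist).
    have : (\dim (F :&: N) <= 2)%N by rewrite (leq_trans (dimvS (capvSl F N))) ?dF.
    rewrite leq_eqVlt => /orP[/eqP e|//]; case/negP: FN.
    have /eqP <- : (F :&: N)%VS == F by rewrite eqEdim capvSl e dF.
    exact: capvSr.
  by move: h1 h2 l1 t1 t2 d7; clear; lia.
have bad_big i L' : (L' <= N)%VS -> \dim L' = 2%N -> P i \in L' ->
  (d <= 2 * #|on L' :\: on D|)%N \/
  ((2 * d <= 2 * #|on L' :\: on D| + 2 * #|on L|)%N /\ (0 < \dim (L' :&: L))%N) ->
  (d <= 2 * #|on L' :\: on D| + 1)%N.
  by move=> _ _ _ [|[]]; move: bLine; clear; lia.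
have Dlt : (#|on D| < d.+1)%N by have := Hline dD; move: d7; clear; lia.
have [i0 i0N i0D] : exists2 i, P i \in N & P i \notin D.
  have : (0 < #|on N :\: on D|)%N by move: card_ND Dlt; clear; lia.
  by case/card_gt0P => i; rewrite !inE => /andP[]; exists i.
have [L1 [L1N dL1 i0L1 b1]] := all_bad i0 i0N i0D.
have B1 := bad_big _ _ L1N dL1 i0L1 b1.
have [j [jN jD jL1]] : exists j, [/\ P j \in N, P j \notin D & P j \notin L1].
  apply: NNPP => nj; apply: (no_two_lines DN L1N dD dL1) => i iN.
  apply: contraT; rewrite negb_or => /andP[iD iL]; case: nj; by exists i.
have [L2 [L2N dL2 jL2 b2]] := all_bad j jN jD.
have B2 := bad_big _ _ L2N dL2 jL2 b2.
have L12 : L1 != L2 by apply: contraNneq jL1 => ->.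
have c12 := on_two_lines Pdist dL1 dL2 L12.
have hU : (#|on L1 :\: on D| + #|on L2 :\: on D| <=
    #|on N :\: on D| + #|(on L1 :&: on L2) :\: on D|)%N.
  rewrite -cardsUI -setDIl leq_add2r -setDUl; apply: subset_leq_card.
  by apply: setSD; rewrite subUset !onS.
have m1 : (#|on L1 :\: on D| <= #|on D|)%N.
  by apply: leq_trans (Dmax _ L1N dL1); apply: subset_leq_card; apply: subsetDl.
have m2 : (#|on L2 :\: on D| <= #|on D|)%N.
  by apply: leq_trans (Dmax _ L2N dL2); apply: subset_leq_card; apply: subsetDl.
have t12 : (#|(on L1 :&: on L2) :\: on D| <= #|on L1 :&: on L2|)%N.
  by apply: subset_leq_card; apply: subsetDl.
(* the three groups of points on [D], [L1] and [L2] would be too many if disjoint *)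
have [k kL] : exists k, k \in on L1 :&: on L2.
  apply/card_gt0P; move: hU m1 m2 t12 card_ND B1 B2 d7; clear; lia.
have n1 : (2 * #|on L1 :\: on D| < d)%N.
  by move: hU m1 m2 t12 c12 card_ND B1 B2 d7; clear; lia.
have n2 : (2 * #|on L2 :\: on D| < d)%N.
  by move: hU m1 m2 t12 c12 card_ND B1 B2 d7; clear; lia.
have meet X : (X <= N)%VS -> (0 < \dim (X :&: L))%N -> (L :&: N <= X)%VS.
  move=> XN h; have /eqP <- : (X :&: L)%VS == (L :&: N)%VS.
    by rewrite eqEdim dim_LN h andbT subv_cap capvSr (subv_trans (capvSl _ _) XN).
  exact: capvSl.
have O1 : (L :&: N <= L1)%VS.
  by case: b1 => [|[_ h]]; [rewrite leqNgt n1 | apply: meet].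
have O2 : (L :&: N <= L2)%VS.
  by case: b2 => [|[_ h]]; [rewrite leqNgt n2 | apply: meet].
move: kL; rewrite !inE => /andP[kL1 kL2].
have kN : P k \in N := subvP L1N _ kL1.
case/negP: (off_L kN); apply: (subvP (capvSl L N)).
have d12 : (\dim (L1 :&: L2) <= 1)%N.
  by have := @dim_cap_lt K L1 L2; rewrite dL1 dL2 L12 => /(_ isT isT).
have /eqP -> : (L :&: N)%VS == (L1 :&: L2)%VS by rewrite eqEdim subv_cap O1 O2 dim_LN d12.
by rewrite memv_cap kL1.
Qed.

End PlaneAndLine.

(** * Conics in a plane *)

Section FreeSubfamily.
Variables (K : fieldType) (V : vectType K) (I : finType) (e : I -> V).

Definition span_set (T : {set I}) : {vspace V} := (\sum_(i in T) <[e i]>)%VS.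

Lemma mem_span_set (T : {set I}) i : i \in T -> e i \in span_set T.
Proof.
move=> iT; apply: (subvP _ _ (memv_line (e i))).
by rewrite /span_set (bigD1 i) //= addvSl.
Qed.

Lemma dim_span_set (T : {set I}) : (\dim (span_set T) <= #|T|)%N.
Proof.
apply: leq_trans (dimv_leq_sum _ _ _) _; rewrite -sum1_card; apply: leq_sum => i _.
by rewrite dim_vline; case: (_ != 0).
Qed.

Lemma free_extension (T0 A : {set I}) : T0 \subset A -> \dim (span_set T0) = #|T0| ->
  exists T : {set I}, [/\ T0 \subset T, T \subset A, \dim (span_set T) = #|T| &
    forall i, i \in A -> e i \in span_set T].
Proof.
move=> T0A dT0; pose p (T : {set I}) := [&& T0 \subset T, T \subset A & \dim (span_set T) == #|T|].
have [T /maxsetP [/and3P [T0T TA /eqP dT] Tmax] _] := @maxset_exists _ p T0 (introT and3P (And3 (subxx _) T0A (introT eqP dT0))).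
exists T; split=> // i iA; apply: contraT => iT.
have iT' : i \notin T by apply: contra iT; apply: mem_span_set.
suff /Tmax/(_ (subsetU1 _ _))/setP/(_ i) : p (i |: T) by rewrite !inE eqxx (negPf iT').
apply/and3P; split; first exact: subset_trans T0T (subsetU1 _ _).
  by rewrite subUset sub1set iA.
rewrite eqn_leq dim_span_set /= cardsU1 iT' add1n -dT.
have -> : span_set (i |: T) = (span_set T + <[e i]>)%VS.
  by rewrite /span_set big_setU1 //= addvC.
exact: dim_add_notin.
Qed.

End FreeSubfamily.

Section PlaneQuadrics.
Variable (K : fieldType).

Notation o3 k := (@Ordinal 3 k isT).

Definition mon (k : 'I_6) : {mpoly K[3]} :=
  nth 0 [:: 'X_(o3 0) * 'X_(o3 0); 'X_(o3 1) * 'X_(o3 1); 'X_(o3 2) * 'X_(o3 2);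
    'X_(o3 0) * 'X_(o3 1); 'X_(o3 0) * 'X_(o3 2); 'X_(o3 1) * 'X_(o3 2)] k.

(** The Veronese map of the plane. *)
Definition mons (y : 'rV[K]_3) : 'rV[K]_6 := \row_k ev (mon k) y.

Definition qform (c : 'cV[K]_6) : {mpoly K[3]} := \sum_k c k 0 *: mon k.

Lemma ev_qform c y : ev (qform c) y = (mons y *m c) 0 0.
Proof.
by rewrite /qform ev_sum mxE; apply: eq_bigr => k _; rewrite evZ mxE mulrC.
Qed.

Lemma qform_homog c : qform c \is 2.-homog.
Proof.
have h i j : 'X_i * 'X_j \is [in K[3], 2.-homog].
  by apply: (@dhomogM _ _ _ 1 _ 1); rewrite dhomogX /= mdeg1.
apply: rpred_sum => k _; apply: dhomogZ; rewrite /mon.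
by case: k => -[|[|[|[|[|[|//]]]]]] /= _; apply: h.
Qed.

Lemma monsE (y : 'rV[K]_3) (c : 'cV[K]_6) (x := y 0 (o3 0)) (z := y 0 (o3 1)) (t := y 0 (o3 2)) :
  (mons y *m c) 0 0 = x * x * c (@Ordinal 6 0 isT) 0 + z * z * c (@Ordinal 6 1 isT) 0
    + t * t * c (@Ordinal 6 2 isT) 0 + x * z * c (@Ordinal 6 3 isT) 0
    + x * t * c (@Ordinal 6 4 isT) 0 + z * t * c (@Ordinal 6 5 isT) 0.
Proof.
rewrite mxE !big_ord_recl big_ord0 !mxE /mon /= !evM !evXU -/x -/z -/t addr0 !addrA.
by do !congr (_ + _); congr (_ * c _ _); apply/val_inj.
Qed.

(** The values at the basis vectors and at their pairwise sums determine the coefficients. *)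
Lemma qform_neq0 c : c != 0 -> exists y, ev (qform c) y != 0.
Proof.
move=> c0; apply: NNPP => nex; case/eqP: c0.
pose v (a b e : K) : 'rV[K]_3 := \row_j nth 0 [:: a; b; e] j.
have h a b e : (mons (v a b e) *m c) 0 0 = 0.
  by apply/eqP; apply: contraT => h; case: nex; exists (v a b e); rewrite ev_qform.
have := (h 1 0 0, h 0 1 0, h 0 0 1, (h 1 1 0, h 1 0 1, h 0 1 1)).
rewrite !monsE !mxE /= !(mulr0, mul0r, mulr1, mul1r, addr0, add0r).
case=> -[[-> ->] ->] [[]]; rewrite !add0r => c3 c4 c5.
have := (h 1 0 0, h 0 1 0, h 0 0 1).
rewrite !monsE !mxE /= !(mulr0, mul0r, mulr1, mul1r, addr0, add0r).
case=> -[c0 c1] c2.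
apply/colP => -[[|[|[|[|[|[|//]]]]]] i]; rewrite mxE.
- by rewrite -[RHS]c0; congr (c _ _); apply/val_inj.
- by rewrite -[RHS]c1; congr (c _ _); apply/val_inj.
- by rewrite -[RHS]c2; congr (c _ _); apply/val_inj.
- by rewrite -[RHS]c3; congr (c _ _); apply/val_inj.
- by rewrite -[RHS]c4; congr (c _ _); apply/val_inj.
by rewrite -[RHS]c5; congr (c _ _); apply/val_inj.
Qed.

(** The square of a linear form that vanishes at [y'] but not at [y] is linear in [mons]. *)
Lemma mons_distinct (y y' : 'rV[K]_3) : y \notin <[y']>%VS -> mons y \notin <[mons y']>%VS.
Proof.
move=> /separate [c c0 c1].
have cy' : (y' *m c) 0 0 = 0 by rewrite c0 ?memv_line // mxE.
pose a := c (o3 0) 0; pose b := c (o3 1) 0; pose e := c (o3 2) 0.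
pose q : 'cV[K]_6 := \col_k nth 0 [:: a * a; b * b; e * e; 2%:R * a * b; 2%:R * a * e; 2%:R * b * e] k.
have qE z : (mons z *m q) 0 0 = (z *m c) 0 0 ^+ 2.
  rewrite monsE !mxE /= !big_ord_recl big_ord0.
  rewrite (_ : lift ord0 ord0 = o3 1); last exact/val_inj.
  rewrite (_ : lift ord0 (lift ord0 ord0) = o3 2); last exact/val_inj.
  rewrite (_ : ord0 = o3 0); last exact/val_inj.
  by rewrite -/a -/b -/e; ring.
apply/negP => /vlineP [t yE]; case/eqP: c1.
have := qE y; rewrite yE -scalemxAl mxE qE cy' expr0n mulr0 => /esym/eqP.
by rewrite expf_eq0 => /eqP.
Qed.

End PlaneQuadrics.

Section PlaneCoordinates.
Variable (K : fieldType).

Lemma subspace_coords n k (N : {vspace 'rV[K]_n}) : \dim N = k ->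
  exists (B : 'M[K]_(k, n)) (R : 'M[K]_(n, k)), [/\ B *m R = 1%:M,
    (forall y : 'rV[K]_k, y *m B \in N) & forall v, v \in N -> v *m R *m B = v].
Proof.
move=> dN; have [b hb] : exists b : k.-tuple 'rV[K]_n, basis_of N b.
  by move: (vbasis N) (vbasisP N); rewrite dN => b; exists b.
pose B : 'M[K]_(k, n) := \matrix_i tnth b i.
have BE (y : 'rV[K]_k) : y *m B = \sum_i y 0 i *: b`_i.
  by rewrite mulmx_sum_row; apply: eq_bigr => i _; rewrite rowK -tnth_nth.
have Bfree : row_free B.
  rewrite -kermx_eq0; apply/rowV0P => y /sub_kermxP; rewrite BE => yB.
  apply/rowP => i; rewrite mxE.
  by have /freeP := basis_free hb; apply.
have BR := mulmxVp Bfree.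
exists B, (pinvmx B); split=> // [y|v vN].
  rewrite BE; apply: rpred_sum => i _; apply: rpredZ.
  by apply: (basis_mem hb); apply: mem_nth; rewrite size_tuple.
have -> : v = (\row_i coord b i v) *m B.
  by rewrite BE {1}(coord_basis hb vN); apply: eq_bigr => i _; rewrite mxE.
by rewrite -(mulmxA _ B) BR mulmx1.
Qed.

End PlaneCoordinates.

(** * A plane and a line: the case without collinear points *)

Section PlaneAndLineConic.
Variables (K : fieldType) (I : finType) (d : nat) (P lam : I -> 'rV[K]_4).
Hypothesis charK : [pchar K] =i pred0.
Hypothesis Pdist : distinct_pts setT P.
Hypothesis hdep : dep d P lam.
Hypothesis lam0 : forall i, lam i != 0.
Hypothesis d7 : (7 <= d)%N.
Hypothesis xle : (2 * #|I| <= 3 * d + 3)%N.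
Hypothesis xge : (3 * d + 2 <= 2 * #|I|)%N.
Implicit Types (F G H : {vspace 'rV[K]_4}).
Local Notation on := (on P).
Hypothesis Hline : forall L, \dim L = 2%N -> (2 * #|on L| <= d.+1)%N.
Hypothesis Hconic : forall N (g : {mpoly K[4]}), \dim N = 3%N -> g \is 2.-homog ->
  (exists2 v, v \in N & ev g v != 0) -> (forall i, P i \in N -> ev g (P i) = 0) ->
  (#|on N| <= d)%N.
Variables (N L : {vspace 'rV[K]_4}).
Hypotheses (dN : \dim N = 3%N) (dL : \dim L = 2%N) (hL : (d <= 2 * #|on L|)%N).
Hypothesis LN : on L :&: on N = set0.
Hypothesis cov : forall i, (P i \in N) || (P i \in L).

Let cN : #|on N| = d.+1 := card_N d7 xle xge Hline dL hL LN cov.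

(** Since [d + 1] points of [N] are on no conic, their images under the Veronese map span [K^6].
    The images of [P i0] and [P j0] are completed to a basis by images of four others; the conic is
    the vector of the dual basis that belongs to [P i0]. *)
Lemma conic_through i0 j0 : P i0 \in N -> P j0 \in N -> i0 != j0 ->
  exists (g : {mpoly K[4]}) (Z : {set I}), [/\ g \is 2.-homog, ev g (P i0) != 0,
    Z \subset on N, (5 <= #|Z|)%N & [/\ j0 \in Z, i0 \notin Z &
    forall z, z \in Z -> ev g (P z) = 0]].
Proof.
move=> iN jN ij; have [B [R [BR BN NB]]] := subspace_coords dN.
pose e i := mons (P i *m R).
pose g c : {mpoly K[4]} := qform c \mPo ltup R.
have evg c i : ev (g c) (P i) = (e i *m c) 0 0 by rewrite ev_comp gmap_ltup ev_qform.
have hg c : g c \is 2.-homog.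
  rewrite -[X in X.-homog](muln1 2); apply: comp_homog (qform_homog c) => k.
  by rewrite tnth_mktuple lf_homog.
have spanA : span_set e (on N) = fullv.
  apply/eqP; rewrite eqEsubv subvf /=; apply/subvP => v _; apply: contraT => /separate [c cA cv].
  have c0 : c != 0 by apply: contraNneq cv => ->; rewrite mulmx0 mxE.
  have := @Hconic N (g c) dN (hg c); rewrite cN ltnn => h; case: (notF (h _ _)).
    have [y qy] := qform_neq0 c0; exists (y *m B); first exact: BN.
    by rewrite ev_comp gmap_ltup -mulmxA BR mulmx1.
  by move=> i iN'; rewrite evg cA ?mxE // mem_span_set // inE.
have eij : e j0 \notin <[e i0]>%VS.
  apply: mons_distinct; apply: contraL (Pdist.2 j0 i0 (in_setT _) (in_setT _) _).
    move=> /vlineP [t yE]; rewrite negbK -(NB _ jN) yE -scalemxAl NB //.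
    by rewrite memvZ ?memv_line.
  by rewrite eq_sym.
have ei0 : e i0 != 0.
  have := Pdist.2 i0 j0 (in_setT _) (in_setT _) ij => h.
  apply: contraNneq (_ : e i0 \notin <[e j0]>%VS) => [->|]; first exact: mem0v.
  apply: mons_distinct; apply: contraNN h => /vlineP [t yE].
  by rewrite -(NB _ iN) yE -scalemxAl NB // memvZ ?memv_line.
have [||T [T0T TA dT Tspan]] := @free_extension K _ I e [set i0; j0] (on N).
- by apply/subsetP => k; rewrite !inE => /orP[] /eqP ->.
- rewrite cards2 ij /span_set big_setU1 ?inE //= big_set1.
  by rewrite dim_add_pt // dim_vline ei0.
have T6 : #|T| = 6%N.
  rewrite -dT; have -> : span_set e T = fullv.
    apply/eqP; rewrite eqEsubv subvf -spanA; apply/subv_sumP => i iN'.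
    by rewrite -memvE Tspan.
  by rewrite dimvf dim_matrix.
have iT : i0 \in T by apply: (subsetP T0T); rewrite !inE eqxx.
have jT : j0 \in T by apply: (subsetP T0T); rewrite !inE eqxx orbT.
have cT : #|T :\ i0| = 5%N by have := cardsD1 i0 T; rewrite iT T6; case.
have : e i0 \notin span_set e (T :\ i0).
  apply/negP => h; have : (span_set e T <= span_set e (T :\ i0))%VS.
    rewrite /span_set (bigD1 i0) //= subv_add -memvE h /=; apply/subv_sumP => k /andP[kT ki].
    by rewrite -memvE mem_span_set // !inE ki.
  move/dimvS; rewrite dT T6 => h6; have := leq_trans h6 (dim_span_set e _).
  by rewrite cT.
case/separate => c cZ ci; exists (g c), (T :\ i0); split.
- exact: hg.
- by rewrite evg.
- exact: subset_trans (subsetDl _ _) TA.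
- by rewrite cT.
split; first by rewrite !inE eq_sym ij.
  by rewrite !inE eqxx.
by move=> z zT; rewrite evg cZ ?mxE // mem_span_set.
Qed.

Lemma two_forms (a b : 'rV[K]_4) x y : a \notin <[b]>%VS -> b \notin <[a]>%VS ->
  exists m : 'cV[K]_4, (a *m m) 0 0 = x /\ (b *m m) 0 0 = y.
Proof.
move=> /separate [ca cb0 ca1] /separate [cb ca0 cb1].
exists ((x / (a *m ca) 0 0) *: ca + (y / (b *m cb) 0 0) *: cb).
split; rewrite mulmxDr -!scalemxAr ?(cb0 b) ?(ca0 a) ?memv_line // scaler0 ?addr0 ?add0r [LHS]mxE divfK //.
Qed.

(** A conic through five points of [N] and not through [P i0] is extended to a quadric [q] through
    two points of [L]. The square of [q] kills seven points, and [core_plane] applies with the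
    remaining ones. The delicate planes are those through [L]: they meet [N] in a line through the
    point [L :&: N], and if this line contains [P i0] and one more point of the set, then that
    point has been chosen as one of the five. *)
Lemma no_plane_and_line : False.
Proof.
have bLine := Hline dL.
have tri D : (D <= N)%VS -> \dim D = 2%N -> (#|on D| <= 2)%N.
  move=> DN dD; rewrite leqNgt; apply/negP => h.
  exact: (no_trisecant charK Pdist hdep lam0 d7 xle xge Hline Hconic dN dL hL LN cov DN dD h).
have dO : \dim (L :&: N) = 1%N := dim_LN d7 dN dL hL LN.
have [i0] : exists i, i \in on N by apply/card_gt0P; rewrite cN.
rewrite inE => iN; have iL := off_L LN iN.
pose l0 := ((L :&: N) + <[P i0]>)%VS.
have dl0 : \dim l0 = 2%N.
  by rewrite /l0 dim_add_pt ?dO //; apply: contra iL; apply/subvP/capvSl.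
have l0N : (l0 <= N)%VS by rewrite subv_add capvSr -memvE.
(* [j0] is the second point of the set on the line through [P i0] and the trace of [L]; if there is
   none, any other point of [N] will do *)
have [j0 [jN ij0 partner]] : exists j0, [/\ P j0 \in N, i0 != j0 &
    forall j, P j \in l0 -> j = i0 \/ j = j0].
  have := tri _ l0N dl0; rewrite (cardsD1 i0) inE (subvP (addvSr _ _)) ?memv_line //= add1n ltnS.
  case: (posnP #|on l0 :\ i0|) => [/eqP|].
    rewrite cards_eq0 => /eqP e0 _.
    have [j0 /setD1P [ji jN]] : exists j, j \in on N :\ i0.
      apply/card_gt0P; have := cardsD1 i0 (on N); rewrite inE iN cN.
      by move: d7; case: (#|_|) => //; clear; lia.
    exists j0; split; [by rewrite inE in jN | by rewrite eq_sym |].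
    move=> j jl; left; apply/eqP; apply: contraT => ji0.
    by have /setP/(_ j) := e0; rewrite !inE ji0 jl.
  case/card_gt0P => j0 jl h1; exists j0; have /setD1P [ji] := jl; rewrite inE => jl0.
  split; [exact: subvP l0N _ jl0 | by rewrite eq_sym |] => j jl'.
  have [->|jni] := eqVneq j i0; [by left | right].
  by apply: (card_le1_eqP h1) => //; rewrite !inE jni.
have [g [Z [hg gi ZN Z5 [jZ iZ gZ]]]] := conic_through iN jN ij0.
have [c cv ci] : exists2 c : 'cV[K]_4, forall v, v \in N -> (v *m c) 0 0 = 0 &
    forall i, P i \in L -> (P i *m c) 0 0 != 0.
  have [b0 b0L] := pt_L d7 hL; have [c cN0 cb] := separate (off_N LN b0L).
  exists c => [v vN|i iL']; first by rewrite cN0 ?mxE.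
  apply/eqP => ci0; have : (N + <[P i]> <= N + <[P i]>)%VS by [].
  have full : (N + <[P i]>)%VS = fullv.
    apply/eqP; rewrite eqEdim subvf dim_add_pt ?(off_N LN iL') // dN.
    by rewrite dimvf dim_matrix.
  have : P b0 \in (N + <[P i]>)%VS by rewrite full memvf.
  case/memv_addP => w wN [_ /vlineP [t ->] bE]; case/eqP: cb.
  by rewrite bE mulmxDl -scalemxAl mxE cN0 // [X in _ + X]mxE ci0 mulr0 mxE addr0.
have [b1 [b2 [b1L b2L b12]]] : exists b1 b2, [/\ b1 \in on L, b2 \in on L & b1 != b2].
  by apply/card_gt1P; move: hL d7; clear; lia.
have b1L' : P b1 \in L by rewrite inE in b1L.
have b2L' : P b2 \in L by rewrite inE in b2L.
have n12 := Pdist.2 b1 b2 (in_setT _) (in_setT _) b12.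
have n21 : P b2 \notin <[P b1]>%VS by apply: Pdist.2; rewrite ?in_setT // eq_sym.
have [m [m1 m2]] := two_forms (- ev g (P b1) / (P b1 *m c) 0 0) (- ev g (P b2) / (P b2 *m c) 0 0) n12 n21.
(* the multiple of the equation of [N] adjusts the values on [L] and leaves [g] unchanged on [N] *)
pose q := g + lf c * lf m.
have hq : q \is 2.-homog.
  by rewrite rpredD //; apply: (@dhomogM _ _ _ 1 _ 1); apply: lf_homog.
have qN v : v \in N -> ev q v = ev g v by move=> vN; rewrite evD evM ev_lf cv // mul0r addr0.
pose Y := ~: (Z :|: [set b1; b2]).
have disjZ : Z :&: [set b1; b2] = set0.
  apply/setP => i; rewrite !inE; apply/negP => /andP[/(subsetP ZN)]; rewrite inE => iN' /orP[] /eqP ib.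
    by case/negP: (off_N LN b1L'); rewrite -ib.
  by case/negP: (off_N LN b2L'); rewrite -ib.
have cY : (#|Y| + 7 <= #|I|)%N.
  have := cardsC (Z :|: [set b1; b2]); rewrite cardsU disjZ cards0 cards2 b12 subn0 -/Y.
  by move: Z5; clear; lia.
have YN F : ((Y :&: on F) :&: on N) \subset on (F :&: N)%VS :\: Z.
  apply/subsetP => i; rewrite !inE memv_cap !negb_or.
  by case/andP=> /andP[/and3P[-> _ _] ->] ->.
have YL F : ((Y :&: on F) :&: on L) \subset (on F :&: on L) :\: [set b1; b2].
  apply/subsetP => i; rewrite !inE !negb_or.
  by case/andP=> /andP[/and3P[_ -> ->] ->] ->.
have split_Y F : (#|Y :&: on F| <= #|on (F :&: N)%VS :\: Z| + #|(on F :&: on L) :\: [set b1; b2]|)%N.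
  apply: leq_trans (_ : #|((Y :&: on F) :&: on N) :|: ((Y :&: on F) :&: on L)| <= _)%N.
    apply: subset_leq_card; rewrite -setIUr; apply/subsetP => i hi; rewrite inE hi.
    by rewrite !inE cov.
  rewrite cardsU; apply: leq_trans (leq_subr _ _) _.
  by apply: leq_add; apply: subset_leq_card.
have cardZ : (#|on N :\: Z| + 5 <= d.+1)%N.
  by rewrite -cN -(cardsID Z (on N)) (setIidPr ZN) addnC leq_add2r.
have cardL : (#|on L :\: [set b1; b2]| + 2 = #|on L|)%N.
  rewrite -(cardsID [set b1; b2] (on L)) (setIidPr _) ?cards2 ?b12 1?addnC //.
  by apply/subsetP => i; rewrite !inE => /orP[] /eqP ->.
apply: (core_plane charK Pdist hdep lam0 (k := d - 5) (e := 4) (Y := Y) (g := q ^+ 2) (i0 := i0)).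
- exact: (@dhomogMn _ _ _ 2).
- by move: d7; clear; lia.
- by rewrite evX qN // expf_neq0.
- rewrite !inE !negb_or iZ /=; apply/andP; split; apply/eqP => ib; move: iL; rewrite ib.
    by rewrite b1L'.
  by rewrite b2L'.
- move=> i; rewrite !inE negbK => hi.
  have e0 : ev q (P i) = 0.
    case/or3P: hi => [iZ'|/eqP ->|/eqP ->].
    - by rewrite qN ?gZ //; have := subsetP ZN i iZ'; rewrite inE.
    - by rewrite evD evM !ev_lf m1 mulrC divfK ?subrr ?addrN ?ci.
    by rewrite evD evM !ev_lf m2 mulrC divfK ?subrr ?addrN ?ci.
  by split; rewrite ?evX ?dDXn e0 ?expr0n ?expr1 ?(mulr0, mul0r).
- by move: cY xle d7; clear; lia.
- move=> H dH iH; have h1 := split_Y H.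
  have l1 : ((lam i0 \in H) <= 1)%N by case: (_ \in _).
  have [HN|HN] := eqVneq H N.
    rewrite HN capvv (setIC (on N)) LN set0D cards0 in h1.
    by move: h1 l1 cardZ d7; rewrite HN; clear; lia.
  have dHN := plane_trace dN dH iH iN HN.
  have t2 := tri _ (capvSr H N) dHN.
  have d2 : (#|on (H :&: N)%VS :\: Z| <= #|on (H :&: N)%VS|)%N.
    by apply: subset_leq_card; apply: subsetDl.
  have [LH|/(trace_L_le1 Pdist dL) t1] := boolP (L <= H)%VS; last first.
    have d1 : (#|(on H :&: on L) :\: [set b1; b2]| <= #|on H :&: on L|)%N.
      by apply: subset_leq_card; apply: subsetDl.
    by move: h1 t1 t2 d1 d2 l1 d7; clear; lia.
  have HNl : (H :&: N)%VS = l0.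
    apply/eqP; rewrite eq_sym eqEdim dl0 dHN andbT subv_cap l0N andbT.
    by rewrite subv_add (subv_trans (capvSl _ _) LH) -memvE.
  have c1 : (#|on (H :&: N)%VS :\: Z| <= 1)%N.
    apply: leq_trans (_ : #|[set i0]| <= 1)%N; last by rewrite cards1.
    rewrite HNl; apply: subset_leq_card; apply/subsetP => k.
    rewrite !inE => /andP[kZ /partner [->//|kj]]; by rewrite kj jZ in kZ.
  have c2 : (#|(on H :&: on L) :\: [set b1; b2]| <= #|on L :\: [set b1; b2]|)%N.
    by apply: subset_leq_card; apply: setSD; apply: subsetIr.
  by move: h1 c1 c2 cardL bLine l1 d7; clear; lia.
move=> F dF iF; have h1 := split_Y F.
have l1 : ((lam i0 \in F) <= 1)%N by case: (_ \in _).
have d1 : (#|(on F :&: on L) :\: [set b1; b2]| <= #|on F :&: on L|)%N.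
  by apply: subset_leq_card; apply: subsetDl.
have d2 : (#|on (F :&: N)%VS :\: Z| <= #|on (F :&: N)%VS|)%N.
  by apply: subset_leq_card; apply: subsetDl.
have [FN|FN] := boolP (F <= N)%VS.
  have e0 : on F :&: on L = set0.
    apply/setP => i; rewrite !inE; apply/negP => /andP[iF' iL'].
    by case/negP: (off_N LN iL'); apply: (subvP FN).
  have t2 := tri F FN dF; rewrite (capv_idPl FN) in h1 d2.
  rewrite e0 set0D cards0 addn0 in h1.
  by move: h1 d2 t2 l1 d7; clear; lia.
have LF : ~~ (L <= F)%VS.
  apply/negP => LF; have /eqP e : L == F by rewrite eqEdim LF dL dF.
  by move: iL; rewrite e iF.
have t1 := trace_L_le1 Pdist dL LF.
have t2 : (#|on (F :&: N)%VS| <= 1)%N.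
  apply: (on_dim1 Pdist).
  have : (\dim (F :&: N) <= 2)%N by rewrite (leq_trans (dimvS (capvSl F N))) ?dF.
  rewrite leq_eqVlt => /orP[/eqP e|//]; case/negP: FN.
  have /eqP <- : (F :&: N)%VS == F by rewrite eqEdim capvSl e dF.
  exact: capvSr.
by move: h1 d1 d2 t1 t2 l1 d7; clear; lia.
Qed.

End PlaneAndLineConic.

(** * The twisted cubic through six points *)

Section SixPoints.
Variable (K : fieldType).

Definition others (a : 'I_4 -> K) (k : 'I_4) : K * K * K :=
  match val k with
  | 0 => (a (o4 1), a (o4 2), a (o4 3))
  | 1 => (a (o4 0), a (o4 2), a (o4 3))
  | 2 => (a (o4 0), a (o4 1), a (o4 3))
  | _ => (a (o4 0), a (o4 1), a (o4 2))
  end.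

(** At the parameter [(s : t)], the [k]-th coordinate of the curve is [b k] times the product of
    the factors [a l * s - t] for [l] different from [k]. Up to scalars these are Lagrange's
    interpolation polynomials, and the curve passes through the [k]-th coordinate point at [(1 : a
    k)]. *)
Definition lagrange (a b : 'I_4 -> K) : 'M[K]_4 :=
  \matrix_(i, k) (b k * let: (x, y, z) := others a k in
     nth 0 [:: x * y * z; - (x * y + x * z + y * z); x + y + z; -1] i).

Lemma gmap_lagrange a b (u : 'rV[K]_2) k (s := u 0 ord0) (t := u 0 ord_max) :
  (gmap (cubic K) u *m lagrange a b) 0 k =
  b k * let: (x, y, z) := others a k in (x * s - t) * (y * s - t) * (z * s - t).
Proof.
rewrite mxE !big_ord_recl big_ord0 gmap_cubic !mxE /= !subSS !subn0 -/s -/t.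
by case: (others a k) => [[x y] z]; rewrite !expr0; ring.
Qed.

Lemma ord4P (k : 'I_4) : [\/ k = o4 0, k = o4 1, k = o4 2 | k = o4 3].
Proof.
case: k => -[|[|[|[|//]]]] i; [constructor 1 | constructor 2 | constructor 3 | constructor 4];
  exact/val_inj.
Qed.

Definition pt2 (x y : K) : 'rV[K]_2 := \row_j if j == ord0 then x else y.

Lemma gmap_lagrange_pt a b x y k :
  (gmap (cubic K) (pt2 x y) *m lagrange a b) 0 k =
  b k * let: (x1, y1, z1) := others a k in (x1 * x - y) * (y1 * x - y) * (z1 * x - y).
Proof. by rewrite gmap_lagrange !mxE. Qed.

Lemma lagrange_node a b k : injective a -> (forall k, b k != 0) ->
  exists2 c, c != 0 & gmap (cubic K) (pt2 1 (a k)) *m lagrange a b = c *: delta_mx 0 k.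
Proof.
move=> ai b0; pose v := gmap (cubic K) (pt2 1 (a k)) *m lagrange a b.
have ne l : l != k -> a l * 1 - a k != 0 by move=> kl; rewrite mulr1 subr_eq0 (inj_eq ai).
exists (v 0 k); last first.
  apply/rowP => l; rewrite [RHS]mxE [delta_mx _ _ _ _]mxE eqxx /=.
  case: eqVneq => [->|lk]; first by rewrite mulr1.
  rewrite mulr0 gmap_lagrange_pt /others.
  by case: (ord4P l) lk => ->; case: (ord4P k) => -> //= _; rewrite !mulr1 subrr ?mul0r ?mulr0 ?mul0r ?mulr0.
rewrite /v gmap_lagrange_pt mulf_neq0 //; move: ne; rewrite /others.
by case: (ord4P k) => -> ne /=; rewrite !mulf_neq0 ?ne.
Qed.

Lemma lagrange_unit a b : injective a -> (forall k, b k != 0) -> lagrange a b \in unitmx.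
Proof.
move=> ai b0.
have /fin_all_exists2 [c c0 cE] k := @lagrange_node a b k ai b0.
pose W : 'M[K]_4 := \matrix_k gmap (cubic K) (pt2 1 (a k)).
have WE : W *m lagrange a b = diag_mx (\row_k c k).
  apply/row_matrixP => k; rewrite row_mul rowK cE row_diag_mx mxE.
  by [].
have : W *m lagrange a b \in unitmx.
  by rewrite WE unitmxE det_diag unitfE; apply/prodf_neq0 => k _; rewrite mxE.
by rewrite unitmx_mul => /andP[].
Qed.

Variables (I : finType) (P : I -> 'rV[K]_4).
Hypothesis P0 : forall i, P i != 0.
Hypothesis general : forall (c : 'cV[K]_4) (s : seq I), uniq s -> (4 <= size s)%N ->
  (forall i, i \in s -> (P i *m c) 0 0 = 0) -> c = 0.

(** Coordinates [z] are chosen such that the first four points are the coordinate points. General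
    position says that the coordinates of the last two points are nonzero and that their ratios [a
    k] are distinct. If [b] is the last point, the curve of [lagrange] passes through the fifth
    point at the parameter [(1 : 0)] and through the sixth one at [(0 : 1)]. *)
Lemma cubic_through6 (s : seq I) : uniq s -> size s = 6 ->
  exists2 M : 'M[K]_4, M \in unitmx & forall i, i \in s ->
    exists (u : 'rV[K]_2) (t : K), P i = t *: (gmap (cubic K) u *m M).
Proof.
case: s => [//|i0 [//|i1 [//|i2 [//|i3 [//|i4 [//|i5 [|//]]]]]]] us _.
pose Q : 'M[K]_4 := \matrix_k P (nth i0 [:: i0; i1; i2; i3] k).
have Qrow k : row k Q = P (nth i0 [:: i0; i1; i2; i3] k) by rewrite rowK.
have us' : uniq ([:: i0; i1; i2; i3] ++ [:: i4; i5]) := us.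
rewrite cat_uniq in us'; case/and3P: us' => us4 /hasPn hs u45.
have Qu : Q \in unitmx.
  rewrite -unitmx_tr -row_free_unit -kermx_eq0; apply/rowV0P => x /sub_kermxP xQ.
  have Qx : Q *m x^T = 0 by rewrite -[Q]trmxK -trmx_mul xQ trmx0.
  apply: trmx_inj; rewrite trmx0; apply: (general us4) => // i.
  rewrite !inE => hi.
  have [k ->] : exists k : 'I_4, i = nth i0 [:: i0; i1; i2; i3] k.
    by case/or4P: hi => /eqP ->; [exists (o4 0) | exists (o4 1) | exists (o4 2) | exists (o4 3)].
  by rewrite -Qrow -row_mul Qx !mxE.
pose z i := P i *m invmx Q.
have zQ i : z i *m Q = P i by rewrite mulmxKV.
have zk (k : 'I_4) : z (nth i0 [:: i0; i1; i2; i3] k) = delta_mx 0 k.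
  by rewrite /z -Qrow -row_mul mulmxV // row1.
have genz (c : 'cV[K]_4) l : uniq l -> (4 <= size l)%N ->
    (forall i, i \in l -> (z i *m c) 0 0 = 0) -> c = 0.
  move=> ul sl hl; have : invmx Q *m c = 0.
    by apply: (general ul sl) => i il; rewrite mulmxA hl.
  by move/(congr1 (mulmx Q)); rewrite mulKVmx // mulmx0.
have z_neq0 i k : i \in [:: i4; i5] -> z i 0 k != 0.
  move=> hi; apply/eqP => zi0.
  pose l := i :: [seq nth i0 [:: i0; i1; i2; i3] (val j) | j : 'I_4 <- enum 'I_4 & j != k].
  have : (delta_mx k 0 : 'cV[K]_4) = 0.
    apply: (genz _ l).
    - rewrite /l cons_uniq map_inj_in_uniq ?(filter_uniq _ (enum_uniq _)) ?andbT.
        apply/mapP => -[j _ ij]; case/negP: (hs i hi); rewrite ij.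
        by apply: mem_nth; apply: ltn_ord.
      move=> j j' _ _ /eqP; rewrite nth_uniq // => [/eqP/val_inj//||]; exact: ltn_ord.
    - rewrite -[size l]/((size (behead l)).+1) ltnS [behead _]/(map _ _) size_map size_filter; have := count_predC (pred1 k) (enum (ordinal 4)).
      by rewrite size_enum_ord count_uniq_mem ?enum_uniq // mem_enum inE add1n => -[e]; rewrite -[leqLHS]e.
    move=> j; rewrite inE => /orP[/eqP ->|/mapP [j']]; first by rewrite -colE mxE.
    by rewrite mem_filter => /andP[jk _] ->; rewrite zk -colE !mxE eq_sym (negPf jk) andbF.
  by move/matrixP/(_ k 0); rewrite !mxE !eqxx => /eqP; rewrite oner_eq0.
have h4 k : z i4 0 k != 0 by apply: z_neq0; rewrite inE eqxx.
have h5 k : z i5 0 k != 0 by apply: z_neq0; rewrite !inE eqxx orbT.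
pose b k := z i5 0 k; pose a k := b k / z i4 0 k.
have ai : injective a.
  move=> k l kl; apply/eqP; apply: contraT => ne.
  (* equal ratios put the last two points on a plane with two of the coordinate points *)
  pose c : 'cV[K]_4 := z i4 0 l *: delta_mx k 0 - z i4 0 k *: delta_mx l 0.
  have cE i : (z i *m c) 0 0 = z i4 0 l * z i 0 k - z i4 0 k * z i 0 l.
    by rewrite mulmxBr -!scalemxAr -!colE !mxE.
  pose s := i4 :: i5 :: [seq nth i0 [:: i0; i1; i2; i3] (val j) | j : 'I_4 <- enum 'I_4 & (j != k) && (j != l)].
  have : c = 0.
    apply: (genz _ s).
    - rewrite /s !cons_uniq map_inj_in_uniq ?(filter_uniq _ (enum_uniq _)) ?andbT; last first.
        move=> j j' _ _ /eqP; rewrite nth_uniq // => [/eqP/val_inj//||]; exact: ltn_ord.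
      have i45 : i4 != i5 by move: u45; rewrite /= inE andbT.
      rewrite inE negb_or i45 /=; apply/andP; split.
        apply/mapP => -[j _ ij]; case/negP: (hs i4 (mem_head _ _)); rewrite ij.
        by apply: mem_nth; apply: ltn_ord.
      apply/mapP => -[j _ ij]; have i5in : i5 \in [:: i4; i5] by rewrite !inE eqxx orbT.
      case/negP: (hs i5 i5in); rewrite ij; by apply: mem_nth; apply: ltn_ord.
    - rewrite -[size s]/((size (behead (behead s))).+2) !ltnS [behead _]/(map _ _) size_map size_filter.
      have -> : count (fun j : 'I_4 => (j != k) && (j != l)) (enum 'I_4) = #|~: [set k; l]|.
        rewrite cardE -size_filter; apply: perm_size; apply: uniq_perm; [exact/filter_uniq/enum_uniq | exact: enum_uniq | ].
        by move=> j; rewrite mem_filter !mem_enum !inE negb_or andbT.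
      have := cardsC [set k; l]; rewrite cards2 ne card_ord; clear; lia.
    move=> j; rewrite !inE => /or3P[/eqP->|/eqP->|/mapP[j']].
    - by rewrite cE mulrC subrr.
    - have : b k = a k * z i4 0 k by rewrite /a divfK.
      have : b l = a l * z i4 0 l by rewrite /a divfK.
      by rewrite cE -/(b k) -/(b l) => -> ->; rewrite kl; ring.
    rewrite mem_filter => /andP[/andP[jk jl] _] ->; rewrite cE zk !mxE eqxx /=.
    by rewrite !(eq_sym _ j') (negPf jk) (negPf jl) !mulr0 subrr.
  move/matrixP/(_ k 0); rewrite !mxE !eqxx (negPf ne) /= mulr1 mulr0 subr0 => /eqP.
  by move=> e; have /negP[] := h4 l; rewrite mxE.
have Bu := lagrange_unit ai h5.
exists (lagrange a b *m Q); first by rewrite unitmx_mul Bu.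
have through i (u : 'rV[K]_2) t : z i = t *: (gmap (cubic K) u *m lagrange a b) ->
    exists (u : 'rV[K]_2) (t : K), P i = t *: (gmap (cubic K) u *m (lagrange a b *m Q)).
  by move=> e; exists u, t; rewrite mulmxA scalemxAl -e zQ.
have base (k : 'I_4) : exists (u : 'rV[K]_2) (t : K),
    P (nth i0 [:: i0; i1; i2; i3] k) = t *: (gmap (cubic K) u *m (lagrange a b *m Q)).
  have [c c0 cE] := @lagrange_node a b k ai h5.
  by apply: (@through _ (pt2 1 (a k)) c^-1); rewrite zk cE scalerK.
have a0 k : a k != 0 by rewrite mulf_neq0 ?invr_eq0 ?h4 // h5.
move=> i; rewrite !inE => /or4P[/eqP->|/eqP->|/eqP->|].
- exact: (base (o4 0)).
- exact: (base (o4 1)).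
- exact: (base (o4 2)).
case/or3P => /eqP ->; first exact: (base (o4 3)).
  pose t := a (o4 0) * a (o4 1) * a (o4 2) * a (o4 3).
  apply: (@through _ (pt2 1 0) t^-1); apply/rowP => k; rewrite [RHS]mxE gmap_lagrange_pt.
  have -> : b k = a k * z i4 0 k by rewrite /a divfK.
  rewrite /t /others; case: (ord4P k) => -> /=; field; by rewrite !a0.
apply: (@through _ (pt2 0 1) (-1)); apply/rowP => k; rewrite [RHS]mxE gmap_lagrange_pt -/(b k).
by case: (others a k) => [[x y] w]; ring.
Qed.

End SixPoints.

(** * General position forces a twisted cubic *)

Section Quadrics.
Variable K : fieldType.
Local Notation o3 k := (@Ordinal 3 k isT).

Lemma kernel_plane (c : 'cV[K]_4) : c != 0 ->
  exists2 H : {vspace 'rV[K]_4}, \dim H = 3%N & forall v, (v \in H) = ((v *m c) 0 0 == 0).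
Proof.
move=> c0; pose f : 'Hom('rV[K]_4, 'rV[K]_1) := linfun (mulmxr c).
have fE v : (v \in lker f) = ((v *m c) 0 0 == 0).
  rewrite memv_ker lfunE /=; apply/eqP/eqP => [->|h]; first by rewrite mxE.
  by apply/rowP => j; rewrite !ord1 h mxE.
exists (lker f) => //; have := limg_ker_dim f fullv; rewrite capfv [X in _ = X]dimvf dim_matrix.
have : (\dim (limg f) <= 1)%N.
  by apply: leq_trans (dimvS (subvf _)) _; rewrite dimvf dim_matrix.
have : (0 < \dim (limg f))%N.
  rewrite lt0n dimv_eq0; apply: contraNneq c0 => f0; apply/eqP/matrixP => i j.
  have : f (delta_mx 0 i) \in limg f by apply/memv_img/memvf.
  rewrite f0 memv0 lfunE /= -rowE => /eqP/rowP/(_ 0); rewrite !mxE !ord1 => ->.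
  by [].
move: (\dim (lker f)) (\dim (limg f)) => a b b0 b1 e.
have {}e : (a + b = 4)%N := e.
by move: b0 b1 e; clear; lia.
Qed.

Lemma ev_quadric (y : 'rV[K]_4) (a := y 0 (o4 0)) (b := y 0 (o4 1)) (c := y 0 (o4 2)) (e := y 0 (o4 3)) :
  [/\ ev (quadric K (o3 0)) y = a * c - b * b, ev (quadric K (o3 1)) y = a * e - b * c &
      ev (quadric K (o3 2)) y = b * e - c * c].
Proof. by rewrite /quadric /= !(evB, evM, evXU). Qed.

Lemma on_cubic (y : 'rV[K]_4) : (forall k, ev (quadric K k) y = 0) ->
  exists (u : 'rV[K]_2) (t : K), y = t *: gmap (cubic K) u.
Proof.
have := ev_quadric y; set a := y 0 _; set b := y 0 _; set c := y 0 _; set e := y 0 _.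
move=> [q0 q1 q2] h; move: q0 q1 q2; rewrite !h => q0 q1 q2.
have [a0|a0] := eqVneq a 0.
  have b0 : b = 0 by apply/eqP; move/eqP: q0; rewrite a0 mul0r sub0r eq_sym oppr_eq0 mulf_eq0 orbb.
  have c0 : c = 0 by apply/eqP; move/eqP: q2; rewrite b0 mul0r sub0r eq_sym oppr_eq0 mulf_eq0 orbb.
  exists (pt2 0 1), e; apply: row4P; rewrite mxE gmap_cubic !mxE /= ?subSS ?subn0;
    rewrite -/a -/b -/c -/e ?a0 ?b0 ?c0; ring.
have cE : c = b * b / a by apply: (mulIf a0); rewrite divfK // mulrC -[LHS]subr0 q0; ring.
have eE : e = b * c / a by apply: (mulIf a0); rewrite divfK // mulrC -[LHS]subr0 q1; ring.
exists (pt2 a b), (a ^- 2); apply: row4P; rewrite mxE gmap_cubic !mxE /= ?subSS ?subn0;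
  rewrite -/a -/b -/c -/e ?eE ?cE; field; exact: a0.
Qed.

End Quadrics.

Section CurveThrough.
Variables (K : fieldType) (I : finType) (d : nat) (P lam : I -> 'rV[K]_4).
Hypothesis charK : [pchar K] =i pred0.
Hypothesis Pdist : distinct_pts setT P.
Hypothesis hdep : dep d P lam.
Hypothesis lam0 : forall i, lam i != 0.
Hypothesis d7 : (7 <= d)%N.
Hypothesis xle : (2 * #|I| <= 3 * d + 3)%N.
Hypothesis xge : (3 * d + 2 <= 2 * #|I|)%N.
Implicit Types (F G L N H : {vspace 'rV[K]_4}).
Local Notation on := (on P).
Local Notation o3 k := (@Ordinal 3 k isT).
Hypothesis Hspan : forall F, (\dim F < 4)%N -> exists i, P i \notin F.
Hypothesis Hline : forall L, \dim L = 2%N -> (2 * #|on L| <= d.+1)%N.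
Hypothesis Hconic : forall N (g : {mpoly K[4]}), \dim N = 3%N -> g \is 2.-homog ->
  (exists2 v, v \in N & ev g v != 0) -> (forall i, P i \in N -> ev g (P i) = 0) ->
  (#|on N| <= d)%N.

(** Otherwise, a plane with the largest number of points would contradict [residual_line] and
    [no_plane_and_line]. *)
Lemma planes_small H : \dim H = 3%N -> (#|on H| <= 3)%N.
Proof.
move=> dH; rewrite leqNgt; apply/negP => H4.
have [N [dN N4 Nmax]] : exists N, [/\ \dim N = 3%N, (3 < #|on N|)%N &
    forall H', \dim H' = 3%N -> (#|on H'| <= #|on N|)%N].
  have [m hm] : exists m, (#|I| - #|on H| <= m)%N by exists (#|I| - #|on H|)%N.
  elim: m H dH H4 hm => [|m IHm] H dH H4 hm.
    exists H; split=> // H' _; apply: leq_trans (max_card _) _.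
    by move: hm; rewrite leqn0 subn_eq0.
  have [Hmax|nmax] := classic (forall H', \dim H' = 3%N -> (#|on H'| <= #|on H|)%N).
    by exists H.
  have [H' nH'] := not_all_ex_not _ _ nmax; have [dH' /negP] := imply_to_and _ _ nH'.
  rewrite -ltnNge => lt; apply: (IHm H' dH'); first exact: ltn_trans lt.
  by have := max_card (mem (on H')); move: hm lt; clear; lia.
have [L [dL hL LN cov]] := residual_line charK Pdist hdep lam0 d7 xle xge Hspan Hline dN Nmax N4.
exact: (no_plane_and_line charK Pdist hdep lam0 d7 xle xge Hline Hconic dN dL hL LN cov).
Qed.

(** Any plane through the line and one more point has at most three points. *)
Lemma lines_small L : \dim L = 2%N -> (#|on L| <= 2)%N.
Proof.
move=> dL; have [|i iL] := Hspan (F := L); first by rewrite dL.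
have dH : \dim (L + <[P i]>) = 3%N by rewrite dim_add_pt // dL.
rewrite -ltnS; apply: leq_trans (planes_small dH); apply: proper_card; apply/properP; split.
  exact/onS/addvSl.
by exists i; rewrite inE //; apply: (subvP (addvSr L _)); apply: memv_line.
Qed.

Lemma general_position (c : 'cV[K]_4) (s : seq I) : uniq s -> (4 <= size s)%N ->
  (forall i, i \in s -> (P i *m c) 0 0 = 0) -> c = 0.
Proof.
move=> us s4 hs; apply/eqP; apply: contraT => /kernel_plane [H dH HE].
have := planes_small dH; rewrite leqNgt => /negP[]; apply: leq_trans s4 _.
rewrite -(card_uniqP us); apply: subset_leq_card; apply/subsetP => i /hs e.
by rewrite inE HE e.
Qed.

(** The square of [q] kills the points of [Z], and no plane or line has enough points to prevent
    the use of [core_plane]. *)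
Lemma quadric_contains (q : {mpoly K[4]}) (Z : {set I}) : q \is 2.-homog -> (7 <= #|Z|)%N ->
  (forall i, i \in Z -> ev q (P i) = 0) -> forall i, ev q (P i) = 0.
Proof.
move=> hq Z7 qZ i0; apply/eqP; apply: contraT => qi0.
have cY := cardsC Z.
have l1 H : ((lam i0 \in H) <= 1)%N by case: (_ \in _).
have sub H : (#|~: Z :&: on H| <= #|on H|)%N by apply: subset_leq_card; apply: subsetIr.
case: (@core_plane K I d P lam charK Pdist hdep lam0 (d - 5) 4 (~: Z) (q ^+ 2) i0).
- exact: (@dhomogMn _ _ _ 2).
- by move: d7; clear; lia.
- by rewrite evX expf_neq0.
- by rewrite inE; apply: contra qi0 => /qZ ->.
- move=> i; rewrite inE negbK => /qZ e0.
  by split; rewrite ?evX ?dDXn e0 ?expr0n ?expr1 ?(mulr0, mul0r).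
- by move: cY xle d7 Z7; clear; lia.
- move=> H dH _; have := planes_small dH; have := sub H; have := l1 H; move: d7; clear; lia.
by move=> L dL _; have := lines_small dL; have := sub L; have := l1 L; move: d7; clear; lia.
Qed.

(** Take the twisted cubic through six of the points. By [quadric_contains], a quadric that
    contains the curve and one more point of the set contains the whole set. If [P i0] is not on
    the curve, then at each point outside the six the values of the three quadrics [q_k] are
    proportional, by a nonzero factor, to those at [P i0]. The relation [x_0 q_2 - x_1 q_1 + x_2
    q_0 = 0] then puts these points on one plane, against general position. *)
Lemma exists_cubic : exists2 M : 'M[K]_4, M \in unitmx &
  forall i, exists (u : 'rV[K]_2) (t : K), P i = t *: (gmap (cubic K) u *m M).
Proof.
have I12 : (12 <= #|I|)%N by move: xge d7; clear; lia.
pose s := take 6 (enum I).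
have us : uniq s by apply: take_uniq; apply: enum_uniq.
have s6 : size s = 6 by rewrite size_takel // -cardE; apply: leq_trans I12.
have [M Mu Ms] := cubic_through6 general_position us s6.
exists M => // i0; pose y i := P i *m invmx M; pose A i k := ev (quadric K k) (y i).
have As i k : i \in s -> A i k = 0.
  move=> /Ms [u [t e]]; rewrite /A /y e -scalemxAl mulmxK //.
  by rewrite (ev_homogZ _ _ (quadric_homog K k)) ev_quadric_cubic mulr0.
have evQ k i : ev (quadric K k \mPo ltup (invmx M)) (P i) = A i k.
  by rewrite ev_comp gmap_ltup.
have hQ k : quadric K k \mPo ltup (invmx M) \is 2.-homog.
  apply: (@comp_homog _ _ _ 2 1); last exact: quadric_homog.
  by move=> j; rewrite tnth_mktuple; apply: lf_homog.
(* a combination of two quadrics of the net that vanishes at one more point vanishes at all *)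
have net (c1 c2 : K) k1 k2 j : j \notin s -> c1 * A j k1 = c2 * A j k2 ->
    forall i, c1 * A i k1 = c2 * A i k2.
  move=> js e i; apply/eqP; rewrite -subr_eq0 -!evQ -!evZ -evB; apply/eqP.
  apply: (@quadric_contains _ (j |: [set i in s])).
  - by apply: rpredB; apply: rpredZ; apply: hQ.
  - by rewrite cardsU1 inE js cardsE (card_uniqP us) s6.
  move=> l; rewrite evB !evZ !evQ !inE => /orP[/eqP ->|ls].
    by rewrite e subrr.
  by rewrite !As // !mulr0 subrr.
have [A0|] := classic (forall k, A i0 k = 0).
  have [u [t e]] := on_cubic A0; exists u, t.
  by rewrite scalemxAl -e mulmxKV.
case/not_all_ex_not => k0 /eqP Ak0.
have i0s : i0 \notin s by apply: contra Ak0 => /As ->.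
pose c : 'cV[K]_4 := A i0 (o3 2) *: delta_mx (o4 0) 0 - A i0 (o3 1) *: delta_mx (o4 1) 0
  + A i0 (o3 0) *: delta_mx (o4 2) 0.
have cE v : (v *m c) 0 0 = A i0 (o3 2) * v 0 (o4 0) - A i0 (o3 1) * v 0 (o4 1)
    + A i0 (o3 0) * v 0 (o4 2).
  by rewrite mulmxDr mulmxBr -!scalemxAr -!colE !mxE.
have c0 : invmx M *m c = 0.
  apply: (@general_position _ (drop 6 (enum I))).
  - exact/drop_uniq/enum_uniq.
  - rewrite size_drop; have -> : size (enum I) = #|I| by rewrite cardE.
    by move: I12; clear; lia.
  move=> i iS'; have {iS'}iS : i \notin s.
    have := enum_uniq I; rewrite -(cat_take_drop 6 (enum I)) cat_uniq.
    by case/and3P => _ /hasPn /(_ _ iS').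
  rewrite mulmxA -/(y i) cE.
  have Aik : A i k0 != 0.
    apply: contra Ak0 => /eqP h; have := @net 1 0 k0 k0 i iS; rewrite h mulr0 mul0r => /(_ erefl i0).
    by rewrite mul1r mul0r => ->.
  have [r prop] : exists r, forall k, A i0 k = r * A i k.
    exists (A i0 k0 / A i k0) => k; apply: (mulIf Aik).
    have := @net (A i0 k) (A i0 k0) k0 k i0 i0s (mulrC _ _) i.
    by move=> ->; field.
  have [q0 q1 q2] := ev_quadric (y i).
  rewrite (prop (o3 0)) (prop (o3 1)) (prop (o3 2)) /A q0 q1 q2; ring.
have {}c0 : c = 0 by move/(congr1 (mulmx M)): c0; rewrite mulKVmx // mulmx0.
have A0 k : A i0 k = 0.
  have cc j : c j 0 = 0 by rewrite c0 mxE.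
  move: (cc (o4 0)) (cc (o4 1)) (cc (o4 2)).
  rewrite /c !mxE /= !(mulr1, mulr0, addr0, subr0, sub0r, add0r) => h2 /eqP; rewrite oppr_eq0 => /eqP h1 h0.
  by case: k => -[|[|[|//]]] ki; [rewrite -[RHS]h0|rewrite -[RHS]h1|rewrite -[RHS]h2]; congr (A i0 _); apply/val_inj.
by rewrite A0 eqxx in Ak0.
Qed.

End CurveThrough.

(** * Minimally Terracini sets lie on a twisted cubic *)

Section MinimalDependency.
Variable K : fieldType.

Lemma homog2_qp n (g : {mpoly K[n]}) : g \is 2.-homog ->
  exists S : 'M[K]_n, forall y, ev g y = ev (qp S) y.
Proof.
move: g; apply: homog_ind.
- by exists 0 => y; rewrite ev0 ev_qp mulmx0 mul0mx mxE.
- move=> c f g [S1 h1] [S2 h2]; exists (c *: S1 + S2) => y.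
  rewrite evD evZ h1 h2 !ev_qp mulmxDr mulmxDl -scalemxAr -scalemxAl !mxE.
  by [].
move=> m hm; have [i mi] : exists i, (0 < m i)%N.
  apply: NNPP => h; move: hm; rewrite mdegE big1 // => i _.
  by apply/eqP; rewrite -leqn0 leqNgt; apply/negP => mi; apply: h; exists i.
have /mdeg1P [j /eqP mj] : mdeg (m - U_(i))%MM == 1%N.
  have le : (U_(i) <= m)%MM by rewrite lep1mP -lt0n.
  by have := congr1 mdeg (submK le); rewrite mdegD mdeg1 hm addn1 => -[->].
exists (delta_mx i j) => y; rewrite -(@submK _ U_(i) m) ?lep1mP -?lt0n // mpolyXD evM mj !evXU ev_qp.
by rewrite -(mul_delta_mx (0 : 'I_1)) mulmxA -colE -mulmxA -rowE mxE big_ord1 !mxE mulrC.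
Qed.

Variables (I : finType) (d : nat) (P : I -> 'rV[K]_4).
Hypothesis Hspan : forall F : {vspace 'rV[K]_4}, (\dim F < 4)%N -> exists i, P i \notin F.
Hypothesis full_support : forall mu, dep d P mu -> (exists i, mu i = 0) -> forall i, mu i = 0.
Local Notation on := (on P).

(** The points span the space, so a dependency supported on a proper subspace is zero at some
    point, hence everywhere. *)
Lemma no_dep_within (k : nat) (F : {vspace 'rV[K]_4}) (B : 'M[K]_(k, 4)) (R : 'M[K]_(4, k)) w :
  (\dim F < 4)%N -> B *m R = 1%:M -> (forall v, v \in F -> v *m R *m B = v) ->
  dep d (fun i => P i *m R) w -> (forall i, i \notin on F -> w i = 0) -> forall i, w i = 0.
Proof.
move=> dF BR vRB wd w0 i; have [i0 i0F] := Hspan dF.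
have hdep : dep d P (fun i => w i *m B).
  move=> f hf; rewrite -[RHS](dep_linear B wd hf); apply: eq_bigr => j _.
  have [jF|/w0 ->] := boolP (j \in on F); last by rewrite mul0mx !dDl0.
  by rewrite vRB //; rewrite inE in jF.
have /(full_support hdep)/(_ i) : exists i, w i *m B = 0.
  by exists i0; rewrite w0 ?mul0mx // inE.
by move/(congr1 (mulmx^~ R)); rewrite -mulmxA BR mulmx1 mul0mx.
Qed.

(** More points would carry a dependency by [binary_dep]. *)
Lemma line_bound L : \dim L = 2%N -> (2 * #|on L| <= d.+1)%N.
Proof.
move=> dL; rewrite leqNgt; apply/negP => hL.
have [B [R [BR _ vRB]]] := subspace_coords dL.
have [w [w0 [i wi] wd]] := binary_dep (fun i => P i *m R) hL.
by case/eqP: wi; apply: (@no_dep_within _ L B R w) => //; rewrite dL.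
Qed.

(** More points would carry a dependency by [conic_dep]. *)
Lemma conic_bound N (g : {mpoly K[4]}) : \dim N = 3%N -> g \is 2.-homog ->
  (exists2 v, v \in N & ev g v != 0) -> (forall i, P i \in N -> ev g (P i) = 0) ->
  (#|on N| <= d)%N.
Proof.
move=> dN hg [v vN gv] gP; rewrite leqNgt; apply/negP => hN.
have [B [R [BR _ vRB]]] := subspace_coords dN.
have [|S SE] := @homog2_qp _ (g \mPo ltup B).
  by apply: (@comp_homog _ _ _ 2 1) => // j; rewrite tnth_mktuple; apply: lf_homog.
have evS u : u \in N -> ev (qp S) (u *m R) = ev g u.
  by move=> uN; rewrite -SE ev_comp gmap_ltup vRB.
have [||w [w0 [i wi] wd]] := @conic_dep _ _ (on N) (fun i => P i *m R) S (v *m R) d _ _ hN.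
- by rewrite evS.
- by move=> i; rewrite inE => iN; rewrite evS // gP.
by case/eqP: wi; apply: (@no_dep_within _ N B R w) => //; rewrite dN.
Qed.

End MinimalDependency.

Section FromTerracini.
Variable K : fieldType.
Hypothesis charK : [pchar K] =i pred0.
Variables (d x : nat) (S : {fset proj K 3}).
Hypotheses (hd : (7 <= d)%N) (hx : x = (1 + uphalf (3 * d))%N) (hS : #|` S| = x).

(** The failure of [h^1 = 0] gives a nonzero dependency. By minimality a dependency that is zero at
    one point, being one on a proper subset, is zero; this bounds the numbers of points on lines
    and conics and makes [exists_cubic] applicable. *)
Lemma min_Terracini_on_cubic : min_Terracini d x S -> exists2 M : 'M[K]_4, M \in unitmx &
  forall p, p \in S -> exists u v : K,
    (u, v) <> (0, 0) /\ val p = <[veronese 3 u v *m M]>%VS.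
Proof.
case=> [[_ _ h1 hspan] hmin].
pose rep (p : proj K 3) := vpick (val p); have repE : forall p, val p = <[rep p]>%VS := @proj_vpick K 3.
pose P (i : S) := rep (val i).
have Pdist : distinct_pts setT P := rep_distinct S repE.
have d1 : d = d.-1.+1 by move: hd; clear; lia.
have [lam hdep [i1 lami1]] : exists2 lam, dep d P lam & exists i, lam i != 0.
  apply: NNPP => h; case: h1 => c [cc]; apply; move: c cc; rewrite d1.
  apply/(h_zero1P _ _ charK repE) => lam; rewrite -d1 => hlam i; apply/eqP.
  by apply: contraT => li; case: h; exists lam => //; exists i.
have full_support mu : dep d P mu -> (exists i, mu i = 0) -> forall i, mu i = 0.
  move=> hmu [i0 mu0] i; have [->//|ii0] := eqVneq i i0.
  pose A := (S `\ val i0)%fset; have AS : (A `<` S)%fset by apply: fproperD1; apply: valP.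
  have sAS := fproper_sub AS.
  pose f (a : A) : S := fincl sAS a.
  have fi : injective f by move=> a b /(congr1 val) /= /val_inj.
  have fE j : j != i0 -> exists a, j = f a.
    move=> ji; have jA : val j \in A by rewrite !inE (inj_eq val_inj) ji; apply: valP.
    by exists [` jA]%fset; apply: val_inj.
  have := hmin A AS; rewrite d1 => /(h_zero1P _ _ charK repE) hA.
  have [a ->] := fE i ii0; apply: (hA (mu \o f)); rewrite -d1 => g hg.
  rewrite -[RHS](hmu g hg) (bigD1 i0) //= mu0 dDl0 add0r.
  rewrite (eq_bigl (mem (f @: setT))) => [|j].
    by rewrite big_imset /=; [apply: eq_bigl => b; rewrite in_setT | move=> b c _ _ /fi].
  apply/idP/imsetP => [/fE [b ->]|[b _ ->]]; first by exists b; rewrite ?in_setT.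
  by apply/eqP => /(congr1 val) /= e; have := valP b; rewrite /= e !inE eqxx.
have lam0 i : lam i != 0.
  apply: contraNneq lami1 => li; rewrite (full_support lam) //; by exists i.
have Hspan F : (\dim F < 4)%N -> exists i, P i \notin F.
  move=> dF; apply: NNPP => h; move: dF; rewrite ltnNge => /negP[].
  have : (fullv <= F)%VS.
    rewrite -hspan big_seq_fsetE /=; apply/subv_sumP => i _; rewrite repE -memvE.
    by apply: contraT => iF; case: h; exists i.
  by move/dimvS; apply: leq_trans; rewrite dimvf dim_matrix.
have cS : #|{: S}| = x by rewrite -cardfE.
have xle : (2 * #|{: S}| <= 3 * d + 3)%N by rewrite cS hx; lia.
have xge : (3 * d + 2 <= 2 * #|{: S}|)%N by rewrite cS hx; lia.
have Hline := line_bound Hspan full_support.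
have Hconic := conic_bound Hspan full_support.
have [M Mu hM] := exists_cubic charK Pdist hdep lam0 hd xle xge Hspan Hline Hconic.
exists M => // p pS; have [u [t ut]] := hM [` pS]%fset.
have Pp : val p = <[P [` pS]%fset]>%VS by rewrite repE.
have P0 : P [` pS]%fset != 0 by apply: Pdist.1; rewrite in_setT.
have t0 : t != 0 by apply: contraNneq P0; rewrite ut => ->; rewrite scale0r.
exists (u 0 ord0), (u 0 ord_max); split.
  case=> u0 u1; case/eqP: P0; rewrite ut gmap_cubic u0 u1.
  suff -> : veronese 3 0 0 = 0 :> 'rV[K]_4 by rewrite mul0mx scaler0.
  by apply: row4P; rewrite !mxE /= !expr0n /= ?(mul0r, mulr0).
rewrite -gmap_cubic Pp ut; apply/eqP; rewrite eqEdim -memvE memvZ ?memv_line //=.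
by rewrite !dim_vline scaler_eq0 (negPf t0).
Qed.

End FromTerracini.

Theorem theorem1p4 (K : closedFieldType) (charK : [pchar K] =i pred0)
    (d x : nat) (hd : (7 <= d)%N) (hx : x = (1 + uphalf (3 * d))%N)
    (S : {fset proj K 3}) (hS : #|` S| = x) :
  min_Terracini d x S <->
  exists C : proj K 3 -> Prop,
    rational_normal_curve C /\ (forall p, p \in S -> C p).
Proof.
split=> [/(min_Terracini_on_cubic charK hd hx hS) [M Mu SM]|[C [[M Mu CM] SC]]].
  exists (fun p => exists u v : K, (u, v) <> (0, 0) /\ val p = <[veronese 3 u v *m M]>%VS).
  by split=> //; exists M.
by apply: (cubic_min_Terracini charK hd hx hS Mu) => p /SC /CM.
Qed.
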